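(* Let $W$ be the Weyl group of type $E_6$ and let $\mathcal{T}$ and $\mathcal{T}^\vee$ denote the corresponding (real) maximal tori of the simply connected form and of the adjoint form respectively. For each $w\in W$ there is a homotopy equivalence $$\mathcal{T}^w/Z_W(w)\sim(\mathcal{T}^\vee)^w/Z_W(w).$$
   Context: Let $\mathfrak{t}$ be the 6-dimensional Euclidean space containing the $E_6$ root system, with $W$ acting as the group generated by the root reflections. With roots normalised to have squared length 2, let $\Gamma\subset\mathfrak{t}$ be the root lattice and $\Gamma^\vee=\{x\in\mathfrak{t}:\langle x,y\rangle\in\mathbb{Z}\ \text{for all } y\in\Gamma\}$ its dual lattice (the weight lattice). Then $\mathcal{T}=\mathfrak{t}/\Gamma$ is the maximal torus of the compact simply connected Lie group of type $E_6$, and $\mathcal{T}^\vee=\mathfrak{t}/\Gamma^\vee=\mathcal{T}/\mathcal{Z}$ is the maximal torus of the adjoint form, where $\mathcal{Z}$ (cyclic of order 3) is the centre of the simply connected form. $W$ acts on both tori by the induced action; $\mathcal{T}^w$ and $(\mathcal{T}^\vee)^w$ are the fixed sets of $w$, $Z_W(w)$ is the centraliser of $w$ in $W$, and the quotients are the topological orbit spaces of the $Z_W(w)$-action on these fixed sets. *)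

(* Defs.v *)
From HB Require Import structures.
From mathcomp Require Import all_boot all_order all_algebra generic_quotient.
From mathcomp Require Import ring.
From mathcomp Require Import all_classical all_reals all_analysis.

Set Implicit Arguments.
Unset Strict Implicit.
Unset Printing Implicit Defensive.

Import Order.TTheory GRing.Theory Num.Theory.
Import numFieldNormedType.Exports.

Local Open Scope classical_set_scope.
Local Open Scope ring_scope.
Local Open Scope quotient_scope.

(* Only the restriction of H to X x [0, 1] matters. *)
Definition homotopic (R : realType) (X Y : topologicalType) (f g : X -> Y) :=
  exists H : X * R -> Y,
    [/\ {within [set: X] `*` `[0, 1], continuous H},
        forall x, H (x, 0) = f x &
        forall x, H (x, 1) = g x].

Definition homotopy_equivalent (R : realType) (X Y : topologicalType) :=
  exists (f : X -> Y) (g : Y -> X),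
    [/\ continuous f, continuous g,
        homotopic R (g \o f) idfun &
        homotopic R (f \o g) idfun].

Definition dot (R : realType) (n : nat) (x y : 'rV[R]_n) : R :=
  \sum_i x 0 i * y 0 i.

Definition reflection (R : realType) (n : nat) (a x : 'rV[R]_n) : 'rV[R]_n :=
  x - (2 * dot x a / dot a a) *: a.

Record rootSystem (R : realType) (n : nat) := RootSystem {
  root_set : set 'rV[R]_n;
  roots_finite : finite_set root_set;
  roots_span : forall x, exists m (c : 'I_m -> R) (a : 'I_m -> 'rV[R]_n),
    (forall i, root_set (a i)) /\ x = \sum_i c i *: a i;
  roots_neq0 : ~ root_set 0;
  roots_reflection : forall a b,
    root_set a -> root_set b -> root_set (reflection a b);
  roots_integral : forall a b, root_set a -> root_set b ->
    2 * dot b a / dot a a \is a Num.int;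
  roots_reduced : forall a c, root_set a -> root_set (c *: a) -> c = 1 \/ c = -1
}.

Definition is_base (R : realType) (n : nat) (Phi : rootSystem R n)
    (a : 'I_n -> 'rV[R]_n) :=
  [/\ forall i, root_set Phi (a i),
      row_free (\matrix_i a i) &
      forall b, root_set Phi b -> exists k : 'I_n -> int, b = \sum_i a i *~ k i /\
        ((forall i, 0 <= k i) \/ (forall i, k i <= 0))].

(* The Dynkin diagram is the chain 0 - 2 - 3 - 4 - 5 with 1 attached to 3
   (Bourbaki's labelling shifted by one). *)
Definition E6_edges : seq (nat * nat) :=
  [:: (0, 2); (2, 3); (3, 4); (4, 5); (1, 3)]%N.

Definition E6_cartan (i j : 'I_6) : int :=
  if i == j then 2
  else if ((i : nat, j : nat) \in E6_edges) || ((j : nat, i : nat) \in E6_edges)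
  then -1 else 0.

Definition type_E6 (R : realType) (Phi : rootSystem R 6) :=
  exists2 a : 'I_6 -> 'rV[R]_6, is_base Phi a &
    forall i j, 2 * dot (a i) (a j) / dot (a j) (a j) = (E6_cartan i j)%:~R.

(* Reflections being involutions, closure under composition already yields the
   group they generate. *)
Inductive weyl (R : realType) (n : nat) (Phi : rootSystem R n) :
    ('rV[R]_n -> 'rV[R]_n) -> Prop :=
| weyl_id : weyl Phi idfun
| weyl_reflection a w :
    root_set Phi a -> weyl Phi w -> weyl Phi (reflection a \o w).

Definition weyl_centralizer (R : realType) (n : nat) (Phi : rootSystem R n)
    (w : 'rV[R]_n -> 'rV[R]_n) : set ('rV[R]_n -> 'rV[R]_n) :=
  [set u | weyl Phi u /\ u \o w = w \o u].

(* The additive subgroups of R^n stable under the Weyl group of Phi, i.e. those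
   for which the action descends to the quotient. *)
Record weylLattice (R : realType) (n : nat) (Phi : rootSystem R n) :=
  WeylLattice {
  lattice_set : set 'rV[R]_n;
  lattice0 : lattice_set 0;
  latticeB : forall x y, lattice_set x -> lattice_set y -> lattice_set (x - y);
  latticeW : forall w x, weyl Phi w -> lattice_set x -> lattice_set (w x)
}.

Section euclidean.
Context (R : realType) (n : nat).
Implicit Types (x y a : 'rV[R]_n) (c : R).

Lemma dotC x y : dot x y = dot y x.
Proof. by apply: eq_bigr => i _; rewrite mulrC. Qed.

Lemma dotDl x y a : dot (x + y) a = dot x a + dot y a.
Proof. by rewrite /dot -big_split; apply: eq_bigr => i _; rewrite mxE mulrDl. Qed.

Lemma dotZl c x a : dot (c *: x) a = c * dot x a.
Proof. by rewrite /dot mulr_sumr; apply: eq_bigr => i _; rewrite mxE mulrA. Qed.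

Lemma dotBl x y a : dot (x - y) a = dot x a - dot y a.
Proof. by rewrite dotDl -scaleN1r dotZl mulN1r. Qed.

Lemma dotBr x y a : dot a (x - y) = dot a x - dot a y.
Proof. by rewrite dotC dotBl !(dotC a). Qed.

Lemma dot0l a : dot 0 a = 0.
Proof. by rewrite /dot big1 // => i _; rewrite mxE mul0r. Qed.


Lemma reflectionB a x y :
  reflection a (x - y) = reflection a x - reflection a y.
Proof.
by apply/rowP => i; rewrite /reflection dotBl !mxE; ring.
Qed.

Lemma reflectionK a : involutive (reflection a).
Proof.
move=> x; rewrite {1}/reflection.
have -> : 2 * dot (reflection a x) a / dot a a = - (2 * dot x a / dot a a).
  rewrite /reflection dotBl dotZl.
  have [->|aa] := eqVneq (dot a a) 0; first by rewrite invr0 !mulr0 oppr0.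
  by rewrite divfK// mulrBr mulrBl; ring.
by rewrite scaleNr opprK /reflection subrK.
Qed.

Lemma dot_reflection a x y : dot (reflection a x) y = dot x (reflection a y).
Proof.
rewrite /reflection dotBl dotBr dotZl (dotC x (_ *: a)) dotZl (dotC a y).
by rewrite (dotC a x); congr (_ - _); rewrite mulrAC -!mulrA; ring.
Qed.

End euclidean.

Section weyl_group.
Context (R : realType) (n : nat) (Phi : rootSystem R n).
Implicit Types (u v w : 'rV[R]_n -> 'rV[R]_n).

Lemma weylB w x y : weyl Phi w -> w (x - y) = w x - w y.
Proof. by elim=> //= a {}w _ _ ->; rewrite reflectionB. Qed.

Lemma weyl_comp u v : weyl Phi u -> weyl Phi v -> weyl Phi (u \o v).
Proof.
by move=> + Wv; elim=> //= a w Pa _ Ww; exact: weyl_reflection Pa Ww.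
Qed.

Lemma weyl_inv u : weyl Phi u -> exists v,
  [/\ weyl Phi v, cancel u v, cancel v u & forall x y, dot (u x) y = dot x (v y)].
Proof.
elim=> [|a w Pa _ [v [Wv uv vu adj]]]; first by exists idfun; split=> //; exact: weyl_id.
exists (v \o reflection a); split => /=.
- apply: weyl_comp => //; exact: weyl_reflection Pa (weyl_id _).
- by move=> x /=; rewrite reflectionK uv.
- by move=> x /=; rewrite vu reflectionK.
- by move=> x y /=; rewrite dot_reflection adj.
Qed.

Definition root_lattice_set : set 'rV[R]_n :=
  [set x | exists m (k : 'I_m -> int) (a : 'I_m -> 'rV[R]_n),
    (forall i, root_set Phi (a i)) /\ x = \sum_i a i *~ k i].

Definition dual_lattice_set : set 'rV[R]_n :=
  [set x | forall y, root_lattice_set y -> dot x y \is a Num.int].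

Lemma root_lattice0 : root_lattice_set 0.
Proof.
exists 0%N, (fun=> 0), (fun=> 0); split; first by case.
by rewrite big_ord0.
Qed.

Lemma root_lattice_root a (k : int) : root_set Phi a -> root_lattice_set (a *~ k).
Proof. by move=> Pa; exists 1%N, (fun=> k), (fun=> a); split; rewrite ?big_ord1. Qed.

Lemma root_latticeB x y :
  root_lattice_set x -> root_lattice_set y -> root_lattice_set (x - y).
Proof.
move=> [m [k [a [Pa ->]]]] [p [l [b [Pb ->]]]].
exists (m + p)%N, (fun i => match fintype.split i with inl j => k j | inr j => - l j end),
  (fun i => match fintype.split i with inl j => a j | inr j => b j end); split.
  by move=> i; case: fintype.split.
rewrite big_split_ord -sumrN; congr (_ + _); apply: eq_bigr => i _.
  by rewrite -[lshift p i]/(unsplit (inl i)) unsplitK.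
by rewrite -[rshift m i]/(unsplit (inr i)) unsplitK mulrNz.
Qed.

Lemma root_latticeW w x :
  weyl Phi w -> root_lattice_set x -> root_lattice_set (w x).
Proof.
move=> Ww Lx; elim: Ww => //= a {}w Pa _; move: (w x) => {Lx w}x Lx.
rewrite /reflection; have : 2 * dot x a / dot a a \is a Num.int.
  case: Lx => m [k [b [Pb ->]]].
  have -> : dot (\sum_i b i *~ k i) a = \sum_i (k i)%:~R * dot (b i) a.
    have add0 : dot 0 a = 0 by rewrite -[X in dot X a](subrr a) dotBl subrr.
    rewrite (big_morph (fun z => dot z a) (fun y z => dotDl y z a) add0).
    by apply: eq_bigr => i _; rewrite -scaler_int dotZl.
  rewrite mulr_sumr mulr_suml; apply: rpred_sum => i _.
  rewrite mulrCA -mulrA; apply: rpredM; first exact: intr_int.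
  exact: (roots_integral Pa (Pb i)).
by move=> /intrP[k ->]; rewrite scaler_int; apply: root_latticeB => //;
  exact: root_lattice_root.
Qed.

(* When all roots have squared length 2, roots and coroots coincide: the quotient
   by root_lattice is the maximal torus of the simply connected form, and the
   quotient by its dual that of the adjoint form. *)
Definition root_lattice : weylLattice Phi :=
  WeylLattice root_lattice0 root_latticeB root_latticeW.

Lemma dual_lattice0 : dual_lattice_set 0.
Proof. by move=> y _; rewrite -[X in dot X y](subrr y) dotBl subrr rpred0. Qed.

Lemma dual_latticeB x y :
  dual_lattice_set x -> dual_lattice_set y -> dual_lattice_set (x - y).
Proof. by move=> Dx Dy z Lz; rewrite dotBl rpredB ?Dx ?Dy. Qed.

Lemma dual_latticeW w x :
  weyl Phi w -> dual_lattice_set x -> dual_lattice_set (w x).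
Proof.
move=> /weyl_inv[v [Wv _ _ adj]] Dx y Ly; rewrite adj.
by apply: Dx; exact: root_latticeW.
Qed.

Definition dual_lattice : weylLattice Phi :=
  WeylLattice dual_lattice0 dual_latticeB dual_latticeW.

End weyl_group.

Section torus.
Context (R : realType) (n : nat) (Phi : rootSystem R n).
Context (L : weylLattice Phi).
Implicit Types (u v w : 'rV[R]_n -> 'rV[R]_n) (x y : 'rV[R]_n).

Definition congruent x y : bool := `[< lattice_set L (x - y) >].

Lemma congruent_refl : reflexive congruent.
Proof. by move=> x; apply/asboolP; rewrite subrr; exact: lattice0. Qed.

Lemma congruent_sym : symmetric congruent.
Proof.
suff h x y : congruent x y -> congruent y x by move=> x y; apply/idP/idP; exact: h.
move=> /asboolP Lxy; apply/asboolP; rewrite -opprB -sub0r.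
by apply: latticeB => //; exact: lattice0.
Qed.

Lemma congruent_trans : transitive congruent.
Proof.
move=> y x z /asboolP Lxy; rewrite congruent_sym => /asboolP Lzy.
apply/asboolP; suff -> : x - z = (x - y) - (z - y) by exact: latticeB.
by rewrite opprB addrA subrK.
Qed.

Definition congruent_rel :=
  EquivRel congruent congruent_refl congruent_sym congruent_trans.

Definition torus := {eq_quot congruent_rel}.

HB.instance Definition _ := Topological.copy torus (quotient_topology torus).
HB.instance Definition _ := Quotient.on torus.

Definition torus_act w (q : torus) : torus := \pi_torus (w (repr q)).

Lemma torus_eqP x y : \pi_torus x = \pi_torus y <-> lattice_set L (x - y).
Proof. by split=> [/eqmodP/asboolP//|Lxy]; apply/eqmodP/asboolP. Qed.

Lemma torus_act_pi w x :
  weyl Phi w -> torus_act w (\pi_torus x) = \pi_torus (w x).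
Proof.
move=> Ww; apply/torus_eqP; rewrite -(weylB _ _ Ww).
by apply: latticeW => //; apply/torus_eqP; rewrite reprK.
Qed.

Lemma torus_act_id q : torus_act idfun q = q.
Proof. exact: reprK. Qed.

Lemma torus_act_comp u v q : weyl Phi u ->
  torus_act (u \o v) q = torus_act u (torus_act v q).
Proof. by move=> Wu; rewrite {3}/torus_act torus_act_pi. Qed.

Definition torus_fixed w : set torus := [set q | torus_act w q = q].

Lemma torus_fixed_stable w u q : weyl Phi w -> weyl_centralizer Phi w u ->
  torus_fixed w q -> torus_fixed w (torus_act u q).
Proof.
move=> Ww [Wu uw] fq; rewrite /torus_fixed /mkset.
by rewrite -torus_act_comp// -uw torus_act_comp// fq.
Qed.

Definition same_orbit w (p q : torus_fixed w) : bool :=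
  `[< exists2 u, weyl_centralizer Phi w u & torus_act u (val p) = val q >].

Lemma same_orbit_refl w : reflexive (@same_orbit w).
Proof.
move=> p; apply/asboolP; exists idfun; last exact: torus_act_id.
by split=> //; exact: weyl_id.
Qed.

Lemma same_orbit_sym w : symmetric (@same_orbit w).
Proof.
suff h p q : @same_orbit w p q -> same_orbit q p
  by move=> p q; apply/idP/idP; exact: h.
move=> /asboolP[u [Wu uw] pq]; apply/asboolP.
have [v [Wv uv vu _]] := weyl_inv Wu; exists v; first split=> //.
  apply/funext => x /=; rewrite -{1}(vu x).
  by rewrite -[w (u _)]/((w \o u) _) -uw /= uv.
rewrite -pq -torus_act_comp// -[RHS]torus_act_id; congr (torus_act _ _).
exact/funext.
Qed.

Lemma same_orbit_trans w : transitive (@same_orbit w).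
Proof.
move=> q p r /asboolP[u [Wu uw] pq] /asboolP[v [Wv vw] qr]; apply/asboolP.
exists (v \o u); last by rewrite torus_act_comp// pq.
split; first exact: weyl_comp.
by rewrite -compA uw compA vw compA.
Qed.

Definition same_orbit_rel w := EquivRel (@same_orbit w)
  (@same_orbit_refl w) (@same_orbit_sym w) (@same_orbit_trans w).

Definition fixed_orbit_space w := {eq_quot same_orbit_rel w}.

HB.instance Definition _ w :=
  Topological.copy (fixed_orbit_space w) (quotient_topology (fixed_orbit_space w)).
HB.instance Definition _ w := Quotient.on (fixed_orbit_space w).

End torus.

(* Main.v *)
From HB Require Import structures.
Require Import Defs.
From mathcomp Require Import all_boot all_order all_algebra generic_quotient.
From mathcomp Require Import zify ssrZ.
From mathcomp Require Import all_classical all_reals all_analysis.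
From Stdlib Require Import ZArith.
From mathcomp Require Import ring lra.
(**
Let L be the root lattice or its dual, F = {x : w x - x in L} the preimage in
Euclidean space of the set fixed by w, and G the group of maps x |-> u x + l with
u in the centraliser Z of w and l in L. The space attached to L is F / G. As L is
discrete, F is a locally finite union of translates x0 + V of V = ker (w - 1), the
slices, and only finitely many of them are different modulo G. So F / G is a
finite disjoint union of quotients of slices by their stabilisers.

The theorem holds because all these quotients are points up to homotopy for some w,
and all are circles for the others, while the number of slices modulo G does not
depend on L. The stabiliser of a slice contains affine reflections, whose mirrors
<y - x0, b> = k (k an integer) come from finitely many vectors b, the walls. There
is a vector v0 fixed by Z such that the walls span the part K of V orthogonal to
v0. If v0 = 0 the mirrors cut the slice into bounded cells, and its quotient is the
quotient of a cell by a finite group of isometries. Otherwise the cells are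
cylinders with axis v0 and the quotient retracts onto a circle, the quotient of a
line by a group of translations. Circles of different lengths are homotopy
equivalent, so the spaces of the two lattices are compared by scaling v0
(slices_equivalent_lattices).

The retraction (contraction) has to be independent of all choices. It moves x along
a straight segment to a nearest centre, where the centres are the translates by G of
chosen lines c + R v0. In a cell, the integer parts of the <y - x0, b> are constant
and the sum over the walls of (frac <y - x0, b> - 1/2)^2 is a strictly convex
function along K; its critical point is the centre of the cell, and this equation
is preserved by G (target_balanced). Hence two centres which x can reach are equal
or separated by a mirror (walls_separate), and reflecting in that mirror brings one
closer to the other. By descent they are conjugate under G, and nearest ones are
conjugate under the stabiliser of x (target_orbit): the segment is well defined in
the quotient.

What remains concerns E6 only and is a finite computation with integer vectors in
the basis of simple roots. The Weyl group has 25 conjugacy classes; a list of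
representatives is complete because it contains the identity and because the product
of a reflection and a representative is always conjugate to a representative
(weyl_class). Replacing the simple roots by their images under an element of the
group turns a conjugate of a representative into the representative itself
(act_base_weyl). For each of them, and for both lattices, a certificate records the
slices, their walls and centres and the elements of Z that identify slices or
reflect in walls; torus_slice_system turns a certificate accepted by the checker
into the geometric data used above.
*)

Set Implicit Arguments.
Unset Strict Implicit.
Unset Printing Implicit Defensive.

Import Order.TTheory GRing.Theory Num.Theory.
Import numFieldNormedType.Exports.

Local Open Scope classical_set_scope.
Local Open Scope ring_scope.
Local Open Scope quotient_scope.

(** * Euclidean norm *)

Section euclid.
Context (R : realType) (n : nat).
Implicit Types (x y a : 'rV[R]_n) (c : R).

Lemma dotDr x y a : dot a (x + y) = dot a x + dot a y.
Proof. by rewrite dotC dotDl !(dotC a). Qed.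

Lemma dotZr c x a : dot a (c *: x) = c * dot a x.
Proof. by rewrite dotC dotZl (dotC x). Qed.

Lemma dot0r a : dot a 0 = 0.
Proof. by rewrite dotC dot0l. Qed.

Lemma dotNl x y : dot (- x) y = - dot x y.
Proof. by rewrite -scaleN1r dotZl mulN1r. Qed.

Lemma dotNr x y : dot x (- y) = - dot x y.
Proof. by rewrite dotC dotNl dotC. Qed.

Lemma dot_suml I (r : seq I) (F : I -> 'rV[R]_n) y :
  dot (\sum_(i <- r) F i) y = \sum_(i <- r) dot (F i) y.
Proof. by apply: (big_morph (fun z => dot z y)); [move=> *; exact: dotDl|exact: dot0l]. Qed.

Lemma dot_sumr I (r : seq I) (F : I -> 'rV[R]_n) y :
  dot y (\sum_(i <- r) F i) = \sum_(i <- r) dot y (F i).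
Proof. by rewrite dotC dot_suml; apply: eq_bigr => i _; exact: dotC. Qed.

Lemma dot_ge0 x : 0 <= dot x x.
Proof. by apply: sumr_ge0 => i _; rewrite -expr2 sqr_ge0. Qed.

Lemma dot_eq0 x : (dot x x == 0) = (x == 0).
Proof.
apply/eqP/eqP => [|->]; last exact: dot0l.
move/eqP; rewrite /dot psumr_eq0; last by move=> i _; rewrite -expr2 sqr_ge0.
move=> /allP h; apply/rowP => i; rewrite mxE.
by have /eqP := h i (mem_index_enum _); move/eqP; rewrite mulf_eq0 orbb => /eqP.
Qed.

Lemma dot_gt0 x : x != 0 -> 0 < dot x x.
Proof. by rewrite lt0r dot_ge0 dot_eq0 => ->. Qed.

Definition enorm x := Num.sqrt (dot x x).

Lemma enorm_ge0 x : 0 <= enorm x. Proof. exact: sqrtr_ge0. Qed.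

Lemma sqr_enorm x : enorm x ^+ 2 = dot x x.
Proof. by rewrite sqr_sqrtr// dot_ge0. Qed.

Lemma enormZ c x : enorm (c *: x) = `|c| * enorm x.
Proof. by rewrite /enorm dotZl dotZr mulrA -expr2 sqrtrM ?sqr_ge0// sqrtr_sqr. Qed.

Lemma enormN x : enorm (- x) = enorm x.
Proof. by rewrite -scaleN1r enormZ normrN1 mul1r. Qed.

Lemma enorm0 : enorm 0 = 0. Proof. by rewrite /enorm dot0l sqrtr0. Qed.

Lemma cauchy_schwarz x y : `|dot x y| <= enorm x * enorm y.
Proof.
have [->|y0] := eqVneq y 0; first by rewrite dot0r normr0 enorm0 mulr0.
have y2 := dot_gt0 y0.
have := dot_ge0 (dot y y *: x - dot x y *: y).
rewrite !(dotBl, dotBr, dotZl, dotZr) (dotC y x) => h.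
rewrite -(@ler_pXn2r _ 2)// ?nnegrE// ?mulr_ge0 ?enorm_ge0//.
rewrite exprMn !sqr_enorm real_normK ?num_real//.
by rewrite -(ler_pM2l y2); nra.
Qed.

Lemma enormD x y : enorm (x + y) <= enorm x + enorm y.
Proof.
rewrite -(@ler_pXn2r _ 2)// ?nnegrE ?addr_ge0 ?enorm_ge0//.
rewrite sqrrD !sqr_enorm !(dotDl, dotDr) (dotC y x).
have := le_trans (ler_norm _) (cauchy_schwarz x y); lra.
Qed.

Lemma enorm_sqr_le x y : (dot x x <= dot y y) = (enorm x <= enorm y).
Proof. by rewrite ler_sqrt// dot_ge0. Qed.

Lemma coord_le_enorm x i : `|x 0 i| <= enorm x.
Proof.
rewrite -sqrtr_sqr ler_sqrt ?dot_ge0// /dot (bigD1 i)//= -expr2.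
by rewrite lerDl sumr_ge0// => j _; rewrite -expr2 sqr_ge0.
Qed.

Lemma near_enorm x (e : R) : 0 < e -> \forall y \near x, enorm (y - x) < e.
Proof.
move=> e0; have d0 : 0 < e / n.+1%:R by rewrite divr_gt0// ltr0n.
apply/nbhs_ballP; exists (e / n.+1%:R) => //= y [_ xy].
rewrite -(@ltr_pXn2r _ 2)// ?nnegrE ?enorm_ge0 ?ltW// sqr_enorm.
apply: (@le_lt_trans _ _ (\sum_(i < n) (e / n.+1%:R) ^+ 2)).
  apply: ler_sum => i _; rewrite -expr2 -ler_sqrt ?sqr_ge0// !sqrtr_sqr.
  rewrite (gtr0_norm d0) !mxE; have := xy 0 i; rewrite /ball /= distrC.
  by move/ltW.
rewrite sumr_const card_ord -[ltLHS]mulr_natr exprMn.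
rewrite -mulrA gtr_pMr ?exprn_gt0// exprVn mulrC ltr_pdivrMr ?exprn_gt0 ?ltr0n//.
by rewrite mul1r -natrX ltr_nat expnS expn1 mulnS addSn ltnS leq_addr.
Qed.

(** The topology of row vectors comes from the sup norm; the Euclidean norm, which is
  the one preserved by reflections, has the same neighbourhoods. *)
Lemma nbhs_enormP x (A : set 'rV[R]_n) :
  nbhs x A <-> exists2 e : R, 0 < e & forall y, enorm (y - x) < e -> A y.
Proof.
split=> [/nbhs_ballP[e /= e0 h]|[e e0 h]]; last first.
  by apply: filterS (near_enorm x e0) => y; exact: h.
exists e => // y yx; apply: h; split=> // i j; rewrite (ord1 i) /ball /=.
by rewrite distrC (le_lt_trans _ yx)//; have := coord_le_enorm (y - x) j; rewrite !mxE.
Qed.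

End euclid.

(** * The orbit space as a quotient of Euclidean space *)

Section weyl_isometry.
Context (R : realType) (n : nat) (Phi : rootSystem R n).
Implicit Types (u v w : 'rV[R]_n -> 'rV[R]_n) (x y : 'rV[R]_n).

Lemma reflectionD (a x y : 'rV[R]_n) :
  reflection a (x + y) = reflection a x + reflection a y.
Proof. by apply/rowP => i; rewrite /reflection dotDl !mxE; ring. Qed.

Lemma reflectionZ (a x : 'rV[R]_n) c : reflection a (c *: x) = c *: reflection a x.
Proof. by apply/rowP => i; rewrite /reflection dotZl !mxE; ring. Qed.

Lemma weylD w x y : weyl Phi w -> w (x + y) = w x + w y.
Proof. by elim=> //= a {}w _ _ ->; rewrite reflectionD. Qed.

Lemma weylZ w c x : weyl Phi w -> w (c *: x) = c *: w x.
Proof. by elim=> //= a {}w _ _ ->; rewrite reflectionZ. Qed.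

Lemma weyl0 w : weyl Phi w -> w 0 = 0.
Proof. by move=> Ww; rewrite -[X in w X](subrr 0) (weylB _ _ Ww) subrr. Qed.

Lemma weylN w x : weyl Phi w -> w (- x) = - w x.
Proof. by move=> Ww; rewrite -sub0r (weylB _ _ Ww) weyl0// sub0r. Qed.

Lemma weyl_sum w (I : Type) (r : seq I) (F : I -> 'rV[R]_n) : weyl Phi w ->
  w (\sum_(i <- r) F i) = \sum_(i <- r) w (F i).
Proof.
move=> Ww; apply: big_morph; last exact: weyl0.
by move=> x y; exact: weylD.
Qed.

Lemma weyl_dot w x y : weyl Phi w -> dot (w x) (w y) = dot x y.
Proof.
by elim=> //= a {}w _ _ <-; rewrite dot_reflection reflectionK.
Qed.

Lemma weyl_enorm w x : weyl Phi w -> enorm (w x) = enorm x.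
Proof. by move=> Ww; rewrite /enorm weyl_dot. Qed.

Lemma weyl_affine_continuous w l : weyl Phi w -> continuous (fun x => w x + l).
Proof.
move=> Ww x A /nbhs_enormP[e e0 h]; apply/nbhs_enormP; exists e => // y yx.
by apply: h; rewrite opprD addrACA subrr addr0 -(weylB _ _ Ww) weyl_enorm.
Qed.

Lemma centralizer_id w : weyl_centralizer Phi w idfun.
Proof. by split=> //; exact: weyl_id. Qed.

Lemma centralizer_comp w u v : weyl_centralizer Phi w u ->
  weyl_centralizer Phi w v -> weyl_centralizer Phi w (u \o v).
Proof.
move=> [Wu uw] [Wv vw]; split; first exact: weyl_comp.
by rewrite -compA vw compA uw compA.
Qed.

Lemma centralizer_inv w u : weyl_centralizer Phi w u ->
  exists v, [/\ weyl_centralizer Phi w v, cancel u v & cancel v u].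
Proof.
move=> [Wu uw]; have [v [Wv uv vu _]] := weyl_inv Wu; exists v; split=> //.
split=> //; apply/funext => x /=; rewrite -{1}(vu x).
by rewrite -[w (u _)]/((w \o u) _) -uw /= uv.
Qed.

Lemma centralizer_comm w u x : weyl_centralizer Phi w u -> u (w x) = w (u x).
Proof. by move=> [_ uw]; rewrite -[RHS]/((w \o u) x) -uw. Qed.

End weyl_isometry.

Section orbit_map.
Context (R : realType) (n : nat) (Phi : rootSystem R n) (L : weylLattice Phi).
Context (w : 'rV[R]_n -> 'rV[R]_n) (Ww : weyl Phi w).
Implicit Types (x y : 'rV[R]_n).
Local Notation X := (fixed_orbit_space L w).

Lemma latticeN x : lattice_set L x -> lattice_set L (- x).
Proof. by move=> Lx; rewrite -sub0r; apply: latticeB => //; exact: lattice0. Qed.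

Lemma latticeD x y : lattice_set L x -> lattice_set L y -> lattice_set L (x + y).
Proof. by move=> Lx Ly; rewrite -(opprK y); apply/latticeB/latticeN. Qed.

Definition fixed_lift : set 'rV[R]_n := [set x | lattice_set L (w x - x)].

Lemma fixed_liftP x : fixed_lift x <-> torus_fixed (L := L) w (\pi_(torus L) x).
Proof.
by rewrite /torus_fixed /= torus_act_pi//; split=> [|/torus_eqP]//; move=> ?; exact/torus_eqP.
Qed.

Lemma fixed_lift0 : fixed_lift 0.
Proof. by rewrite /fixed_lift /= (weyl0 Ww) subrr; exact: lattice0. Qed.

Definition fixed_pt x (Fx : fixed_lift x) : torus_fixed (L := L) w :=
  exist _ (\pi_(torus L) x) (mem_set (proj1 (fixed_liftP x) Fx)).

(** Total on Euclidean space, so that no proof of fixed_lift has to be carried around.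
  The value outside fixed_lift is that of 0 and has no meaning. *)
Definition orbit_of x : X :=
  match pselect (fixed_lift x) with
  | left Fx => \pi_X (fixed_pt Fx)
  | right _ => \pi_X (fixed_pt fixed_lift0)
  end.

Lemma orbit_ofE x (Fx : fixed_lift x) : orbit_of x = \pi_X (fixed_pt Fx).
Proof.
rewrite /orbit_of; case: pselect => // Fx'.
by congr (\pi_X _); exact: val_inj.
Qed.

Lemma fixed_lift_act u l x : weyl_centralizer Phi w u -> lattice_set L l ->
  fixed_lift x -> fixed_lift (u x + l).
Proof.
move=> Zu Ll Fx; have Wu : weyl Phi u by case: Zu.
rewrite /fixed_lift /= (weylD _ _ Ww) -(centralizer_comm _ Zu) opprD addrACA -(weylB _ _ Wu).
apply: latticeD; first exact: latticeW.
by apply: latticeB => //; exact: latticeW.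
Qed.

Lemma orbit_ofP x y : fixed_lift x -> fixed_lift y ->
  orbit_of x = orbit_of y <-> exists u l,
    [/\ weyl_centralizer Phi w u, lattice_set L l & y = u x + l].
Proof.
move=> Fx Fy; rewrite (orbit_ofE Fx) (orbit_ofE Fy).
have E : \pi_X (fixed_pt Fx) = \pi_X (fixed_pt Fy) <->
   exists2 u, weyl_centralizer Phi w u & torus_act (L := L) u (\pi_(torus L) x) = \pi_(torus L) y.
  by split=> [/eqmodP/asboolP//|h]; apply/eqmodP/asboolP.
rewrite E; split=> [[u Zu]|[u [l [Zu Ll ->]]]].
  have [Wu _] := Zu; rewrite torus_act_pi// => /torus_eqP Ll.
  exists u, (y - u x); split=> //; last by rewrite addrC subrK.
  by rewrite -opprB; exact: latticeN.
exists u => //; have [Wu _] := Zu; rewrite torus_act_pi//.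
by apply/torus_eqP; rewrite opprD addrA subrr add0r; exact: latticeN.
Qed.

Lemma orbit_of_act u l x : fixed_lift x -> weyl_centralizer Phi w u ->
  lattice_set L l -> orbit_of (u x + l) = orbit_of x.
Proof.
move=> Fx Zu Ll; apply/esym/orbit_ofP => //; first exact: fixed_lift_act.
by exists u, l.
Qed.

Lemma fixed_pt_surj (t : torus_fixed (L := L) w) : exists x (Fx : fixed_lift x),
  t = fixed_pt Fx.
Proof.
have Ft : fixed_lift (repr (val t)).
  by apply/fixed_liftP; rewrite reprK; exact: (set_mem (valP t)).
by exists (repr (val t)), Ft; apply: val_inj; rewrite /= reprK.
Qed.

Lemma orbit_of_surj (p : X) : exists2 x, fixed_lift x & orbit_of x = p.
Proof.
have [x [Fx E]] := fixed_pt_surj (repr p).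
by exists x => //; rewrite (orbit_ofE Fx) -E reprK.
Qed.

Lemma orbit_of_continuous x (A : set X) : fixed_lift x -> nbhs (orbit_of x) A ->
  \forall y \near x, fixed_lift y -> A (orbit_of y).
Proof.
move=> Fx; rewrite (orbit_ofE Fx) nbhsE => -[B [oB Bx] BA].
case: (oB) => W oW WB.
have oW' : open (\pi_(torus L) @^-1` W) by [].
have Wx : (\pi_(torus L) @^-1` W) x.
  rewrite /= -[\pi_(torus L) x]/(set_val (fixed_pt Fx)).
  by rewrite -[W _]/((set_val @^-1` W) (fixed_pt Fx)) WB.
have := open_nbhs_nbhs (conj oW' Wx); apply: filterS => y Wy Fy.
apply: BA; rewrite (orbit_ofE Fy).
by rewrite -[B _]/((\pi_X @^-1` B) (fixed_pt Fy)) -WB.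
Qed.

(** The set of points with an orbit meeting B is a union of preimages of B under affine
  maps, one for each element of the affine group, hence it is open. *)
Lemma orbit_of_open x (A : set 'rV[R]_n) : fixed_lift x -> nbhs x A ->
  nbhs (orbit_of x) [set orbit_of y | y in A `&` fixed_lift].
Proof.
move=> Fx; rewrite nbhsE => -[B [oB Bx] BA].
rewrite nbhsE; exists [set orbit_of y | y in B `&` fixed_lift]; last first.
  by move=> _ [y [By Fy] <-]; exists y => //; split=> //; exact: BA.
split; last by exists x.
pose W := [set t : torus L | exists y u l, [/\ t = \pi_(torus L) y,
  weyl_centralizer Phi w u, lattice_set L l & B (u y + l)]].
exists W.
  have -> : open W = open (\pi_(torus L) @^-1` W) by [].
  have -> : \pi_(torus L) @^-1` W =
      \bigcup_(i in [set p : ('rV[R]_n -> 'rV[R]_n) * 'rV[R]_n |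
         weyl_centralizer Phi w p.1 /\ lattice_set L p.2]) [set y | B (i.1 y + i.2)].
    apply/seteqP; split=> y /=.
      move=> [z [u [l [/torus_eqP yz Zu Ll Bz]]]]; have [Wu _] := Zu.
      exists (u, l - u (y - z)); first split=> //=.
        by apply: latticeB => //; exact: latticeW.
      rewrite /=; suff -> : u y + (l - u (y - z)) = u z + l by [].
      by rewrite (weylB _ _ Wu) opprB addrCA [u y + _]addrC subrK addrC.
    by move=> [[u l] /= [Zu Ll] Bul]; exists y, u, l.
  apply: bigcup_open => -[u l] /= [[Wu _] Ll].
  apply: (@open_comp _ _ (fun y => u y + l) B) => // y _.
  by have := @weyl_affine_continuous R n Phi u l Wu y.
apply/seteqP; split=> t /=.
  move=> [y [u [l [ty Zu Ll Bu]]]].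
  have [x' [Fx' tx']] := fixed_pt_surj t.
  have Fy : fixed_lift y by apply/fixed_liftP; rewrite -ty; exact: (set_mem (valP t)).
  have -> : t = fixed_pt Fy by apply: val_inj; rewrite /= -ty.
  exists (u y + l); first by split=> //; exact: fixed_lift_act.
  by rewrite -(orbit_ofE Fy) orbit_of_act.
have [y [Fy ->]] := fixed_pt_surj t; rewrite -(orbit_ofE Fy).
move=> [z [Bz Fz]] /esym/(orbit_ofP Fy Fz)[u [l [Zu Ll E]]].
by exists y, u, l; split=> //; rewrite -E.
Qed.

End orbit_map.

(** * Isolated minima and the affine group of the torus *)

Section isolated_minimum.
Context (R : realType) (T : eqType) (f : T -> R).

Lemma seq_min (s : seq T) x : x \in s ->
  exists2 y, y \in s & forall z, z \in s -> f y <= f z.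
Proof.
elim: s x => // a s IH x _; case: s IH => [|b s] IH.
  by exists a; rewrite ?mem_seq1// => z; rewrite mem_seq1 => /eqP->.
have [y ys my] := IH b (mem_head _ _).
have [fya|fay] := leP (f y) (f a).
  exists y; first by rewrite inE ys orbT.
  by move=> z; rewrite inE => /predU1P[->//|]; exact: my.
exists a; first exact: mem_head.
move=> z; rewrite inE => /predU1P[->//|/my]; exact/le_trans/ltW.
Qed.

Lemma seq_gap (s : seq T) (c : R) : exists2 e : R, 0 < e <= 1 &
  forall z, z \in s -> c < f z -> c + e <= f z.
Proof.
elim: s => [|a s [e /andP[e0 e1] he]]; first by exists 1; rewrite ?ltr01 ?lexx.
have [ca|ac] := ltP c (f a); last first.
  exists e; first by rewrite e0.
  by move=> z; rewrite inE => /predU1P[->|]; [rewrite ltNge ac|exact: he].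
exists (Num.min e (f a - c)).
  by rewrite lt_min e0 subr_gt0 ca ge_min e1.
move=> z; rewrite inE => /predU1P[->|zs] cz.
  by rewrite addrC -lerBrDr ge_min lexx orbT.
by apply: le_trans (he z zs cz); rewrite lerD2l ge_min lexx.
Qed.

(** Finite sublevel sets give a minimum and also a gap above it. The gap is used for
  the continuity of the contraction: a point almost as near as a nearest one is nearest. *)
Lemma isolated_min (A : set T) a : A a ->
  (forall r, finite_set [set x | A x /\ f x <= r]) ->
  exists x, [/\ A x, forall y, A y -> f x <= f y &
    exists2 e, 0 < e & forall y, A y -> f y < f x + e -> f y <= f x].
Proof.
move=> Aa /(_ (f a + 1))/finite_seqP[s sE].
have sP y : y \in s <-> A y /\ f y <= f a + 1.
  suff -> : (y \in s) <-> [set` s] y by rewrite -sE.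
  by [].
have as_ : a \in s by apply/sP; split=> //; rewrite lerDl.
have [x xs mx] := seq_min as_.
have [e /andP[e0 e1] he] := seq_gap s (f x).
have [Ax _] := (sP x).1 xs.
have fxa := mx _ as_.
exists x; split=> //.
  move=> y Ay; have [h|/ltW h] := leP (f y) (f a + 1); first by apply/mx/sP.
  by apply: le_trans h; rewrite (le_trans fxa)// lerDl.
exists e => // y Ay ye; rewrite leNgt; apply/negP => xy.
have ys : y \in s by apply/sP; split=> //; rewrite (le_trans (ltW ye))// lerD.
by have := he y ys xy; rewrite leNgt ye.
Qed.

End isolated_minimum.

Section affine_group.
Context (R : realType) (n : nat) (Phi : rootSystem R n) (L : weylLattice Phi).
Context (w : 'rV[R]_n -> 'rV[R]_n).
Implicit Types (x y : 'rV[R]_n) (g h : 'rV[R]_n -> 'rV[R]_n).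

(** The semidirect product of the centraliser and the lattice; its orbits in fixed_lift
  are the points of the orbit space. *)
Definition affine_group : set ('rV[R]_n -> 'rV[R]_n) :=
  [set g | exists u l, [/\ weyl_centralizer Phi w u, lattice_set L l & g = fun x => u x + l]].

Lemma affine_group_id : affine_group idfun.
Proof.
exists idfun, 0; split; [exact: centralizer_id|exact: lattice0|].
by apply/funext => x; rewrite addr0.
Qed.

Lemma affine_group_comp g h : affine_group g -> affine_group h -> affine_group (g \o h).
Proof.
move=> [u [l [Zu Ll ->]]] [v [k [Zv Lk ->]]]; have [Wu _] := Zu.
exists (u \o v), (u k + l); split.
- exact: centralizer_comp.
- by apply: latticeD => //; exact: latticeW.
- by apply/funext => x /=; rewrite (weylD _ _ Wu) addrA.
Qed.

Lemma affine_group_inv g : affine_group g ->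
  exists h, [/\ affine_group h, cancel g h & cancel h g].
Proof.
move=> [u [l [Zu Ll ->]]]; have [v [Zv uv vu]] := centralizer_inv Zu.
have [Wv _] := Zv; have [Wu _] := Zu; exists (fun x => v x + - v l); split.
- by exists v, (- v l); split=> //; apply: latticeN; exact: latticeW.
- by move=> x; rewrite (weylD _ _ Wv) uv addrK.
- by move=> x; rewrite (weylD _ _ Wu) (weylN _ Wu) !vu addrNK.
Qed.

Lemma affine_group_diff g : affine_group g ->
  exists2 u, weyl_centralizer Phi w u & forall x y, g x - g y = u (x - y).
Proof.
move=> [u [l [Zu _ ->]]]; exists u => // x y; have [Wu _] := Zu.
by rewrite opprD addrACA subrr addr0 (weylB _ _ Wu).
Qed.

Lemma affine_group_enorm g x y : affine_group g -> enorm (g x - g y) = enorm (x - y).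
Proof.
by move=> /affine_group_diff[u [Wu _] ->]; exact: weyl_enorm Wu.
Qed.

Lemma affine_group_conv g x y (t : R) : affine_group g ->
  g (t *: x + (1 - t) *: y) = t *: g x + (1 - t) *: g y.
Proof.
move=> [u [l [[Wu _] _ ->]]]; rewrite (weylD _ _ Wu) !(weylZ _ _ Wu) !scalerDr [RHS]addrACA.
by rewrite -[in RHS]scalerDl addrCA subrr addr0 scale1r.
Qed.

Hypothesis Ww : weyl Phi w.

Lemma affine_group_fixed g x : affine_group g ->
  fixed_lift L w x -> fixed_lift L w (g x).
Proof. by move=> [u [l [Zu Ll ->]]]; exact: fixed_lift_act. Qed.

Lemma orbit_of_affine g x : affine_group g -> fixed_lift L w x ->
  orbit_of L Ww (g x) = orbit_of L Ww x.
Proof. by move=> [u [l [Zu Ll ->]]] Fx; exact: orbit_of_act. Qed.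

Lemma orbit_of_eq x y : fixed_lift L w x -> fixed_lift L w y ->
  orbit_of L Ww x = orbit_of L Ww y -> exists2 g, affine_group g & g x = y.
Proof.
move=> Fx Fy /(orbit_ofP Ww Fx Fy)[u [l [Zu Ll ->]]].
by exists (fun x => u x + l) => //; exists u, l.
Qed.

End affine_group.

(** * Slices, walls and centres *)

(** Integer parts of bounded functions take finitely many values. *)
Lemma finite_of_floors (R : realType) (T : Type) (A : set T) (k : nat)
    (F : 'I_k -> T -> R) (M : R) :
  (forall d, A d -> forall j, `|F j d| <= M) ->
  (forall d e, A d -> A e -> (forall j, Num.floor (F j d) = Num.floor (F j e)) -> d = e) ->
  finite_set A.
Proof.
move=> FM Finj.
have [N [N0 hN]] : exists N : int, 0 <= N /\
    forall d, A d -> forall j, - N <= Num.floor (F j d) <= N.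
  exists (`|Num.floor M| + 1); split=> [|d Ad j]; first by rewrite addr_ge0.
  have := FM d Ad j; rewrite ler_norml => /andP[h1 h2].
  have M1 := le_floor h2.
  have M2 := le_floor h1.
  have M3 := le_trans M1 (ler_norm _).
  have M4 : - (Num.floor M + 1) <= Num.floor (- M).
    by rewrite floor_ge_int mulrNz lerN2 ltW// floorD1_gt.
  rewrite (le_trans M3) ?lerDl// andbT (le_trans _ M2)// (le_trans _ M4)//.
  by rewrite lerN2 lerD2r ler_norm.
pose f d := [ffun j : 'I_k => inord (absz (Num.floor (F j d) + N)) : 'I_(absz (N + N)).+1].
have finj : {in A &, injective f}.
  move=> d e /set_mem Ad /set_mem Ae /ffunP fde; apply: Finj => // j.
  have := fde j; rewrite !ffunE => /(congr1 val) /=.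
  have /andP[] := hN d Ad j; have /andP[] := hN e Ae j.
  move: (Num.floor (F j d)) (Num.floor (F j e)) => p q h1 h2 h3 h4.
  by rewrite !inordK; lia.
have := inj_card_eq finj; rewrite card_eq_le => /andP[_ /card_le_finite]; apply.
exact: finite_finset.
Qed.

Definition frac (R : realType) (y : R) : R := y - (Num.floor y)%:~R.

Lemma fracD_int (R : realType) (y z : R) : z \is a Num.int -> frac (z + y) = frac y.
Proof.
by move=> zi; rewrite /frac floorDzr// intrD opprD addrACA floorK// subrr add0r.
Qed.

Section slices.
Context (R : realType) (n : nat) (Phi : rootSystem R n).
Context (w : 'rV[R]_n -> 'rV[R]_n) (Ww : weyl Phi w).
Context (v0 : 'rV[R]_n).
Implicit Types (x y d : 'rV[R]_n) (g h u : 'rV[R]_n -> 'rV[R]_n).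

Definition fixed_space : set 'rV[R]_n := [set x | w x = x].

Definition contracted_space : set 'rV[R]_n := [set x | w x = x /\ dot x v0 = 0].

(** The geometry of the slices x0 i + ker (w - 1), one for each orbit of the affine group
  on slices. The vector v0 is the direction that survives the contraction (0 if nothing
  does). S i is the list of walls of slice i: it is closed under the centraliser, the
  stabiliser of the slice shifts the functions <y - x0 i, b> by integers, every mirror
  <y - x0 i, b> = k is fixed by an element acting as a reflection, and the walls
  span the orthogonal complement of v0 in ker (w - 1). The point c i is off all mirrors
  and solves the equation of a centre (see balanced). *)
Record slice_system (L : weylLattice Phi) (m : nat) (x0 c : 'I_m -> 'rV[R]_n)
    (S : 'I_m -> seq 'rV[R]_n) : Prop := SliceSystem {
  slice_cover : forall x, fixed_lift L w x ->
    exists i u l, [/\ weyl_centralizer Phi w u, lattice_set L l &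
      fixed_space (u x + l - x0 i)];
  slice_uniq : forall i j u l, weyl_centralizer Phi w u -> lattice_set L l ->
    fixed_space (u (x0 i) + l - x0 j) -> i = j;
  slice_fixed : forall i, fixed_lift L w (x0 i);
  slice_perp : forall i, dot (x0 i) v0 = 0;
  wall_contracted : forall i b, b \in S i -> contracted_space b;
  wall_perm : forall i u, weyl_centralizer Phi w u -> perm_eq (map u (S i)) (S i);
  wall_int : forall i u l b, weyl_centralizer Phi w u -> lattice_set L l ->
    fixed_space (u (x0 i) + l - x0 i) -> b \in S i ->
    dot (u (x0 i) + l - x0 i) b \is a Num.int;
  wall_reflection : forall i b (k : int), b \in S i ->
    exists u l, [/\ weyl_centralizer Phi w u, lattice_set L l,
      forall v, fixed_space v -> u v = reflection b v &
      u (x0 i) + l - x0 i = (2 * k%:~R / dot b b) *: b];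
  wall_span : forall i v, contracted_space v ->
    (forall b, b \in S i -> dot v b = 0) -> v = 0;
  centre_contracted : forall i, contracted_space (c i - x0 i);
  centre_off_walls : forall i b, b \in S i -> dot (c i - x0 i) b \isn't a Num.int;
  centre_balanced : forall i,
    \sum_(b <- S i) (frac (dot (c i - x0 i) b) - 2^-1) *: b = 0
}.

Lemma fixed_spaceD x y : fixed_space x -> fixed_space y -> fixed_space (x + y).
Proof. by rewrite /fixed_space /= (weylD _ _ Ww) => -> ->. Qed.

Lemma fixed_spaceB x y : fixed_space x -> fixed_space y -> fixed_space (x - y).
Proof. by rewrite /fixed_space /= (weylB _ _ Ww) => -> ->. Qed.

Lemma fixed_spaceZ c x : fixed_space x -> fixed_space (c *: x).
Proof. by rewrite /fixed_space /= (weylZ _ _ Ww) => ->. Qed.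

Lemma fixed_space_act u x : weyl_centralizer Phi w u ->
  fixed_space x -> fixed_space (u x).
Proof. by move=> Zu; rewrite /fixed_space /= -(centralizer_comm _ Zu) => ->. Qed.

Hypothesis v0_fixed : forall u, weyl_centralizer Phi w u -> u v0 = v0.

Lemma w_centralizer : weyl_centralizer Phi w w. Proof. by []. Qed.

Lemma v0_fixed_space : fixed_space v0.
Proof. by apply: v0_fixed; exact: w_centralizer. Qed.

Lemma dot_v0_act u x : weyl_centralizer Phi w u -> dot (u x) v0 = dot x v0.
Proof. by move=> Zu; rewrite -{1}(v0_fixed Zu) (weyl_dot _ _ (proj1 Zu)). Qed.

Lemma contracted_spaceB x y :
  contracted_space x -> contracted_space y -> contracted_space (x - y).
Proof.
move=> [Vx xv] [Vy yv]; split; last by rewrite dotBl xv yv subrr.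
exact: fixed_spaceB.
Qed.

Lemma contracted_spaceN x : contracted_space x -> contracted_space (- x).
Proof.
move=> Kx; rewrite -sub0r; apply: contracted_spaceB => //.
by split; [exact: weyl0 Ww|rewrite dot0l].
Qed.

Lemma contracted_spaceD x y :
  contracted_space x -> contracted_space y -> contracted_space (x + y).
Proof. by move=> Kx Ky; rewrite -(opprK y); apply/contracted_spaceB/contracted_spaceN. Qed.

Lemma contracted_spaceZ c x : contracted_space x -> contracted_space (c *: x).
Proof. by move=> [Vx xv]; split; [exact: fixed_spaceZ|rewrite dotZl xv mulr0]. Qed.

Lemma contracted_space_act u x : weyl_centralizer Phi w u ->
  contracted_space x -> contracted_space (u x).
Proof.
by move=> Zu [Vx xv]; split; [exact: fixed_space_act|rewrite dot_v0_act].
Qed.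

Context (L : weylLattice Phi) (m : nat) (x0 c : 'I_m -> 'rV[R]_n).
Context (S : 'I_m -> seq 'rV[R]_n) (HS : slice_system L x0 c S).
Local Notation G := (affine_group L w).
Local Notation F := (fixed_lift L w).

(** The translates of the lines c i + R v0, which are points when v0 = 0. *)
Definition centre : set 'rV[R]_n :=
  [set d | exists i g s, G g /\ d = g (c i + s *: v0)].

(** The centres that x can reach without leaving its slice and without moving along v0. *)
Definition target x : set 'rV[R]_n := [set d | centre d /\ contracted_space (d - x)].

Definition nearest x d :=
  target x d /\ forall d', target x d' -> enorm (d - x) <= enorm (d' - x).

(** Away from the mirrors the integer parts are constant, and this sum is half the gradient
  of the sum of the (frac <y - x0 i, b> - 1/2)^2. So these are the critical points in the
  cells that the mirrors cut out. *)
Definition balanced i y :=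
  (forall b, b \in S i -> dot (y - x0 i) b \isn't a Num.int) /\
  \sum_(b <- S i) (frac (dot (y - x0 i) b) - 2^-1) *: b = 0.

Lemma fixed_liftV x y : F x -> fixed_space (y - x) -> F y.
Proof.
rewrite /fixed_lift /fixed_space /= (weylB _ _ Ww) => Fx Vyx.
suff -> : w y - y = w x - x by [].
by rewrite -(subrK (w x) (w y)) Vyx addrAC [y - x]addrC addrK addrC.
Qed.

Lemma centre_act g d : G g -> centre d -> centre (g d).
Proof.
move=> Gg [i [h [s [Gh ->]]]]; exists i, (g \o h), s; split=> //.
exact: affine_group_comp.
Qed.

Lemma centreD d s : centre d -> centre (d + s *: v0).
Proof.
move=> [i [g [t [[u [l [Zu Ll ->]]] ->]]]]; exists i, (fun x => u x + l), (t + s).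
split; first by exists u, l.
have [Wu _] := Zu.
rewrite scalerDl addrA (weylD (c i + _) _ Wu) (weylZ s _ Wu) (v0_fixed Zu).
by rewrite addrAC.
Qed.

Lemma target_act g x d : G g -> target x d -> target (g x) (g d).
Proof.
move=> Gg [Cd Kd]; split; first exact: centre_act.
have [u Zu ->] := affine_group_diff Gg; exact: contracted_space_act.
Qed.

Lemma nearest_act g x d : G g -> nearest x d -> nearest (g x) (g d).
Proof.
move=> Gg [Td md]; split; first exact: target_act.
move=> d' Td'; have [h [Gh gh hg]] := affine_group_inv Gg.
rewrite (affine_group_enorm _ _ Gg) (le_trans (md (h d') _))//.
  by rewrite -{1}(gh x); exact: target_act.
by rewrite -(affine_group_enorm _ _ Gg) hg.
Qed.

(** An element of the affine group that maps slice j into slice i forces j = i. It then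
  permutes the walls and changes the <y - x0 i, b> by integers only, so that the equation
  satisfied by c i holds for all centres of the slice. *)
Lemma target_balanced i x d : fixed_space (x - x0 i) -> target x d ->
  fixed_space (d - x0 i) /\ balanced i d.
Proof.
move=> Vx [[j [g [s [[u [l [Zu Ll ->]]] ->]]]] [Vd _]].
have [Wu _] := Zu.
have Vg : fixed_space (u (c j + s *: v0) + l - x0 i).
  by rewrite -[X in fixed_space X](subrKA x); exact: fixed_spaceD.
have [Vc Kc] := centre_contracted HS j.
have Vt : fixed_space (c j - x0 j + s *: v0).
  by apply: fixed_spaceD => //; apply: fixed_spaceZ; exact: v0_fixed_space.
have E : u (c j + s *: v0) + l - x0 i =
    u (c j - x0 j + s *: v0) + (u (x0 j) + l - x0 i).
  have -> : c j + s *: v0 = c j - x0 j + s *: v0 + x0 j by rewrite addrAC subrK.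
  by rewrite (weylD _ (x0 j) Wu) !addrA.
have Vl : fixed_space (u (x0 j) + l - x0 i).
  rewrite -[X in fixed_space X](addKr (u (c j - x0 j + s *: v0))) -E addrC.
  by apply: fixed_spaceB => //; exact: fixed_space_act.
have ji := slice_uniq HS Zu Ll Vl; subst j.
have [v [Zv uv vu]] := centralizer_inv Zu; have [Wv _] := Zv.
have dotE b : b \in S i -> dot (u (c i + s *: v0) + l - x0 i) b =
    dot (u (x0 i) + l - x0 i) b + dot (c i - x0 i) (v b).
  move=> bS; rewrite E dotDl addrC; congr (_ + _).
  have [_ bv] := contracted_space_act Zv (wall_contracted HS bS).
  by rewrite -(weyl_dot _ _ Wv) uv dotDl dotZl (dotC v0) bv mulr0 addr0.
have vS b : b \in S i -> v b \in S i.
  by move=> bS; rewrite -(perm_mem (wall_perm HS i Zv)) map_f.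
split=> //; split=> [b bS|].
  rewrite dotE// rpredDl; last exact: (wall_int HS Zu Ll Vl bS).
  by apply: (centre_off_walls HS); exact: vS.
rewrite -(perm_big _ (wall_perm HS i Zu)) big_map /=.
transitivity (u (\sum_(b <- S i) (frac (dot (c i - x0 i) b) - 2^-1) *: b)).
  rewrite (weyl_sum _ _ Wu); apply: eq_big_seq => b bS.
  have ubS : u b \in S i by rewrite -(perm_mem (wall_perm HS i Zu)) map_f.
  rewrite dotE// uv fracD_int ?(weylZ _ _ Wu)//.
  exact: (wall_int HS Zu Ll Vl ubS).
by rewrite (centre_balanced HS) (weyl0 Wu).
Qed.

(** Subtract the two equations: the sum of the <d - e, b> b vanishes since the integer parts
  agree. Paired with d - e it is a sum of squares, so d - e is orthogonal to all walls. *)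
Lemma balanced_uniq i d e : balanced i d -> balanced i e ->
  contracted_space (d - e) ->
  (forall b, b \in S i -> Num.floor (dot (d - x0 i) b) = Num.floor (dot (e - x0 i) b)) ->
  d = e.
Proof.
move=> [_ bd] [_ be] Kde fl; apply/eqP; rewrite -subr_eq0; apply/eqP.
apply: (wall_span HS (i := i)) => //.
have sq : \sum_(b <- S i) dot (d - e) b ^+ 2 = 0.
  transitivity (dot (d - e) (\sum_(b <- S i) dot (d - e) b *: b)).
    by rewrite dot_sumr; apply: eq_bigr => b _; rewrite dotZr expr2.
  suff -> : \sum_(b <- S i) dot (d - e) b *: b = 0 by rewrite dot0r.
  transitivity (\sum_(b <- S i) (frac (dot (d - x0 i) b) - 2^-1) *: b -
      \sum_(b <- S i) (frac (dot (e - x0 i) b) - 2^-1) *: b); last by rewrite bd be subrr.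
  rewrite -sumrB.
  apply: eq_big_seq => b bS; rewrite -scalerBl /frac fl//; congr (_ *: _).
  by rewrite !dotBl; ring.
move=> b bS; apply/eqP; rewrite -sqrf_eq0.
have /eqP := sq; rewrite (perm_big _ (perm_to_rem bS)) big_cons paddr_eq0 ?sqr_ge0//.
  by case/andP.
by apply: sumr_ge0 => *; rewrite sqr_ge0.
Qed.

Lemma wall_reflectionP i b (k : int) : b \in S i -> exists2 g, G g &
  forall y, fixed_space (y - x0 i) ->
    g y = y - (2 * (dot (y - x0 i) b - k%:~R) / dot b b) *: b.
Proof.
move=> bS; have [u [l [Zu Ll uE lE]]] := wall_reflection HS k bS.
exists (fun y => u y + l); first by exists u, l.
move=> y Vy; have [Wu _] := Zu.
have -> : u y + l = u (y - x0 i) + (u (x0 i) + l - x0 i) + x0 i.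
  by rewrite (weylB _ _ Wu); apply/rowP => j; rewrite !mxE; ring.
rewrite uE// lE /reflection.
apply/rowP => j; rewrite !mxE; ring.
Qed.

Lemma wall_neq0 i b : b \in S i -> 0 < dot b b.
Proof.
move=> bS; apply: dot_gt0; apply/eqP => b0.
by have := centre_off_walls HS bS; rewrite b0 dot0r rpred0.
Qed.

(** Reflecting z in the mirror changes its squared distance to y by a positive multiple
  of the product of the two signed distances to the mirror: it decreases exactly when
  y and z are on opposite sides. *)
Lemma wall_dist i b (k : R) y z : b \in S i ->
  dot (y - (z - (2 * (dot (z - x0 i) b - k) / dot b b) *: b))
      (y - (z - (2 * (dot (z - x0 i) b - k) / dot b b) *: b)) =
  dot (y - z) (y - z) + 4 / dot b b * ((dot (y - x0 i) b - k) * (dot (z - x0 i) b - k)).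
Proof.
move=> /wall_neq0/lt0r_neq0 b0.
rewrite opprB addrCA -[y + _]opprB -addrC.
rewrite !(dotDl, dotDr, dotBl, dotBr, dotNl, dotNr, dotZl, dotZr) !(dotC b).
by rewrite (dotC z y); field.
Qed.

(** Different centres have different integer parts at some wall, and neither of them lies
  on a mirror; the larger integer part is the level of a separating mirror. *)
Lemma walls_separate i x d e : fixed_space (x - x0 i) -> target x d -> target x e ->
  d <> e -> exists b (k : int), b \in S i /\
    (dot (d - x0 i) b - k%:~R) * (dot (e - x0 i) b - k%:~R) < 0.
Proof.
move=> Vx Td Te de.
have [_ Bd] := target_balanced Vx Td; have [_ Be] := target_balanced Vx Te.
have Kde : contracted_space (d - e).
  by rewrite -(subrKA x) -[x - e]opprB; apply: contracted_spaceB; [case: Td|case: Te].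
have [h|/existsNP[b /not_implyP[bS /eqP fl]]] :=
    pselect (forall b, b \in S i -> Num.floor (dot (d - x0 i) b) = Num.floor (dot (e - x0 i) b)).
  by case: de; exact: (balanced_uniq Bd Be Kde h).
have sep p q : p \isn't a Num.int -> q \isn't a Num.int ->
    Num.floor p < Num.floor q :> int ->
    p - (Num.floor q)%:~R < 0 :> R /\ 0 < q - (Num.floor q)%:~R :> R.
  move=> pi qi pq; rewrite subr_lt0 -floor_lt_int pq subr_gt0 lt_neqAle floor_le andbT.
  by split=> //; apply: contra qi => /eqP <-; exact: intr_int.
have di := Bd.1 b bS; have ei := Be.1 b bS.
case/lt_total/orP: fl => fl.
  exists b, (Num.floor (dot (e - x0 i) b)); split=> //.
  by have [h1 h2] := sep _ _ di ei fl; rewrite nmulr_rlt0.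
exists b, (Num.floor (dot (d - x0 i) b)); split=> //.
by have [h1 h2] := sep _ _ ei di fl; rewrite pmulr_rlt0.
Qed.

(** The centres x can reach are determined by the integer parts of the <d - x0 i, b>, and these
  are bounded on balls. *)
Lemma target_finite i x (r : R) : fixed_space (x - x0 i) ->
  finite_set [set d | target x d /\ enorm (d - x) <= r].
Proof.
move=> Vx; pose F (j : 'I_(size (S i))) d := dot (d - x0 i) (S i)`_j.
pose B := \sum_(j < size (S i)) enorm (S i)`_j.
have Bj (j : 'I_(size (S i))) : enorm (S i)`_j <= B.
  by rewrite /B (bigD1 j)//= lerDl sumr_ge0// => *; exact: enorm_ge0.
apply: (@finite_of_floors R _ _ _ F ((r + enorm (x - x0 i)) * B)).
  move=> d [_ dr] j; apply: le_trans (cauchy_schwarz _ _) _.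
  apply: ler_pM => //; rewrite ?enorm_ge0//.
  by rewrite -(subrKA x) (le_trans (enormD _ _))// lerD2r.
move=> d e [Td _] [Te _] fl.
have [_ Bd] := target_balanced Vx Td; have [_ Be] := target_balanced Vx Te.
apply: (balanced_uniq Bd Be).
  by rewrite -(subrKA x) -[x - e]opprB; apply: contracted_spaceB; [case: Td|case: Te].
by move=> b /(nthP 0)[j js <-]; exact: (fl (Ordinal js)).
Qed.

(** Among the images of d by admissible elements take the one closest to e. If it is not e,
  a mirror separates the two, and the reflection brings it closer to e. The reflection is
  admissible: when d and e are nearest to x, so is the image of d, and x cannot lie strictly
  on one side of the mirror, as the reflection would bring one of the two nearest centres
  closer to x. So x lies on the mirror and is fixed. *)
Lemma target_orbit_slice i x d e : fixed_space (x - x0 i) -> target x d -> target x e ->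
  exists g, [/\ G g, g d = e & nearest x d -> nearest x e -> g x = x].
Proof.
move=> Vx Td Te.
pose A := [set a | target x a /\
  exists g, [/\ G g, g d = a & nearest x d -> nearest x e -> g x = x]].
have Ad : A d by split=> //; exists idfun; split=> //; exact: affine_group_id.
have finA r : finite_set [set a | A a /\ enorm (a - e) <= r].
  apply: sub_finite_set (target_finite (r + enorm (e - x)) Vx) => a /= [[Ta _] ar].
  by split=> //; rewrite -(subrKA e) (le_trans (enormD _ _))// lerD2r.
have [a [[Ta [g [Gg ga gx]]] amin _]] := isolated_min Ad finA.
have [aE|/eqP ae] := eqVneq a e; first by exists g; rewrite -aE in gx *.
have [b [k [bS sep]]] := walls_separate Vx Ta Te ae.
have [h Gh hE] := wall_reflectionP k bS.
have Vt t : target x t -> fixed_space (t - x0 i).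
  by move=> /(target_balanced Vx)[].
have b2 := wall_neq0 bS; have b4 : 0 < 4 / dot b b by rewrite divr_gt0.
have Tr t : target x t -> target x (h t).
  move=> Tt; split; first by apply: centre_act => //; case: Tt.
  rewrite hE; last exact: Vt.
  rewrite addrAC; apply: contracted_spaceB; first by case: Tt.
  by apply: contracted_spaceZ; exact: (wall_contracted HS bS).
have closer y t : target x t -> (dot (y - x0 i) b - k%:~R) * (dot (t - x0 i) b - k%:~R) < 0 ->
    enorm (h t - y) < enorm (t - y).
  move=> Tt neg; rewrite ltNge -enorm_sqr_le -ltNge.
  rewrite -[h t - y]opprB dotNl dotNr opprK hE; last exact: Vt.
  by rewrite wall_dist// -[y - t]opprB dotNl dotNr opprK gtrDl nmulr_llt0.
have Aha : A (h a).
  split; first exact: Tr.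
  exists (h \o g); split; [exact: affine_group_comp|by rewrite /= ga|].
  move=> nd ne; rewrite /= gx// hE//.
  suff -> : dot (x - x0 i) b - k%:~R = 0 by rewrite mulr0 mul0r scale0r subr0.
  have [_ na] : nearest x a by rewrite -ga -{1}(gx nd ne); exact: nearest_act.
  have far t : nearest x t -> 0 <= (dot (x - x0 i) b - k%:~R) * (dot (t - x0 i) b - k%:~R).
    move=> [Tt mt]; rewrite leNgt; apply/negP => /(closer _ _ Tt).
    by rewrite ltNge mt//; exact: Tr.
  (* x is on the side of a and on the side of e, which are opposite sides. *)
  have := mulr_ge0 (far a (conj Ta na)) (far e ne).
  rewrite mulrACA -expr2 nmulr_lge0// => p2.
  by apply/eqP; rewrite -sqrf_eq0 eq_le p2 sqr_ge0.
have := amin _ Aha; rewrite leNgt closer//.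
by rewrite mulrC.
Qed.

Lemma slice_coverP x : F x -> exists i, exists2 g, G g & fixed_space (g x - x0 i).
Proof.
move=> /(slice_cover HS)[i [u [l [Zu Ll V]]]].
by exists i, (fun y => u y + l) => //; exists u, l.
Qed.

Lemma target_orbit x d e : F x -> target x d -> target x e ->
  exists g, [/\ G g, g d = e & nearest x d -> nearest x e -> g x = x].
Proof.
move=> /slice_coverP[i [g Gg Vgx]] Td Te.
have [h [Gh ghx hgx]] := affine_group_inv Gg.
have [k [Gk kE kx]] := target_orbit_slice Vgx (target_act Gg Td) (target_act Gg Te).
exists (h \o (k \o g)); split.
- by apply: affine_group_comp => //; exact: affine_group_comp.
- by rewrite /= kE ghx.
- by move=> nd ne; rewrite /= kx ?ghx//; exact: nearest_act.
Qed.

Lemma centre_perp i : dot (c i) v0 = 0.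
Proof.
have [_] := centre_contracted HS i.
by rewrite dotBl (slice_perp HS) subr0.
Qed.

Definition height x := dot x v0 / dot v0 v0.

Lemma target_slice i x : fixed_space (x - x0 i) -> target x (c i + height x *: v0).
Proof.
move=> Vx; split.
  by exists i, idfun, (height x); split=> //; exact: affine_group_id.
have [Vc _] := centre_contracted HS i; split.
  have -> : c i + height x *: v0 - x = c i - x0 i - (x - x0 i) + height x *: v0.
    by apply/rowP => j; rewrite !mxE; ring.
  apply: fixed_spaceD; first exact: fixed_spaceB.
  by apply: fixed_spaceZ; exact: v0_fixed_space.
rewrite !(dotBl, dotDl, dotZl) centre_perp add0r /height.
have [->|v0n] := eqVneq v0 0; first by rewrite !dot0r mulr0 subrr.
by rewrite divfK ?dot_eq0// subrr.
Qed.

Lemma nearest_exists x : F x -> exists d, nearest x d /\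
  exists2 e, 0 < e & forall d', target x d' ->
    enorm (d' - x) < enorm (d - x) + e -> nearest x d'.
Proof.
move=> /slice_coverP[i [g Gg Vgx]].
have [h [Gh ghx hgx]] := affine_group_inv Gg.
have finT r : finite_set [set d | target (g x) d /\ enorm (d - g x) <= r].
  exact: (target_finite r Vgx).
have [d [Td md [e e0 he]]] := isolated_min (target_slice Vgx) finT.
have nd : nearest (g x) d := conj Td md.
exists (h d); split; first by rewrite -{1}(ghx x); exact: nearest_act.
exists e => // d' Td' lt; rewrite -(ghx d') -(ghx x); apply: (nearest_act Gh).
split; first exact: target_act.
move=> d'' Td''; apply: le_trans (md _ Td''); apply: he; first exact: target_act.
by rewrite (affine_group_enorm _ _ Gg) -[in ltRHS](hgx d) (affine_group_enorm _ _ Gg).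
Qed.

Lemma height_bound x : enorm (height x *: v0) <= enorm x.
Proof.
have [->|v0n] := eqVneq v0 0; first by rewrite scaler0 enorm0 enorm_ge0.
rewrite enormZ /height normrM normfV (ger0_norm (dot_ge0 _)) -(sqr_enorm v0).
have e0 : 0 < enorm v0 by rewrite sqrtr_gt0 dot_gt0.
rewrite expr2 invfM -!mulrA mulVf ?gt_eqF// mulr1.
by rewrite ler_pdivrMr// cauchy_schwarz.
Qed.

Lemma height_split x : fixed_space x -> contracted_space (x - height x *: v0).
Proof.
move=> Vx; split.
  by apply: fixed_spaceB => //; apply: fixed_spaceZ; exact: v0_fixed_space.
rewrite dotBl dotZl /height; have [->|v0n] := eqVneq v0 0; first by rewrite !dot0r mulr0 subrr.
by rewrite divfK ?dot_eq0// subrr.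
Qed.

Lemma heightD x y : height (x + y) = height x + height y.
Proof. by rewrite /height dotDl mulrDl. Qed.

Lemma heightB x y : height (x - y) = height x - height y.
Proof. by rewrite /height dotBl mulrBl. Qed.

Lemma height_act u x : weyl_centralizer Phi w u -> height (u x) = height x.
Proof. by move=> Zu; rewrite /height dot_v0_act. Qed.

Lemma heightZv0 s : height (s *: v0) *: v0 = s *: v0.
Proof.
have [->|v0n] := eqVneq v0 0; first by rewrite !scaler0.
by rewrite /height dotZl mulfK ?dot_eq0.
Qed.

Hypothesis L_discrete : exists2 e : R, 0 < e &
  forall l, lattice_set L l -> enorm l < e -> l = 0.

(** The displacement w y - y takes values in a discrete set, so it is locally constant on
  fixed_lift: nearby points lie in the same slice. *)
Lemma fixed_lift_near x : F x -> exists2 e : R, 0 < e &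
  forall y, F y -> enorm (y - x) < e -> fixed_space (y - x).
Proof.
move=> Fx; have [e e0 he] := L_discrete; exists (e / 2); first by rewrite divr_gt0.
move=> y Fy yx; apply/eqP; rewrite -subr_eq0; apply/eqP; apply: he.
  have -> : w (y - x) - (y - x) = (w y - y) - (w x - x).
    by rewrite (weylB _ _ Ww); apply/rowP => j; rewrite !mxE; ring.
  exact: latticeB.
by rewrite (le_lt_trans (enormD _ _))// enormN (weyl_enorm _ Ww); lra.
Qed.

Local Notation q := (orbit_of L Ww).

Definition seg x d (t : R) := t *: x + (1 - t) *: d.

Lemma seg_fixed x d t : F x -> target x d -> F (seg x d t).
Proof.
move=> Fx [_ [Vd _]]; apply: (fixed_liftV Fx).
have -> : seg x d t - x = (1 - t) *: (d - x) by apply/rowP => j; rewrite !mxE; ring.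
exact: fixed_spaceZ.
Qed.

(** The points of the segment depend only on the orbit of x: any two choices of x and of
  a nearest centre are related by one element of the affine group. *)
Lemma seg_orbit x d x' d' t : F x -> F x' -> q x = q x' ->
  nearest x d -> nearest x' d' -> q (seg x d t) = q (seg x' d' t).
Proof.
move=> Fx Fx' xx' nd nd'.
have [g Gg gx] := orbit_of_eq Fx Fx' xx'.
have ngd : nearest x' (g d) by rewrite -gx; exact: nearest_act.
have [k [Gk kE kx]] := target_orbit Fx' (proj1 ngd) (proj1 nd').
have -> : seg x' d' t = k (g (seg x d t)).
  by rewrite /seg (affine_group_conv _ _ _ Gg) (affine_group_conv _ _ _ Gk) gx kE kx.
have Fs := seg_fixed t Fx (proj1 nd).
by rewrite (orbit_of_affine Ww Gk) ?(orbit_of_affine Ww Gg)//; exact: affine_group_fixed.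
Qed.

(** Moving x to x0' within the slice, split the displacement into a part along v0, which moves
  centres to centres, and a part in the contracted space, which changes distances by
  at most its norm. The gap at x0' shows that a nearest centre of x becomes a nearest
  centre of x0'. *)
Lemma target_near x0' d0 : F x0' -> nearest x0' d0 -> forall e : R, 0 < e ->
  (forall d', target x0' d' -> enorm (d' - x0') < enorm (d0 - x0') + e -> nearest x0' d') ->
  forall x d, fixed_space (x - x0') -> enorm (x - x0') < e / 2 -> nearest x d ->
    exists2 d', nearest x0' d' & enorm (d - d') <= enorm (x - x0').
Proof.
move=> Fx0 [[Cd0 Kd0] md0] e e0 he x d Vx xe [[Cd Kd] md].
set s := height (x - x0'); set k := x - x0' - s *: v0.
have Kk : contracted_space k by exact: height_split.
have kE : x - x0' = k + s *: v0 by rewrite subrK.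
have kx : enorm k <= enorm (x - x0').
  rewrite kE; move: Kk => [_]; clearbody k => kv.
  rewrite -enorm_sqr_le !(dotDl, dotDr, dotZl, dotZr) (dotC v0 k) kv.
  by rewrite !mulr0 addr0 add0r lerDl mulrA -expr2 mulr_ge0 ?sqr_ge0 ?dot_ge0.
exists (d - s *: v0); last by rewrite opprB addrCA subrr addr0 height_bound.
have Cd' : centre (d - s *: v0) by rewrite -scaleNr; exact: centreD.
apply: he.
  split=> //; have -> : d - s *: v0 - x0' = d - x + k.
    by apply/rowP => j; rewrite !mxE; ring.
  exact: contracted_spaceD.
have h1 : enorm (d - x) <= enorm (d0 - x0') + enorm k.
  have -> : enorm (d0 - x0') + enorm k = enorm (d0 - x0') + enorm (- k) by rewrite enormN.
  apply: le_trans (enormD _ _).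
  have -> : d0 - x0' - k = d0 + s *: v0 - x by apply/rowP => j; rewrite !mxE; ring.
  apply: md; split; first exact: centreD.
  have -> : d0 + s *: v0 - x = d0 - x0' - k by apply/rowP => j; rewrite !mxE; ring.
  exact: contracted_spaceB.
have -> : d - s *: v0 - x0' = d - x + k by apply/rowP => j; rewrite !mxE; ring.
by apply: le_lt_trans (enormD _ _) _; lra.
Qed.

(** At time t the orbit of x is sent to the orbit of t x + (1 - t) d, where d is a centre nearest
  to x. Continuity holds because nearest centres of nearby points are close to nearest
  centres of the limit point, and all of those give the same orbit. *)
Lemma contraction : exists H : fixed_orbit_space L w * R -> fixed_orbit_space L w,
  [/\ {within [set: fixed_orbit_space L w] `*` `[0, 1], continuous H},
      forall x d, F x -> target x d -> H (q x, 0) = q d &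
      forall p, H (p, 1) = p].
Proof.
have /choice[rep repP] : forall p : fixed_orbit_space L w,
    exists xd : 'rV[R]_n * 'rV[R]_n, [/\ F xd.1, q xd.1 = p & nearest xd.1 xd.2].
  move=> p; have [x Fx xp] := orbit_of_surj Ww p.
  by have [d [nd _]] := nearest_exists Fx; exists (x, d).
pose H (pt : fixed_orbit_space L w * R) := q (seg (rep pt.1).1 (rep pt.1).2 pt.2).
have HE x d t : F x -> nearest x d -> H (q x, t) = q (seg x d t).
  by move=> Fx nd; have [F' q' n'] := repP (q x); rewrite /H /=; exact: seg_orbit.
exists H; split.
- apply/subspace_continuousP => -[p0 t0] [_ /=]; rewrite in_itv /= => t01.
  have [x1 Fx1 x1p] := orbit_of_surj Ww p0.
  have [d1 [nd1 [e1 e10 he1]]] := nearest_exists Fx1.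
  rewrite -x1p => O; rewrite /from_subspace (HE _ _ _ Fx1 nd1) => OH.
  have Fs := seg_fixed t0 Fx1 (proj1 nd1).
  have /nbhs_enormP[e e0 he] := orbit_of_continuous Fs OH.
  have [e2 e20 he2] := fixed_lift_near Fx1.
  set r := enorm (d1 - x1).
  have r0 : 0 < r + 1 by rewrite ltr_wpDl ?enorm_ge0.
  (* e1 / 2 for the gap, e2 to stay in the slice, e / 4 for the distance. *)
  set dl := Num.min (Num.min (e1 / 2) e2) (e / 4).
  have dl0 : 0 < dl by rewrite !lt_min e20 !divr_gt0.
  have dt0 : 0 < e / (2 * (r + 1)) by rewrite divr_gt0// mulr_gt0.
  have B : nbhs x1 [set y | enorm (y - x1) < dl] by exact: near_enorm.
  have A1 := orbit_of_open Ww Fx1 B.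
  exists ([set q y | y in [set y | enorm (y - x1) < dl] `&` F],
          ball t0 (e / (2 * (r + 1)))).
    by split=> //=; exact: nbhsx_ballx.
  move=> [p t] /= [[x [xdl Fx] <-] tt0] [_]; rewrite in_itv /= => /andP[t_0 t_1].
  have [d [nd _]] := nearest_exists Fx.
  rewrite (HE _ _ _ Fx nd).
  move: xdl; rewrite /dl !lt_min => /andP[/andP[xe1 xe2] xe].
  have [d' nd' dd'] := target_near Fx1 nd1 e10 he1 (he2 _ Fx xe2) xe1 nd.
  have [g [Gg gd gx]] := target_orbit Fx1 (proj1 nd') (proj1 nd1).
  have Fst := seg_fixed t Fx (proj1 nd).
  rewrite -(orbit_of_affine Ww Gg Fst); apply: he; last exact: affine_group_fixed.
  have -> : seg x1 d1 t0 = g (seg x1 d' t0) by rewrite /seg (affine_group_conv _ _ _ Gg) gd gx.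
  rewrite (affine_group_enorm _ _ Gg).
  have -> : seg x d t - seg x1 d' t0 =
      t *: (x - x1) + (1 - t) *: (d - d') + (t0 - t) *: (d' - x1).
    by apply/rowP => j; rewrite !mxE; ring.
  apply: le_lt_trans (enormD _ _) _.
  apply: (@le_lt_trans _ _ (enorm (x - x1) + enorm (x - x1) + `|t0 - t| * r)).
    apply: lerD; last by rewrite enormZ ler_wpM2l//; exact: (proj2 nd' _ (proj1 nd1)).
    apply: le_trans (enormD _ _) _; rewrite !enormZ ger0_norm// ger0_norm ?subr_ge0//.
    have := enorm_ge0 (x - x1); have := enorm_ge0 (d - d'); nra.
  have : `|t0 - t| * r < e / 2.
    apply: (@le_lt_trans _ _ (`|t0 - t| * (r + 1))); first by rewrite ler_wpM2l// lerDl.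
    by move: tt0; rewrite /ball /= invfM mulrA ltr_pdivlMr.
  lra.
- move=> x d Fx Td; have [e [ne _]] := nearest_exists Fx.
  rewrite (HE _ _ _ Fx ne) /seg scale0r add0r subr0 scale1r.
  have [g [Gg <- _]] := target_orbit Fx (proj1 ne) Td.
  by rewrite (orbit_of_affine Ww Gg)//; apply: (fixed_liftV Fx); case: (proj1 ne) => _ [].
- move=> p; have [x Fx <-] := orbit_of_surj Ww p; have [e [ne _]] := nearest_exists Fx.
  by rewrite (HE _ _ _ Fx ne) /seg subrr scale0r addr0 scale1r.
Qed.

End slices.

(** * Comparison of two lattices *)

Section compare.
Context (R : realType) (n : nat) (Phi : rootSystem R n).
Context (w : 'rV[R]_n -> 'rV[R]_n) (Ww : weyl Phi w) (v0 : 'rV[R]_n).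
Hypothesis v0_fixed : forall u, weyl_centralizer Phi w u -> u v0 = v0.
Local Notation V := (fixed_space w).
Local Notation height := (height v0).

Definition discrete_lattice (L : weylLattice Phi) := exists2 e : R, 0 < e &
  forall l, lattice_set L l -> enorm l < e -> l = 0.

(** The translations of the axis v0 of the slice that come from its stabiliser. Their group
  is the period lattice of the circle onto which the quotient of the slice retracts. *)
Definition slice_shift (L : weylLattice Phi) (x0 : 'rV[R]_n) : set R :=
  [set t | exists u l, [/\ weyl_centralizer Phi w u, lattice_set L l,
     V (u x0 + l - x0) & t = height l]].

Section one.
Context (L : weylLattice Phi) (m : nat) (x0 c : 'I_m -> 'rV[R]_n).
Context (S : 'I_m -> seq 'rV[R]_n) (HS : slice_system w v0 L x0 c S).
Local Notation q := (orbit_of L Ww).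
Local Notation F := (fixed_lift L w).
Local Notation G := (affine_group L w).

Lemma slice_point_fixed i x : V (x - x0 i) -> F x.
Proof. exact: (fixed_liftV Ww (slice_fixed HS i)). Qed.

Lemma centre_line_slice i s : V (c i + s *: v0 - x0 i).
Proof.
rewrite addrAC; apply: (fixed_spaceD Ww); first by case: (centre_contracted HS i).
by apply: (fixed_spaceZ Ww); exact: (v0_fixed_space Ww v0_fixed).
Qed.

(** The image under the stabiliser of a point on the central line need not be on that
  line, but it is a centre at the right height, hence conjugate to the point of the line. *)
Lemma orbit_of_shift i s t : slice_shift L (x0 i) t ->
  q (c i + s *: v0) = q (c i + (s + t) *: v0).
Proof.
move=> [u [l [Zu Ll Vl tE]]]; have Wu : weyl Phi u by case: Zu.
pose g y := u y + l; have Gg : G g by exists u, l.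
set x := c i + (s + t) *: v0; have Fx : F x := slice_point_fixed (centre_line_slice i _).
have Vg y : V (y - x0 i) -> V (g y - x0 i).
  move=> Vy; have -> : g y - x0 i = u (y - x0 i) + (u (x0 i) + l - x0 i).
    by rewrite (weylB _ _ Wu); apply/rowP => j; rewrite !mxE; ring.
  by apply: (fixed_spaceD Ww) => //; exact: (fixed_space_act Zu).
have Ty : target w v0 L c x (g (c i + s *: v0)).
  split; first by exists i, g, s.
  have -> : g (c i + s *: v0) - x = (g (c i + s *: v0) - x0 i) - (x - x0 i).
    by rewrite opprB addrA subrK.
  split; first by apply: (fixed_spaceB Ww); [apply: Vg|]; exact: centre_line_slice.
  rewrite /g /x !(dotBl, dotDl, dotZl) (dot_v0_act v0_fixed _ Zu) !(dotDl, dotZl).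
  rewrite (centre_perp HS) tE; have [->|v0n] := eqVneq v0 0; first by rewrite !dot0r; ring.
  by rewrite /height; field; rewrite dot_eq0.
have Tx : target w v0 L c x x.
  split; first by exists i, idfun, (s + t); split=> //; exact: affine_group_id.
  by rewrite subrr; split; [exact: (weyl0 Ww)|rewrite dot0l].
have [h [Gh hE _]] := target_orbit Ww v0_fixed HS Fx Ty Tx.
have Fs : F (c i + s *: v0) := slice_point_fixed (centre_line_slice i _).
have Fg := affine_group_fixed Ww Gg Fs.
by rewrite -hE (orbit_of_affine Ww Gh Fg) (orbit_of_affine Ww Gg Fs).
Qed.

(** The index of the slice and the height modulo the shifts are well defined on orbits. *)
Lemma slice_of_orbit x y g h i j : F x -> F y -> q x = q y -> G g -> G h ->
  V (g x - x0 i) -> V (h y - x0 j) ->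
  i = j /\ slice_shift L (x0 i) (height (h y) - height (g x)).
Proof.
move=> Fx Fy xy Gg Gh Vx Vy.
have [k Gk kx] := orbit_of_eq Fx Fy xy.
have [g' [Gg' gg' g'g]] := affine_group_inv Gg.
have [u [l [Zu Ll E]]] : G (h \o (k \o g')).
  by apply: affine_group_comp => //; exact: affine_group_comp.
have hy : h y = u (g x) + l.
  by rewrite -[RHS]/((fun z => u z + l) (g x)) -E /= gg' kx.
have Wu : weyl Phi u by case: Zu.
have Vij : V (u (x0 i) + l - x0 j).
  have -> : u (x0 i) + l - x0 j = (h y - x0 j) - u (g x - x0 i).
    by rewrite hy (weylB _ _ Wu); apply/rowP => a; rewrite !mxE; ring.
  by apply: (fixed_spaceB Ww) => //; exact: (fixed_space_act Zu).
have ij := slice_uniq HS Zu Ll Vij; split=> //; subst j.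
exists u, l; split=> //.
by rewrite hy heightD (height_act v0_fixed _ Zu) addrC addKr.
Qed.

End one.

Section maps.
Context (L L' : weylLattice Phi) (m : nat) (x0 c x0' c' : 'I_m -> 'rV[R]_n).
Context (S S' : 'I_m -> seq 'rV[R]_n).
Context (HS : slice_system w v0 L x0 c S) (HS' : slice_system w v0 L' x0' c' S').
Context (Ld : discrete_lattice L).
Context (rho : 'I_m -> R).
Hypothesis rhoP : forall i t, slice_shift L (x0 i) t -> slice_shift L' (x0' i) (rho i * t).

(** Only the index of the slice and the height are kept. The height is rescaled by rho, so that a
  shift of the first lattice goes to a shift of the second and the value depends on the orbit only. *)
Lemma slice_map : exists f : fixed_orbit_space L w -> fixed_orbit_space L' w,
  continuous f /\ forall x i g, fixed_lift L w x -> affine_group L w g ->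
    V (g x - x0 i) ->
    f (orbit_of L Ww x) = orbit_of L' Ww (c' i + (rho i * height (g x)) *: v0).
Proof.
have /choice[f fP] : forall p : fixed_orbit_space L w, exists z : fixed_orbit_space L' w,
    exists x i g, [/\ fixed_lift L w x, orbit_of L Ww x = p, affine_group L w g,
      V (g x - x0 i) & z = orbit_of L' Ww (c' i + (rho i * height (g x)) *: v0)].
  move=> p; have [x Fx xp] := orbit_of_surj Ww p.
  have [i [g Gg Vg]] := slice_coverP HS Fx.
  by eexists; exists x, i, g.
have fE x i g : fixed_lift L w x -> affine_group L w g -> V (g x - x0 i) ->
    f (orbit_of L Ww x) = orbit_of L' Ww (c' i + (rho i * height (g x)) *: v0).
  move=> Fx Gg Vg; have [y [j [h [Fy xy Gh Vh ->]]]] := fP (orbit_of L Ww x).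
  have [ij sh] := slice_of_orbit HS Fy Fx xy Gh Gg Vh Vg; subst j.
  rewrite (orbit_of_shift HS' (rho i * height (h y)) (rhoP sh)).
  by rewrite -mulrDr addrCA subrr addr0.
exists f; split=> // p; have [x Fx <-] := orbit_of_surj Ww p.
have [i [g Gg Vg]] := slice_coverP HS Fx.
rewrite /continuous_at (fE _ _ _ Fx Gg Vg) => O /=.
move/(orbit_of_continuous (slice_point_fixed HS' (centre_line_slice HS' i _))).
move=> /nbhs_enormP[e e0 he].
have [d d0 hd] := fixed_lift_near Ww Ld Fx.
have r0 : 0 < `|rho i| + 1 by rewrite ltr_wpDl.
have e10 : 0 < Num.min d (e / (`|rho i| + 1)) by rewrite lt_min d0 divr_gt0.
apply: filterS (orbit_of_open Ww Fx (near_enorm x e10)) => _ [y [/= yx Fy] <-].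
move: yx; rewrite lt_min => /andP[yd ye].
have Vyx := hd _ Fy yd.
have [u Zu gB] := affine_group_diff Gg.
have Vgy : V (g y - x0 i).
  rewrite -(subrKA (g x)) gB; apply: (fixed_spaceD Ww) => //.
  exact: (fixed_space_act Zu).
rewrite /= (fE _ _ _ Fy Gg Vgy); apply: he; last first.
  exact: (slice_point_fixed HS' (centre_line_slice HS' i _)).
rewrite opprD addrACA subrr add0r -scalerBl -mulrBr -heightB gB (height_act v0_fixed _ Zu).
rewrite -scalerA enormZ (@le_lt_trans _ _ (`|rho i| * enorm (y - x)))//.
  by rewrite ler_wpM2l// height_bound.
rewrite (@le_lt_trans _ _ ((`|rho i| + 1) * enorm (y - x)))//.
  by rewrite ler_wpM2r ?enorm_ge0// lerDl.
by rewrite mulrC -ltr_pdivlMr.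
Qed.

End maps.

(** The composite of the two rescalings sends an orbit to the point of the central line at
  the same height, which is the end of the contraction. *)
Lemma slice_homotopy (L L' : weylLattice Phi) m (x0 c x0' c' : 'I_m -> 'rV[R]_n)
    (S S' : 'I_m -> seq 'rV[R]_n) (rho rho' : 'I_m -> R)
    (f : fixed_orbit_space L w -> fixed_orbit_space L' w)
    (f' : fixed_orbit_space L' w -> fixed_orbit_space L w) :
  slice_system w v0 L x0 c S -> slice_system w v0 L' x0' c' S' ->
  discrete_lattice L -> (forall i, rho' i * rho i = 1) ->
  (forall x i g, fixed_lift L w x -> affine_group L w g -> V (g x - x0 i) ->
    f (orbit_of L Ww x) = orbit_of L' Ww (c' i + (rho i * height (g x)) *: v0)) ->
  (forall x i g, fixed_lift L' w x -> affine_group L' w g -> V (g x - x0' i) ->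
    f' (orbit_of L' Ww x) = orbit_of L Ww (c i + (rho' i * height (g x)) *: v0)) ->
  homotopic R (f' \o f) idfun.
Proof.
move=> HS HS' Ld rr fE f'E.
have [H [cH H0 H1]] := contraction Ww v0_fixed HS Ld.
exists H; split=> // p; have [x Fx <-] := orbit_of_surj Ww p.
have [i [g Gg Vg]] := slice_coverP HS Fx.
have Fgx := affine_group_fixed Ww Gg Fx.
rewrite /= (fE _ _ _ Fx Gg Vg) (f'E _ i idfun); last 3 first.
- exact: (slice_point_fixed HS' (centre_line_slice HS' i _)).
- exact: affine_group_id.
- exact: (centre_line_slice HS' i).
rewrite -(orbit_of_affine Ww Gg Fx) (H0 _ _ Fgx (target_slice Ww v0_fixed HS Vg)).
congr (orbit_of _ _ (_ + _)).
have c0 : height (c' i) = 0 by rewrite /height (centre_perp HS') mul0r.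
by rewrite /= heightD c0 add0r -scalerA heightZv0 scalerA mulrA rr mul1r.
Qed.

Theorem slices_equivalent (L L' : weylLattice Phi) m (x0 c x0' c' : 'I_m -> 'rV[R]_n)
    (S S' : 'I_m -> seq 'rV[R]_n) (rho : 'I_m -> R) :
  slice_system w v0 L x0 c S -> slice_system w v0 L' x0' c' S' ->
  discrete_lattice L -> discrete_lattice L' ->
  (forall i, rho i != 0) ->
  (forall i t, slice_shift L (x0 i) t <-> slice_shift L' (x0' i) (rho i * t)) ->
  homotopy_equivalent R (fixed_orbit_space L w) (fixed_orbit_space L' w).
Proof.
move=> HS HS' Ld Ld' r0 rP.
have [f [cf fE]] := slice_map HS HS' Ld (fun i t => proj1 (rP i t)).
have rP' i t : slice_shift L' (x0' i) t -> slice_shift L (x0 i) ((rho i)^-1 * t).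
  by move=> h; apply/rP; rewrite mulVKf.
have [f' [cf' f'E]] := slice_map HS' HS Ld' rP'.
exists f, f'; split=> //.
  by apply: (slice_homotopy HS HS' Ld _ fE f'E) => i; rewrite mulVf.
by apply: (slice_homotopy HS' HS Ld' _ f'E fE) => i; rewrite mulfV.
Qed.

Section shift_group.
Context (L : weylLattice Phi) (x0 : 'rV[R]_n).

Lemma slice_shiftP t : slice_shift L x0 t <-> exists g,
  [/\ affine_group L w g, V (g x0 - x0) & t = height (g x0 - x0)].
Proof.
split=> [[u [l [Zu Ll Vl ->]]]|[g [[u [l [Zu Ll ->]]] Vl ->]]].
  exists (fun y => u y + l); split=> //; first by exists u, l.
  by rewrite heightB heightD (height_act v0_fixed _ Zu) addrC addKr.
exists u, l; split=> //.
by rewrite heightB heightD (height_act v0_fixed _ Zu) addrC addKr.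
Qed.

Lemma slice_shiftD s t : slice_shift L x0 s -> slice_shift L x0 t -> slice_shift L x0 (s + t).
Proof.
move=> /slice_shiftP[g [Gg Vg ->]] /slice_shiftP[h [Gh Vh ->]]; apply/slice_shiftP.
have [u Zu gB] := affine_group_diff Gg.
have E : g (h x0) - x0 = g x0 - x0 + u (h x0 - x0) by rewrite -gB [RHS]addrC subrKA.
exists (g \o h); split; first exact: affine_group_comp.
  by rewrite /= E; apply: (fixed_spaceD Ww) => //; exact: (fixed_space_act Zu Vh).
by rewrite /= E [in RHS]heightD (height_act v0_fixed _ Zu).
Qed.

Lemma slice_shiftN t : slice_shift L x0 t -> slice_shift L x0 (- t).
Proof.
move=> /slice_shiftP[g [Gg Vg ->]]; apply/slice_shiftP.
have [h [Gh gh hg]] := affine_group_inv Gg.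
have [u Zu hB] := affine_group_diff Gh.
have E : h x0 - x0 = u (- (g x0 - x0)) by rewrite opprB -hB gh.
exists h; split=> //; rewrite E.
  apply: (fixed_space_act Zu); rewrite -[- _]add0r; apply: (fixed_spaceB Ww) => //.
  exact: (weyl0 Ww).
by rewrite (height_act v0_fixed _ Zu) /height dotNl mulNr.
Qed.

Lemma slice_shiftZ t (k : int) : slice_shift L x0 t -> slice_shift L x0 (t *~ k).
Proof.
move=> st; have nat_shift j : slice_shift L x0 (t *+ j).
  elim: j => [|j IH]; last by rewrite mulrS; exact: slice_shiftD.
  by rewrite mulr0n -(subrr t); apply: slice_shiftD => //; exact: slice_shiftN.
by case: k => j; [exact: nat_shift|apply: slice_shiftN; exact: nat_shift].
Qed.

(** The shifts form a subgroup of (1 / <v0, v0>) Z that contains 1 because v0 lies in L. So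
  it is generated by its least positive element. *)
Lemma slice_shift_cyclic : v0 != 0 -> lattice_set L v0 ->
  (forall l, lattice_set L l -> dot l v0 \is a Num.int) ->
  exists2 a : R, a != 0 & forall t, slice_shift L x0 t <-> exists k : int, t = a *~ k.
Proof.
move=> v0n Lv0 Lint.
have D0 : dot v0 v0 != 0 by rewrite dot_eq0.
have /natrP[D DE] : dot v0 v0 \is a Num.nat by rewrite natrEint Lint// dot_ge0.
have sh1 : slice_shift L x0 1.
  exists idfun, v0; split=> //; first exact: centralizer_id.
    by rewrite addrAC subrr add0r; exact: (v0_fixed_space Ww v0_fixed).
  by rewrite /height divff.
(* The least j with j / <v0, v0> a shift generates, by Euclidean division. *)
pose P j := `[< (0 < j)%nat /\ slice_shift L x0 (j%:R / dot v0 v0) >].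
have exP : exists j, P j.
  exists D; apply/asboolP; split; last by rewrite -DE divff.
  by rewrite lt0n; apply: contra_neq D0; rewrite DE => ->.
have [j] := ex_minnP exP; move=> /asboolP[j0 shj] jmin.
have jR : j%:R != 0 :> R by rewrite pnatr_eq0 -lt0n.
exists (j%:R / dot v0 v0); first by rewrite mulf_neq0 ?invr_eq0.
move=> t; split=> [sht|[k ->]]; last exact: slice_shiftZ.
have [k kE] : exists k : int, t = k%:~R / dot v0 v0.
  have [u [l [_ Ll _ tE]]] := sht; have /intrP[k kE] := Lint _ Ll.
  by exists k; rewrite tE /height kE.
exists (divz k j).
have kR : k%:~R = (divz k j)%:~R * j%:R + (modz k j)%:~R :> R.
  by rewrite {1}(divz_eq k j) intrD intrM.
have r0 : 0 <= (modz k j) by rewrite modz_ge0// eqz_nat -lt0n.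
have rj : (modz k j) < j by rewrite ltz_mod// eqz_nat -lt0n.
suff r0' : (modz k j) = 0.
  by rewrite kE kR r0' addr0 -[RHS]mulrzr [RHS]mulrC mulrA.
have shr : slice_shift L x0 ((modz k j)%:~R / dot v0 v0).
  have -> : (modz k j)%:~R / dot v0 v0 = t - (j%:R / dot v0 v0) *~ (divz k j).
    by rewrite kE kR -[X in _ - X]mulrzr mulrDl [X in _ - X]mulrC mulrA addrC addKr.
  by apply: slice_shiftD => //; apply: slice_shiftN; exact: slice_shiftZ.
move: r0 rj shr; case: (modz k j) => // r _ rj shr.
case: r rj shr => // r rj shr; suff : (j <= r.+1)%nat by rewrite leqNgt -ltz_nat rj.
by apply: jmin; apply/asboolP.
Qed.

Lemma slice_shift0 t : v0 = 0 -> slice_shift L x0 t <-> t = 0.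
Proof.
move=> v00; split=> [[u [l [_ _ _ ->]]]|->]; first by rewrite /height v00 dot0r mul0r.
apply/slice_shiftP; exists idfun; split; first exact: affine_group_id.
  by rewrite subrr; exact: (weyl0 Ww).
by rewrite subrr /height dot0l mul0r.
Qed.

End shift_group.

(** Both shift groups are infinite cyclic, or both vanish when v0 = 0; rho i is the quotient of
  the generators. *)
Theorem slices_equivalent_lattices (L L' : weylLattice Phi) m
    (x0 c x0' c' : 'I_m -> 'rV[R]_n) (S S' : 'I_m -> seq 'rV[R]_n) :
  slice_system w v0 L x0 c S -> slice_system w v0 L' x0' c' S' ->
  discrete_lattice L -> discrete_lattice L' ->
  lattice_set L v0 -> lattice_set L' v0 ->
  (forall l, lattice_set L l -> dot l v0 \is a Num.int) ->
  (forall l, lattice_set L' l -> dot l v0 \is a Num.int) ->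
  homotopy_equivalent R (fixed_orbit_space L w) (fixed_orbit_space L' w).
Proof.
move=> HS HS' Ld Ld' Lv Lv' Li Li'.
have /choice[rho rhoP] : forall i, exists r : R, r != 0 /\
    forall t, slice_shift L (x0 i) t <-> slice_shift L' (x0' i) (r * t).
  move=> i; have [v00|v0n] := eqVneq v0 0.
    exists 1; split=> [|t]; first exact: oner_neq0.
    by rewrite mul1r !slice_shift0.
  have [a a0 aP] := slice_shift_cyclic (x0 i) v0n Lv Li.
  have [b b0 bP] := slice_shift_cyclic (x0' i) v0n Lv' Li'.
  exists (b / a); split=> [|t]; first by rewrite mulf_neq0 ?invr_eq0.
  rewrite aP bP; split=> -[k]; first by move=> ->; exists k; rewrite mulrzAr divfK.
  move=> E; exists k; apply: (mulfI (x := b / a)); first by rewrite mulf_neq0 ?invr_eq0.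
  by rewrite E mulrzAr divfK.
apply: (slices_equivalent HS HS' Ld Ld' (rho := rho)) => i; first exact: (proj1 (rhoP i)).
exact: (proj2 (rhoP i)).
Qed.

End compare.

(** * Integer vectors in the basis of simple roots *)

Arguments Z.mul : simpl never.
Arguments Z.add : simpl never.
Arguments Z.sub : simpl never.

(** Coordinates in the simple roots. A record of six integers lets the checks below
  run fast in the kernel. *)
Record zvec := ZV { zc1 : Z; zc2 : Z; zc3 : Z; zc4 : Z; zc5 : Z; zc6 : Z }.

Section zvec_operations.
Local Open Scope Z_scope.

Definition zeqb (u v : zvec) : bool :=
  [&& zc1 u =? zc1 v, zc2 u =? zc2 v, zc3 u =? zc3 v, zc4 u =? zc4 v,
      zc5 u =? zc5 v & zc6 u =? zc6 v].

Definition zadd (u v : zvec) : zvec :=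
  ZV (zc1 u + zc1 v) (zc2 u + zc2 v) (zc3 u + zc3 v) (zc4 u + zc4 v)
     (zc5 u + zc5 v) (zc6 u + zc6 v).

Definition zscale (k : Z) (v : zvec) : zvec :=
  ZV (k * zc1 v) (k * zc2 v) (k * zc3 v) (k * zc4 v) (k * zc5 v) (k * zc6 v).

Definition zsub (u v : zvec) : zvec := zadd u (zscale (-1) v).

Definition zzero : zvec := ZV 0 0 0 0 0 0.

Definition zsum (s : seq zvec) : zvec := foldr zadd zzero s.

(** The pairings with the six simple roots. *)
Definition zdual (v : zvec) : zvec :=
  ZV (2 * zc1 v - zc3 v) (2 * zc2 v - zc4 v) (2 * zc3 v - zc1 v - zc4 v)
     (2 * zc4 v - zc2 v - zc3 v - zc5 v) (2 * zc5 v - zc4 v - zc6 v)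
     (2 * zc6 v - zc5 v).

Definition zdot (u v : zvec) : Z :=
  let d := zdual v in
  zc1 u * zc1 d + zc2 u * zc2 d + zc3 u * zc3 d + zc4 u * zc4 d +
  zc5 u * zc5 d + zc6 u * zc6 d.

Definition zreflection (a v : zvec) : zvec := zsub v (zscale (zdot v a) a).

(** Every index outside 1, ..., 5 stands for the sixth simple root; zsimple_reflection
  and simple_index follow the same convention. *)
Definition zsimple (i : nat) : zvec :=
  match i with
  | 1%nat => ZV 1 0 0 0 0 0 | 2%nat => ZV 0 1 0 0 0 0 | 3%nat => ZV 0 0 1 0 0 0
  | 4%nat => ZV 0 0 0 1 0 0 | 5%nat => ZV 0 0 0 0 1 0 | _ => ZV 0 0 0 0 0 1
  end.

Definition zsimple_reflection (i : nat) (v : zvec) : zvec :=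
  let: ZV a b c d e f := v in
  match i with
  | 1%nat => ZV (c - a) b c d e f
  | 2%nat => ZV a (d - b) c d e f
  | 3%nat => ZV a b (a + d - c) d e f
  | 4%nat => ZV a b c (b + c + e - d) e f
  | 5%nat => ZV a b c d (d + f - e) f
  | _ => ZV a b c d e (e - f)
  end.

End zvec_operations.

Lemma zeqbP : Equality.axiom zeqb.
Proof.
move=> [a b c d e f] [a' b' c' d' e' f']; rewrite /zeqb /=.
apply: (iffP idP); last by case=> -> -> -> -> -> ->; rewrite !Z.eqb_refl.
by case/and5P => /Z.eqb_eq-> /Z.eqb_eq-> /Z.eqb_eq-> /Z.eqb_eq-> /andP[/Z.eqb_eq-> /Z.eqb_eq->].
Qed.

HB.instance Definition _ := hasDecEq.Build zvec zeqbP.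

Definition word := seq nat.

(** The leftmost letter of a word acts last. *)
Definition zact (s : word) (v : zvec) : zvec := foldr zsimple_reflection v s.

(** A record on its own because the simple roots will be replaced by their images under the
  Weyl group. *)
Record E6_base (R : realType) (Phi : rootSystem R 6) (a : 'I_6 -> 'rV[R]_6) : Prop := {
  E6_norm : forall x, root_set Phi x -> dot x x = 2;
  E6_is_base : is_base Phi a;
  E6_base_cartan : forall i j,
    2 * dot (a i) (a j) / dot (a j) (a j) = (E6_cartan i j)%:~R
}.

Section realisation.
Context (R : realType) (Phi : rootSystem R 6).
Implicit Types (x y : 'rV[R]_6) (u v : zvec) (s : word).

Definition zr (k : Z) : R := (int_of_Z k)%:~R.

Lemma zr_intr (k : Z) : zr k = (int_of_Z k)%:~R. Proof. by []. Qed.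

Lemma zrD (k l : Z) : zr (k + l)%Z = zr k + zr l :> R.
Proof. by rewrite /zr (rmorphD int_of_Z) intrD. Qed.

Lemma zrN (k : Z) : zr (- k)%Z = - zr k :> R.
Proof. by rewrite /zr (rmorphN int_of_Z) mulrNz. Qed.

Lemma zrB (k l : Z) : zr (k - l)%Z = zr k - zr l :> R.
Proof. by rewrite /Z.sub zrD zrN. Qed.

Lemma zrM (k l : Z) : zr (k * l)%Z = zr k * zr l :> R.
Proof. by rewrite /zr (rmorphM int_of_Z) intrM. Qed.

Lemma zr_inj : injective zr.
Proof. by move=> k l /intr_inj /(can_inj int_of_ZK). Qed.

Lemma zr_int (k : Z) : zr k \is a Num.int. Proof. exact: intr_int. Qed.

Lemma zr_intP (x : R) : x \is a Num.int -> exists k, x = zr k.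
Proof. by move=> /intrP[k ->]; exists (Z_of_int k); rewrite /zr Z_of_intK. Qed.

Lemma zr_eq0 (k : Z) : (zr k == 0) = (k =? 0)%Z.
Proof.
by apply/eqP/idP => [h|/Z.eqb_eq ->//]; apply/Z.eqb_eq; exact: zr_inj.
Qed.

Definition zrE := (zrD, zrN, zrB, zrM).

Definition simple_index (i : nat) : 'I_6 :=
  match i with
  | 1%nat => inord 0 | 2%nat => inord 1 | 3%nat => inord 2
  | 4%nat => inord 3 | 5%nat => inord 4 | _ => inord 5
  end.

Lemma sum_simple (F : 'I_6 -> 'rV[R]_6) : \sum_i F i =
  F (simple_index 1) + F (simple_index 2) + F (simple_index 3) +
  F (simple_index 4) + F (simple_index 5) + F (simple_index 6).
Proof.
rewrite !big_ord_recl big_ord0 addr0 !addrA.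
by do ![congr (_ + _)]; congr (F _); apply: val_inj; rewrite /= inordK.
Qed.

Lemma simple_indexP (i : 'I_6) : exists2 j, (0 < j <= 6)%nat & i = simple_index j.
Proof.
case: i => -[|[|[|[|[|[|//]]]]]] h.
- by exists 1%nat => //; apply: val_inj; rewrite /= inordK.
- by exists 2%nat => //; apply: val_inj; rewrite /= inordK.
- by exists 3%nat => //; apply: val_inj; rewrite /= inordK.
- by exists 4%nat => //; apply: val_inj; rewrite /= inordK.
- by exists 5%nat => //; apply: val_inj; rewrite /= inordK.
- by exists 6%nat => //; apply: val_inj; rewrite /= inordK.
Qed.

Section base.
Context (a : 'I_6 -> 'rV[R]_6) (E : E6_base Phi a).
Let Phi_norm := E6_norm E.
Let a_base := E6_is_base E.
Let a_cartan := E6_base_cartan E.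

Definition vec (v : zvec) : 'rV[R]_6 :=
  zr (zc1 v) *: a (simple_index 1) + zr (zc2 v) *: a (simple_index 2) +
  zr (zc3 v) *: a (simple_index 3) + zr (zc4 v) *: a (simple_index 4) +
  zr (zc5 v) *: a (simple_index 5) + zr (zc6 v) *: a (simple_index 6).

Lemma simple_root i : root_set Phi (a i). Proof. by case: a_base. Qed.

Lemma dot_simple i j : dot (a i) (a j) = (E6_cartan i j)%:~R.
Proof.
by rewrite -a_cartan (Phi_norm (simple_root j)) mulrAC mulfV ?mul1r// pnatr_eq0.
Qed.

Lemma vecD u v : vec (zadd u v) = vec u + vec v.
Proof. by rewrite /vec /zadd /=; apply/rowP => i; rewrite !mxE !zrE; ring. Qed.

Lemma vecZ k v : vec (zscale k v) = zr k *: vec v.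
Proof. by rewrite /vec /zscale /=; apply/rowP => i; rewrite !mxE !zrE; ring. Qed.

Lemma vec0 : vec zzero = 0.
Proof. by rewrite /vec !scale0r !addr0. Qed.

Lemma vecB u v : vec (zsub u v) = vec u - vec v.
Proof. by rewrite /zsub vecD vecZ scaleN1r. Qed.

Lemma vec_sum (s : seq zvec) : vec (zsum s) = \sum_(v <- s) vec v.
Proof.
by elim: s => [|v s IH]; rewrite /= ?vec0 ?big_nil// big_cons -IH vecD.
Qed.

Lemma vec_simple i : vec (zsimple i) = a (simple_index i).
Proof.
by case: i => [|[|[|[|[|[|i]]]]]]; rewrite /vec /= ?scale0r ?scale1r ?add0r ?addr0.
Qed.

Lemma dot_vec_simple u i : dot (vec u) (a (simple_index i)) =
  zr (match i with 1%nat => zc1 (zdual u) | 2%nat => zc2 (zdual u) | 3%nat => zc3 (zdual u)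
      | 4%nat => zc4 (zdual u) | 5%nat => zc5 (zdual u) | _ => zc6 (zdual u) end).
Proof.
have dE j : dot (vec u) (a j) =
    zr (zc1 u) * (E6_cartan (simple_index 1) j)%:~R +
    zr (zc2 u) * (E6_cartan (simple_index 2) j)%:~R +
    zr (zc3 u) * (E6_cartan (simple_index 3) j)%:~R +
    zr (zc4 u) * (E6_cartan (simple_index 4) j)%:~R +
    zr (zc5 u) * (E6_cartan (simple_index 5) j)%:~R +
    zr (zc6 u) * (E6_cartan (simple_index 6) j)%:~R.
  by rewrite /vec !dotDl !dotZl !dot_simple.
rewrite dE {dE} /E6_cartan -!val_eqE.
have z2 : zr 2 = 2 :> R by [].
by case: i => [|[|[|[|[|[|i]]]]]]; rewrite /= !inordK//= !zrE z2; ring.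
Qed.

Lemma dot_vec u v : dot (vec u) (vec v) = zr (zdot u v).
Proof.
rewrite dotC {2}/vec !dotDr !dotZr !(dotC (vec v)) !(dotC _ (vec v)) !dot_vec_simple.
by rewrite /zdot !zrE; ring.
Qed.

Lemma vec_reflection u v : zdot u u = 2%Z ->
  reflection (vec u) (vec v) = vec (zreflection u v).
Proof.
move=> uu; rewrite /reflection !dot_vec uu vecB vecZ.
by rewrite mulrAC mulfV ?mul1r// pnatr_eq0.
Qed.

Lemma zsimple_reflectionE i v : zsimple_reflection i v = zreflection (zsimple i) v.
Proof.
case: v => x1 x2 x3 x4 x5 x6.
by case: i => [|[|[|[|[|[|i]]]]]];
  rewrite /zreflection /zsub /zadd /zscale /zdot /zdual /zsimple_reflection;
  cbn [zsimple zc1 zc2 zc3 zc4 zc5 zc6]; congr ZV; lia.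
Qed.

Lemma vec_simple_reflection i v :
  reflection (a (simple_index i)) (vec v) = vec (zsimple_reflection i v).
Proof.
rewrite zsimple_reflectionE -vec_reflection ?vec_simple//.
by case: i => [|[|[|[|[|[|i]]]]]].
Qed.

Definition act s : 'rV[R]_6 -> 'rV[R]_6 :=
  foldr (fun i f => reflection (a (simple_index i)) \o f) idfun s.

Lemma act_weyl s : weyl Phi (act s).
Proof.
elim: s => [|i s IH] /=; first exact: weyl_id.
by apply: weyl_reflection => //; exact: simple_root.
Qed.

Lemma act_vec s v : act s (vec v) = vec (zact s v).
Proof. by elim: s => //= i s ->; exact: vec_simple_reflection. Qed.

Lemma act_cat s t x : act (s ++ t) x = act s (act t x).
Proof. by elim: s => //= i s ->. Qed.

Lemma act_revK s : cancel (act (rev s)) (act s).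
Proof.
move=> x; rewrite -act_cat.
elim: s x => //= i s IH x; rewrite rev_cons -cats1 catA act_cat IH /=.
exact: reflectionK.
Qed.

Lemma act_Krev s : cancel (act s) (act (rev s)).
Proof. by move=> x; rewrite -{2}(revK s) act_revK. Qed.

Lemma base_span x : exists c : 'I_6 -> R, x = \sum_i c i *: a i.
Proof.
have [_ free _] := a_base; have unit : (\matrix_i a i) \in unitmx by rewrite -row_free_unit.
exists (fun i => (x *m invmx (\matrix_i a i)) 0 i).
rewrite -{1}(mulmxKV unit x) mulmx_sum_row.
by apply: eq_bigr => i _; rewrite rowK.
Qed.

Lemma base_coef (c d : 'I_6 -> R) :
  \sum_i c i *: a i = \sum_i d i *: a i -> forall i, c i = d i.
Proof.
have [_ free _] := a_base => cd i.
have eE (e : 'I_6 -> R) : \sum_i e i *: a i = (\row_i e i) *m (\matrix_i a i).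
  by rewrite mulmx_sum_row; apply: eq_bigr => j _; rewrite rowK mxE.
move: cd; rewrite !eE => /(row_free_inj free)/rowP/(_ i).
by rewrite !mxE.
Qed.

Lemma eq_on_simple (f g : 'rV[R]_6 -> 'rV[R]_6) : weyl Phi f -> weyl Phi g ->
  (forall i, (0 < i <= 6)%nat -> f (vec (zsimple i)) = g (vec (zsimple i))) -> f = g.
Proof.
move=> Wf Wg fg; apply/funext => x; have [c ->] := base_span x.
rewrite (weyl_sum _ _ Wf) (weyl_sum _ _ Wg); apply: eq_bigr => i _.
have [j j6 ->] := simple_indexP i.
by rewrite (weylZ _ _ Wf) (weylZ _ _ Wg) -vec_simple fg.
Qed.

Definition zcoef v (i : 'I_6) : Z :=
  match val i with 0%nat => zc1 v | 1%nat => zc2 v | 2%nat => zc3 v | 3%nat => zc4 v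
  | 4%nat => zc5 v | _ => zc6 v end.

Lemma vec_sum_coef v : vec v = \sum_i zr (zcoef v i) *: a i.
Proof. by rewrite sum_simple /zcoef /= !inordK. Qed.

Lemma vec_inj : injective vec.
Proof.
move=> u v; rewrite !vec_sum_coef => /base_coef E0.
have E1 i : zcoef u (simple_index i) = zcoef v (simple_index i) by apply: zr_inj; exact: E0.
move: (E1 1%nat) (E1 2%nat) (E1 3%nat) (E1 4%nat) (E1 5%nat) (E1 6%nat).
rewrite /zcoef /= !inordK//.
by case: u {E0 E1} => ? ? ? ? ? ?; case: v => ? ? ? ? ? ? /= -> -> -> -> -> ->.
Qed.

Lemma reflection_self x : dot x x != 0 -> reflection x x = - x.
Proof.
by move=> x0; apply/rowP => i; rewrite /reflection mulfK// !mxE; ring.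
Qed.

Lemma root_opp x : root_set Phi x -> root_set Phi (- x).
Proof.
move=> rx; rewrite -reflection_self; first exact: (roots_reflection rx rx).
by rewrite (Phi_norm rx) pnatr_eq0.
Qed.

Lemma weyl_root f x : weyl Phi f -> root_set Phi x -> root_set Phi (f x).
Proof. by move=> Wf rx; elim: Wf => //= b g rb _; exact: roots_reflection. Qed.

(** Induction on the height: since <x, x> > 0, a positive root x has a positive product with
  some simple root a i occurring in it. If x is not a i, another simple root occurs in x,
  so the reflection of x in a i is still positive, of smaller height. *)
Lemma positive_root_word (n : nat) x (k : 'I_6 -> int) : root_set Phi x ->
  x = \sum_i a i *~ k i -> (forall i, 0 <= k i) -> \sum_i k i <= n%:Z ->
  exists s i, x = act s (a (simple_index i)).
Proof.
elim: n x k => [|n IH] x k rx xk k0 kn.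
  have kz i : k i = 0.
    apply: le_anti; rewrite k0 andbT (le_trans _ kn)//.
    by rewrite (bigD1 i)//= lerDl sumr_ge0.
  have x0 : x = 0 by rewrite xk big1// => i _; rewrite kz.
  by case: (@roots_neq0 _ _ Phi); rewrite -x0.
have xx := Phi_norm rx.
have [i ki xi] : exists2 i, 0 < k i & 0 < dot x (a i).
  apply: contrapT => nex.
  have : dot x x <= 0.
    rewrite {2}xk dot_sumr; apply: sumr_le0 => i _.
    rewrite -scaler_int dotZr.
    have [ki|] := ltP 0 (k i); last first.
      by move=> ki; rewrite (_ : k i = 0) ?mul0r//; apply: le_anti; rewrite ki k0.
    rewrite mulr_ge0_le0 ?ler0z// leNgt; apply/negP => xi; apply: nex; by exists i.
  by rewrite xx leNgt ltr0n.
have ri := simple_root i.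
have [p pE] : exists p : int, dot x (a i) = p%:~R.
  have /intrP[p pE] := roots_integral ri rx; exists p; rewrite -pE (Phi_norm ri).
  by rewrite mulrAC mulfV ?mul1r// pnatr_eq0.
have p0 : 0 < p by rewrite -(ltr0z R) -pE.
have [j ji] : exists j, i = simple_index j by have [j _ ->] := simple_indexP i; exists j.
have [only|/existsNP[j' /not_implyP[jn kj']]] :=
    pselect (forall j', j' <> i -> k j' = 0).
  have xE : x = (k i)%:~R *: a i.
    rewrite xk (bigD1 i)//= big1 ?addr0 ?scaler_int// => j' /eqP jn.
    by rewrite only.
  have := @roots_reduced _ _ Phi (a i) (k i)%:~R ri; rewrite -xE => /(_ rx)[k1|k1].
    by exists [::], j; rewrite xE k1 scale1r /= ji.
  by move: ki; rewrite -(ltr0z R) k1 ltr0N1.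
pose y := reflection (a i) x.
have ry : root_set Phi y := roots_reflection ri rx.
pose k' j := if j == i then k i - p else k j.
have yE : y = \sum_j a j *~ k' j.
  rewrite /y /reflection (Phi_norm ri) pE mulrAC mulfV ?mul1r ?pnatr_eq0// {1}xk.
  rewrite (bigD1 i)//= [RHS](bigD1 i)//= /k' eqxx mulrzBr scaler_int addrAC; congr (_ + _).
  by apply: eq_bigr => j'' /negbTE ->.
have [_ _ /(_ y ry)[l [yl lsign]]] := a_base.
have lk i' : l i' = k' i'.
  apply: (@intr_inj R); apply: (@base_coef (fun i => (l i)%:~R) (fun i => (k' i)%:~R)).
  rewrite (eq_bigr (fun i => a i *~ l i)); last by move=> *; rewrite scaler_int.
  by rewrite -yl yE; apply: eq_bigr => *; rewrite scaler_int.
have k'0 i' : 0 <= k' i'.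
  rewrite -lk; case: lsign => // neg; have := neg j'; rewrite lk /k'.
  case: eqP => // _ kneg; case: kj'; apply: le_anti.
  by rewrite kneg k0.
have [|s [m yE']] := IH y k' ry yE k'0.
  move: kn; rewrite (bigD1 i)//= [X in _ -> X <= _](bigD1 i)//= /k' eqxx.
  rewrite [X in _ -> _ + X <= _](eq_bigr k); last by move=> j'' /negbTE ->.
  lia.
exists (j :: s), m; rewrite /= -yE' -ji /y reflectionK//.
Qed.

Lemma root_word x : root_set Phi x -> exists s i, x = act s (a (simple_index i)).
Proof.
move=> rx; have [_ _ /(_ x rx)[k [xk ksign]]] := a_base.
case: ksign => kpos.
  apply: (@positive_root_word (absz (\sum_i k i)) x k) => //.
  by rewrite abszE ler_norm.
have [s [i xE]] : exists s i, - x = act s (a (simple_index i)).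
  apply: (@positive_root_word (absz (\sum_i - k i)) (- x) (fun i => - k i)) => //.
  - exact: root_opp.
  - by rewrite xk -sumrN; apply: eq_bigr => i _; rewrite mulrNz.
  - by move=> i; rewrite oppr_ge0.
  - by rewrite abszE ler_norm.
exists (rcons s i), i; rewrite -cats1 act_cat /= reflection_self.
  by rewrite (weylN _ (act_weyl s)) -xE opprK.
by rewrite (Phi_norm (simple_root _)) pnatr_eq0.
Qed.

Lemma reflection_act s x y : reflection (act s x) y = act s (reflection x (act (rev s) y)).
Proof.
have Ws := act_weyl s.
have yx : dot y (act s x) = dot (act (rev s) y) x by rewrite -[RHS](weyl_dot _ _ Ws) act_revK.
by rewrite /reflection (weylB _ _ Ws) (weylZ _ _ Ws) act_revK yx (weyl_dot _ _ Ws).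
Qed.

Lemma weyl_word f : weyl Phi f -> exists s, f = act s.
Proof.
elim=> [|b g rb _ [s ->]]; first by exists [::].
have [t [i ->]] := root_word rb; exists (t ++ i :: (rev t ++ s)).
by apply/funext => x; rewrite /= reflection_act act_cat /= act_cat.
Qed.

End base.
End realisation.

(** * The conjugacy classes of the Weyl group *)

Definition simple_words : seq nat := [:: 1; 2; 3; 4; 5; 6]%nat.

(** The number of rounds is explicit; taking too few is harmless, as membership in the result
  is all that is used. *)
Definition closure (I : eqType) (F : I -> zvec -> zvec) (r : seq I) (n : nat) (s : seq zvec) :=
  ssrnat.iter n (fun s => undup (s ++ [seq F i v | i <- r, v <- s])) s.

Definition simple_orbit (s : seq zvec) : seq zvec :=
  closure zsimple_reflection simple_words 16 s.

Definition zroots : seq zvec :=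
  Eval vm_compute in simple_orbit (map zsimple simple_words).

(** Three times the 27 weights in the orbit of the first fundamental weight; the factor
  makes their coordinates integral. *)
Definition zweights : seq zvec :=
  Eval vm_compute in simple_orbit [:: ZV 4 3 5 6 4 2].

Fixpoint digits (fuel : nat) (n : N) (s : word) : word :=
  if fuel is fuel'.+1 then
    if n is N0 then s else
      let: (q, r) := N.div_eucl n 10 in digits fuel' q (N.to_nat r :: s)
  else s.

(** Words are written as decimal numerals: the digit i stands for the i-th simple reflection.
  The bound 64 exceeds the number of digits of all numerals below. *)
Definition word_of (n : N) : word := digits 64 n [::].

(** Representatives of the conjugacy classes, which in Carter's notation are
  1, A1, 2A1, A2, A2+A1, 3A1, A3, A4, A2+2A1, A3+A1, 2A2, D4, D5, A4+A1, 2A2+A1, A5, E6,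
  D4(a1), D5(a1), E6(a1), E6(a2), 4A1, A3+2A1, A5+A1, 3A2. *)
Definition class_words : seq N :=
  [::
   0; 1; 21; 31; 321; 521; 431; 4321; 5321; 5421; 6531; 5432; 54321; 64321;
   65321; 65431; 654321; 452432; 4524321; 64524321; 564543241321;
   543245432432; 5432454324321; 65432454324321; 654324565413245413241321]%N.

(** The reflection in the root cs_root, multiplied by a given representative, is conjugated by
  cs_word into the representative of class cs_class. *)
Record class_step := ClassStep { cs_root : zvec; cs_class : nat; cs_word : N }.

(** For each class, generators of a subgroup of the centraliser and one step for each orbit of
  this subgroup (with w and -1) on the roots. Conjugating by the centraliser extends a step to
  the whole orbit (reflection_class), which keeps the table short. *)
Definition class_steps : seq (seq N * seq class_step) := [::
  ([:: 654321; 1]%num, [:: ClassStep (ZV 1 0 0 0 0 0) 1 0]);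
  ([:: 6542; 3413245432413]%num, [:: ClassStep (ZV 0 0 1 0 0 0) 3 0; ClassStep (ZV 0 1 0 0 0 0) 2 0;
    ClassStep (ZV 1 0 0 0 0 0) 0 0]);
  ([:: 65341324131; 5]%num, [:: ClassStep (ZV 0 0 0 0 1 0) 5 0; ClassStep (ZV 0 0 1 0 0 0) 4 0;
    ClassStep (ZV 0 1 0 0 0 0) 1 0; ClassStep (ZV 0 1 1 1 0 0) 6 24]);
  ([:: 645341324534132421; 2]%num, [:: ClassStep (ZV 0 0 0 1 0 0) 6 0;
    ClassStep (ZV 0 0 1 0 0 0) 1 0; ClassStep (ZV 0 1 0 0 0 0) 4 0]);
  ([:: 65]%num, [:: ClassStep (ZV 0 0 0 0 1 0) 8 0; ClassStep (ZV 0 0 0 1 0 0) 7 0;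
    ClassStep (ZV 0 0 1 0 0 0) 2 0; ClassStep (ZV 0 1 0 0 0 0) 3 0;
    ClassStep (ZV 0 1 1 2 1 0) 9 2314234; ClassStep (ZV 1 1 2 3 2 1) 10 4254231654234]);
  ([:: 4562453413245643245432413; 1]%num, [:: ClassStep (ZV 0 0 0 0 1 0) 2 0;
    ClassStep (ZV 0 0 1 0 0 0) 8 0; ClassStep (ZV 0 0 0 1 1 0) 9 0;
    ClassStep (ZV 0 0 1 1 1 0) 11 13; ClassStep (ZV 1 1 2 2 1 0) 21 13]);
  ([:: 62453413245132421]%num, [:: ClassStep (ZV 0 0 0 0 0 1) 9 654231435465;
    ClassStep (ZV 0 0 0 1 0 0) 3 0; ClassStep (ZV 0 0 1 1 0 0) 2 42;
    ClassStep (ZV 0 1 0 1 0 0) 7 0; ClassStep (ZV 0 1 1 1 1 0) 17 1342;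
    ClassStep (ZV 0 1 1 2 1 0) 11 1345]);
  ([:: 6]%num, [:: ClassStep (ZV 0 0 0 0 0 1) 13 0; ClassStep (ZV 0 0 0 0 1 0) 12 0;
    ClassStep (ZV 0 0 0 1 0 0) 4 0; ClassStep (ZV 0 1 0 1 0 0) 6 0;
    ClassStep (ZV 0 1 0 1 1 0) 18 2; ClassStep (ZV 1 1 1 2 2 1) 15 1234315423145]);
  ([:: 45341324534132421]%num, [:: ClassStep (ZV 0 0 0 0 0 1) 14 0; ClassStep (ZV 0 0 0 0 1 0) 4 0;
    ClassStep (ZV 0 0 1 0 0 0) 5 0; ClassStep (ZV 0 0 0 1 1 0) 12 0;
    ClassStep (ZV 0 0 0 1 1 1) 13 56; ClassStep (ZV 0 1 1 2 1 0) 22 0]);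
  ([:: 1]%num, [:: ClassStep (ZV 0 0 0 0 1 0) 4 1423143; ClassStep (ZV 1 0 0 0 0 0) 6 543165423456;
    ClassStep (ZV 0 0 0 0 1 1) 13 5423143542654231435426543; ClassStep (ZV 0 0 0 1 1 0) 5 0;
    ClassStep (ZV 0 0 1 1 1 0) 12 0; ClassStep (ZV 0 1 1 1 1 0) 18 4;
    ClassStep (ZV 0 1 1 2 2 1) 15 2456; ClassStep (ZV 1 1 2 2 1 0) 22 31423;
    ClassStep (ZV 1 1 2 2 2 1) 13 543165423456]);
  ([:: 4563451342; 31]%num, [:: ClassStep (ZV 0 0 1 0 0 0) 4 1423143542654;
    ClassStep (ZV 0 1 0 0 0 0) 14 0; ClassStep (ZV 0 0 0 1 1 1) 15 0]);
  ([:: 654324561324524321]%num, [:: ClassStep (ZV 0 0 0 1 1 0) 5 31;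
    ClassStep (ZV 0 1 0 1 1 0) 6 5431; ClassStep (ZV 1 0 1 1 1 0) 12 0;
    ClassStep (ZV 1 1 1 1 1 0) 18 4231]);
  ([::], [:: ClassStep (ZV 0 0 0 0 0 1) 16 0; ClassStep (ZV 0 0 0 0 1 0) 7 0;
    ClassStep (ZV 0 0 0 1 1 0) 8 0; ClassStep (ZV 0 0 1 1 1 0) 9 0;
    ClassStep (ZV 0 1 0 1 1 1) 19 56; ClassStep (ZV 1 0 1 1 1 0) 11 0]);
  ([::], [:: ClassStep (ZV 0 0 0 0 0 1) 7 0; ClassStep (ZV 0 0 0 1 0 0) 8 65;
    ClassStep (ZV 0 0 0 0 1 1) 16 0; ClassStep (ZV 0 1 0 1 0 0) 9 654231435465;
    ClassStep (ZV 0 1 0 1 1 1) 19 2; ClassStep (ZV 0 1 1 2 2 1) 23 5465]);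
  ([:: 31]%num, [:: ClassStep (ZV 0 0 0 0 0 1) 8 0; ClassStep (ZV 0 0 1 0 0 0) 8 165423143542654;
    ClassStep (ZV 0 1 0 0 0 0) 10 0; ClassStep (ZV 0 0 0 1 1 1) 16 0;
    ClassStep (ZV 0 1 1 2 1 1) 23 0; ClassStep (ZV 1 1 2 3 2 1) 24 134]);
  ([::], [:: ClassStep (ZV 0 0 0 0 0 1) 7 1315423143542; ClassStep (ZV 0 1 0 1 0 0) 19 2;
    ClassStep (ZV 0 0 0 1 1 1) 10 0; ClassStep (ZV 0 1 0 1 1 0) 19 56;
    ClassStep (ZV 0 0 1 1 1 1) 9 6542; ClassStep (ZV 0 1 0 1 1 1) 16 0;
    ClassStep (ZV 1 1 1 2 1 1) 20 15; ClassStep (ZV 1 2 2 3 2 1) 23 1314543654231]);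
  ([::], [:: ClassStep (ZV 0 0 0 0 0 1) 12 0; ClassStep (ZV 0 0 0 0 1 1) 13 0;
    ClassStep (ZV 0 0 0 1 1 1) 14 0; ClassStep (ZV 0 1 0 1 1 1) 15 0]);
  ([:: 654324561324532431; 52]%num, [:: ClassStep (ZV 0 0 0 1 1 0) 6 2431;
    ClassStep (ZV 1 1 1 2 1 0) 18 0]);
  ([::], [:: ClassStep (ZV 0 0 0 0 0 1) 19 0; ClassStep (ZV 0 0 0 0 1 0) 11 1234;
    ClassStep (ZV 0 0 0 1 1 0) 7 2; ClassStep (ZV 0 0 1 1 1 1) 20 346;
    ClassStep (ZV 0 1 1 2 1 0) 9 4; ClassStep (ZV 1 1 1 2 1 0) 17 0]);
  ([::], [:: ClassStep (ZV 0 0 0 0 0 1) 18 0; ClassStep (ZV 0 0 0 1 0 0) 15 2;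
    ClassStep (ZV 0 1 0 1 0 0) 12 65; ClassStep (ZV 0 0 0 1 1 1) 13 2]);
  ([:: 654321; 345432]%num, [:: ClassStep (ZV 0 0 0 1 1 0) 18 436;
    ClassStep (ZV 0 1 1 2 2 1) 15 15]);
  ([:: 654324561345324321; 2]%num, [:: ClassStep (ZV 0 1 1 2 1 0) 5 31;
    ClassStep (ZV 1 1 2 2 1 0) 22 0]);
  ([:: 42; 5]%num, [:: ClassStep (ZV 0 0 0 0 0 1) 23 0; ClassStep (ZV 0 1 0 1 1 0) 9 23143;
    ClassStep (ZV 0 1 1 2 1 0) 8 0; ClassStep (ZV 1 1 2 2 1 0) 21 0]);
  ([:: 42]%num, [:: ClassStep (ZV 0 0 0 0 0 1) 22 0; ClassStep (ZV 0 1 0 1 0 0) 15 1234315465431;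
    ClassStep (ZV 0 1 1 1 0 0) 13 5465; ClassStep (ZV 0 1 1 2 1 1) 14 0]);
  ([:: 5432; 654321]%num, [:: ClassStep (ZV 0 1 1 2 2 1) 14 431])].

Definition class_word (k : nat) : word := word_of (nth 0%num class_words k).

Arguments digits : simpl never.
Arguments word_of : simpl never.
Arguments class_word : simpl never.

Definition agree (f g : zvec -> zvec) : bool :=
  all (fun i => zeqb (f (zsimple i)) (g (zsimple i))) simple_words.

Definition commutes (w s : word) : bool :=
  agree (fun v => zact s (zact w v)) (fun v => zact w (zact s v)).

Definition class_step_ok (k : nat) (st : class_step) : bool :=
  let u := word_of (cs_word st) in
  [&& cs_root st \in zroots, (cs_class st < 25)%nat &
    agree (fun x => zact u (zreflection (cs_root st) (zact (class_word k) x)))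
          (fun x => zact (class_word (cs_class st)) (zact u x))].

Definition class_steps_ok (k : nat) : bool :=
  let: (gs, sts) := nth ([::], [::]) class_steps k in
  let w := class_word k in
  [&& all (fun n => commutes w (word_of n)) gs, all (class_step_ok k) sts &
    let reps := map cs_root sts in
    let orbit := closure zact (w :: map word_of gs) 12 (reps ++ map (zscale (-1)) reps) in
    all (fun v => v \in orbit) zroots].

Section classification.
Context (R : realType) (Phi : rootSystem R 6).
Implicit Types (x : 'rV[R]_6) (v : zvec) (s : word).

Lemma closureP (I : eqType) (F : I -> zvec -> zvec) (r : seq I) n (s : seq zvec)
    (P : zvec -> Prop) :
  (forall v, v \in s -> P v) -> (forall i v, i \in r -> P v -> P (F i v)) ->
  forall v, v \in closure F r n s -> P v.
Proof.
move=> Ps PF; elim: n => [//|n IH] v.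
rewrite /closure iterS mem_undup mem_cat; case/orP; first exact: IH.
by case/allpairsP => -[i u] /= [ri us ->]; apply: PF => //; exact: IH.
Qed.

Lemma zsimple_reflection_clamp i : exists2 j, j \in simple_words &
  zsimple_reflection i = zsimple_reflection j.
Proof.
by case: i => [|[|[|[|[|[|i]]]]]]; [exists 6%nat|exists 1%nat|exists 2%nat|exists 3%nat|
  exists 4%nat|exists 5%nat|exists 6%nat].
Qed.

Lemma zact_closed (S : seq zvec) s v :
  all (fun v => all (fun i => zsimple_reflection i v \in S) simple_words) S ->
  v \in S -> zact s v \in S.
Proof.
move=> clS vS; elim: s => //= i s IH.
have [j js ->] := zsimple_reflection_clamp i.
by have /allP/(_ _ IH)/allP/(_ _ js) := clS.
Qed.

Lemma zact_zroots s v : v \in zroots -> zact s v \in zroots.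
Proof. by apply: zact_closed; vm_compute. Qed.

Lemma zact_zweights s v : v \in zweights -> zact s v \in zweights.
Proof. by apply: zact_closed; vm_compute. Qed.

Context (a : 'I_6 -> 'rV[R]_6) (E : E6_base Phi a).
Local Notation vec := (vec a).
Local Notation act := (act a).

Lemma zroots_root v : v \in zroots -> root_set Phi (vec v).
Proof.
rewrite (_ : zroots = simple_orbit (map zsimple simple_words)); last by vm_compute.
move: v; apply: (closureP (P := fun v => root_set Phi (vec v))) => [u /mapP[i _ ->]|i u _ ru].
  by rewrite vec_simple; exact: (simple_root E).
by rewrite -(vec_simple_reflection E); exact: roots_reflection (simple_root E _) ru.
Qed.

Lemma root_zroots x : root_set Phi x -> exists2 v, v \in zroots & x = vec v.
Proof.
move=> /(root_word E)[s [i ->]]; rewrite -vec_simple (act_vec E).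
exists (zact s (zsimple i)) => //; apply: zact_zroots.
by case: i => [|[|[|[|[|[|i]]]]]].
Qed.

(** Two elements of the Weyl group that agree on the simple roots are equal. *)
Lemma agreeP (f g : 'rV[R]_6 -> 'rV[R]_6) (zf zg : zvec -> zvec) :
  weyl Phi f -> weyl Phi g ->
  (forall v, f (vec v) = vec (zf v)) -> (forall v, g (vec v) = vec (zg v)) ->
  agree zf zg -> f = g.
Proof.
move=> Wf Wg fE gE /allP fg; apply: (eq_on_simple E Wf Wg) => i i6.
rewrite fE gE; congr vec; apply/zeqbP/fg.
by case: i i6 => [|[|[|[|[|[|[|i]]]]]]].
Qed.

Lemma commutes_centralizer w s : commutes w s -> weyl_centralizer Phi (act w) (act s).
Proof.
move=> cs; split; first exact: (act_weyl E).
apply: (agreeP _ _ _ _ cs).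
- by apply: weyl_comp; exact: (act_weyl E).
- by apply: weyl_comp; exact: (act_weyl E).
- by move=> v; rewrite /comp !(act_vec E).
- by move=> v; rewrite /comp !(act_vec E).
Qed.

Lemma zroots_norm v : v \in zroots -> zdot v v = 2%Z.
Proof.
have /allP h : all (fun v => (zdot v v =? 2)%Z) zroots by vm_compute.
by move=> /h/Z.eqb_eq.
Qed.

Lemma vec_opp v : vec (zscale (-1) v) = - vec v.
Proof. by rewrite vecZ scaleN1r. Qed.

Lemma reflectionN x : reflection (- x) = reflection x.
Proof.
by apply/funext => y; rewrite /reflection !dotNl !dotNr opprK mulrN mulNr scalerN scaleNr opprK.
Qed.

Lemma reflection_weyl f x y : weyl Phi f -> reflection (f x) (f y) = f (reflection x y).
Proof.
by move=> Wf; rewrite /reflection (weylB _ _ Wf) (weylZ _ _ Wf) !(weyl_dot _ _ Wf).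
Qed.

Lemma class_steps_checked : all class_steps_ok (iota 0 25).
Proof. by vm_compute. Qed.

Lemma reflection_class k v : (k < 25)%nat -> v \in zroots ->
  exists j u, [/\ (j < 25)%nat, weyl Phi u &
    forall x, u (reflection (vec v) (act (class_word k) x)) = act (class_word j) (u x)].
Proof.
move=> k25 vr; have /allP/(_ k) := class_steps_checked.
rewrite mem_iota k25 => /(_ isT); rewrite /class_steps_ok.
case: (nth _ class_steps k) => gs sts /and3P[/allP gsP stsP /allP/(_ v vr)].
pose P v := exists j u, [/\ (j < 25)%nat, weyl Phi u &
  forall x, u (reflection (vec v) (act (class_word k) x)) = act (class_word j) (u x)].
rewrite -/(P v); move: v {vr}; apply: (closureP (P := P)) => [v|s v].
  have base u : u \in map cs_root sts -> P u.
    elim: sts stsP => //= st sts IH /andP[/and3P[rr j25 ag] ok]; rewrite inE.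
    case/orP => [/eqP->|]; last exact: IH.
    exists (cs_class st), (act (word_of (cs_word st))).
    split=> //; first exact: (act_weyl E).
    pose r := reflection (vec (cs_root st)) \o act (class_word k).
    move=> x; rewrite -[LHS]/((act (word_of (cs_word st)) \o r) x).
    rewrite -[RHS]/((act (class_word (cs_class st)) \o act (word_of (cs_word st))) x).
    congr (_ x); apply: (agreeP _ _ _ _ ag).
    - apply: weyl_comp; first exact: (act_weyl E).
      by apply: weyl_reflection; [exact: zroots_root|exact: (act_weyl E)].
    - by apply: weyl_comp; exact: (act_weyl E).
    - move=> u'; rewrite /r /comp (act_vec E) (vec_reflection E) ?(act_vec E)//.
      exact: zroots_norm.
    - by move=> u'; rewrite /comp !(act_vec E).
  rewrite mem_cat => /orP[/base//|/mapP[u /base[j [g [j25 Wg gE]]] ->]].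
  by exists j, g; split=> // x; rewrite vec_opp reflectionN.
move=> s_in [j [g [j25 Wg gE]]].
have Zs : weyl_centralizer Phi (act (class_word k)) (act s).
  move: s_in; rewrite inE => /orP[/eqP->|/mapP[n /gsP com ->]].
    by split=> //; exact: (act_weyl E).
  exact: commutes_centralizer.
have [z [[Wz zw] sz zs]] := centralizer_inv Zs.
exists j, (g \o z); split=> //; first exact: weyl_comp.
move=> x; have Zz : weyl_centralizer Phi (act (class_word k)) z by [].
rewrite /= -gE -(centralizer_comm _ Zz) -(act_vec E) -[in LHS](zs (act (class_word k) x)).
by rewrite (reflection_weyl _ _ (proj1 Zs)) sz.
Qed.

(** Induction on the number of reflections: if g is conjugate to a representative by u, then
  the product of g and a reflection is conjugate by u to the product of that representative
  and another reflection. *)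
Lemma weyl_class f : weyl Phi f -> exists j u, [/\ (j < 25)%nat, weyl Phi u &
  forall x, u (f x) = act (class_word j) (u x)].
Proof.
elim=> [|b g rb Wg [j [u [j25 Wu ug]]]].
  by exists 0%nat, idfun; split=> //; exact: weyl_id.
have [v vr ubv] := root_zroots (weyl_root Wu rb).
have [k [u' [k25 Wu' u'E]]] := reflection_class j25 vr.
exists k, (u' \o u); split=> //; first exact: weyl_comp.
by move=> x /=; rewrite -u'E -ug -(reflection_weyl b (g x) Wu) ubv.
Qed.

End classification.

Lemma E6_base_weyl (R : realType) (Phi : rootSystem R 6) (a : 'I_6 -> 'rV[R]_6) u :
  weyl Phi u -> E6_base Phi a -> E6_base Phi (u \o a).
Proof.
move=> Wu [nrm [ra free span] cart]; have [v [Wv uv vu _]] := weyl_inv Wu.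
split=> //; last by move=> i j /=; rewrite !(weyl_dot _ _ Wu).
split=> /=.
- by move=> i; exact: weyl_root.
- apply: inj_row_free => c; rewrite mulmx_sum_row => c0.
  apply: (row_free_inj free); rewrite mul0mx mulmx_sum_row.
  set x := \sum_i _; suff ux : u x = 0 by rewrite -[LHS]uv ux (weyl0 Wv).
  rewrite (weyl_sum _ _ Wu) -[RHS]c0.
  by apply: eq_bigr => i _; rewrite (weylZ _ _ Wu) !rowK.
- move=> b rb; have [k [vb ksign]] := span _ (weyl_root Wv rb).
  exists k; split=> //; rewrite -[LHS]vu vb (weyl_sum _ _ Wu).
  by apply: eq_bigr => i _; rewrite -scaler_int (weylZ _ _ Wu) scaler_int.
Qed.

Lemma act_base_weyl (R : realType) (Phi : rootSystem R 6) (a : 'I_6 -> 'rV[R]_6) u s x :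
  weyl Phi u -> act (u \o a) s (u x) = u (act a s x).
Proof. by move=> Wu; elim: s => //= i s ->; rewrite (reflection_weyl _ _ Wu). Qed.

(** * Certificates for slices *)

(** A Smith normal form of w - 1 on L. Vectors of the dual lattice are multiplied by 3 to make
  their coordinates integral. With b, s the thirds of co_vec and co_test, and d = co_ord, the
  form <., theta> = <w(.) - ., s> / d vanishes on ker (w - 1) and is integral on L, and x minus
  the sum of the <x, theta> b lies in ker (w - 1). So the <x, theta> modulo 1 are coordinates
  on F / (L + ker (w - 1)), with values in (1/d) Z / Z. *)
Record coordinate := Coordinate {
  co_vec : zvec; co_test : zvec; co_ord : Z }.

(** A wall beta obtained from a root, together with elements u_0, ..., u_(m-1) of the
  centraliser that act on ker (w - 1) as the reflection in beta. Followed by a translation in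
  L, u_j fixes the mirror of level j; the translation by 2 m beta / <beta, beta> lies in L and
  takes care of the other levels. *)
Record wall_certificate := Wall {
  wc_root : zvec; wc_moves : seq N }.

(** The slice goes through x0 = sc_point / sc_den, and its centre is x0 + sc_centre / sc_centre_den.
  An entry (n, t) of sc_mult says that the roots whose sum over the powers of w has squared
  length n give walls, namely t times their projections to ker (w - 1). The walls that are
  roots with integral value at x0 have their own reflections; sc_walls deals with
  the others. *)
Record slice_certificate := Slice {
  sc_point : zvec; sc_den : Z;
  sc_mult : seq (Z * Z);
  sc_centre : zvec; sc_centre_den : Z;
  sc_walls : seq wall_certificate }.

(** When w - 1 is invertible, a slice is a point and has no walls. *)
Definition point_slice (p : zvec) (k : Z) : slice_certificate :=
  Slice p k [::] zzero 1 [::].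

(** Properties of x that depend only on its slice up to the affine group, because the Weyl group
  acts trivially on the dual lattice modulo the root lattice: k x - e / 3 in L + ker (w - 1),
  and w x - x - e / 3 in the root lattice, for e / 3 in the dual lattice. They tell the slices
  of a certificate apart. *)
Inductive invariant := Multiple of Z & zvec | Displacement of zvec.

(** tc_targets and tc_moves have one entry for each residue of the coordinates: the slice to which
  such a point can be moved, and the element of the centraliser that does it. *)
Record torus_certificate := Torus {
  tc_coords : seq coordinate;
  tc_slices : seq slice_certificate;
  tc_targets : seq nat; tc_moves : seq N;
  tc_invariants : seq invariant }.

Definition tc_cover (t : torus_certificate) : seq (nat * N) := seq.zip (tc_targets t) (tc_moves t).

(** cc_v0_norm selects the vector v0, see zaxis. *)
Record class_certificate := ClassCertificate {
  cc_order : nat; cc_v0_norm : Z;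
  cc_root : torus_certificate; cc_dual : torus_certificate }.

Section checker.
Local Open Scope Z_scope.

Definition zdivides (k : Z) (v : zvec) : bool :=
  let: ZV a b c d e f := v in
  [&& a mod k =? 0, b mod k =? 0, c mod k =? 0, d mod k =? 0, e mod k =? 0 & f mod k =? 0].

Definition in_lattice (dual : bool) (k : Z) (v : zvec) : bool :=
  zdivides k (if dual then zdual v else v).

Definition zquot (v : zvec) (k : Z) : zvec :=
  ZV (zc1 v / k) (zc2 v / k) (zc3 v / k) (zc4 v / k) (zc5 v / k) (zc6 v / k).

Variables (w : word) (o : nat).

(** Up to the factor o, the projection to ker (w - 1). *)
Definition ztrace (v : zvec) : zvec := zsum (traject (zact w) v o).

Definition ztrace_norm (v : zvec) : Z := zdot (ztrace v) (ztrace v).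

Definition order_ok : bool :=
  (0 < o)%nat && agree (fun v => zact w (ztrace v)) ztrace.

(** The centraliser permutes the 27 weights and commutes with the projection, so it fixes this
  sum. A negative n gives 0. *)
Definition zaxis (n : Z) : zvec :=
  zsum [seq ztrace m | m <- zweights & ztrace_norm m =? n].

Definition co_char (c : coordinate) : zvec :=
  zquot (zsub (zact (rev w) (co_test c)) (co_test c)) (co_ord c).

Variables (v0 : zvec) (dual : bool).

Definition coordinate_ok (c : coordinate) : bool :=
  [&& 0 <? co_ord c, in_lattice (~~ dual) 3 (co_char c), in_lattice dual 3 (co_vec c),
      in_lattice (~~ dual) 3 (co_test c) &
      all (fun i => zdot (zsub (zact w (zsimple i)) (zsimple i)) (co_test c) =?
                    co_ord c * zdot (zsimple i) (co_char c)) simple_words].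

Definition coordinates_complete (cs : seq coordinate) : bool :=
  all (fun i => let y := zsub (zscale 9 (zsimple i))
      (zsum [seq zscale (zdot (zsimple i) (co_char c)) (co_vec c) | c <- cs]) in
    zeqb (zact w y) y) simple_words.

Definition in_slice_group (cs : seq coordinate) (k : Z) (v : zvec) : bool :=
  all (fun c => zdot v (co_char c) mod (3 * k) =? 0) cs.

Fixpoint residues (ds : seq Z) : seq (seq Z) :=
  if ds is d :: ds' then
    [seq Z.of_nat k :: ks | k <- iota 0 (Z.to_nat d), ks <- residues ds']
  else [:: [::]].

Definition order_product (cs : seq coordinate) : Z :=
  foldr (fun c k => co_ord c * k) 1 cs.

Definition residue_point (cs : seq coordinate) (ks : seq Z) : zvec :=
  zsum [seq zscale (ck.2 * (order_product cs / co_ord ck.1)) (co_vec ck.1)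
       | ck <- seq.zip cs ks].

Definition cover_ok (cs : seq coordinate) (ss : seq slice_certificate)
    (ke : seq Z * (nat * N)) : bool :=
  let: (ks, (i, n)) := ke in
  let s := nth (point_slice zzero 1) ss i in
  let u := word_of n in let D := 3 * order_product cs in
  [&& (i < size ss)%nat, commutes w u &
      in_slice_group cs (D * sc_den s)
        (zsub (zscale (sc_den s) (zact u (residue_point cs ks))) (zscale D (sc_point s)))].

Definition invariant_ok (i : invariant) : bool :=
  match i with Multiple _ e => in_lattice true 3 e | Displacement e => in_lattice true 3 e end.

Definition invariant_holds (cs : seq coordinate) (i : invariant) (s : slice_certificate) : bool :=
  match i with
  | Multiple k e => in_slice_group cs (3 * sc_den s)
      (zsub (zscale (3 * k) (sc_point s)) (zscale (sc_den s) e))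
  | Displacement e => zdivides (3 * sc_den s)
      (zsub (zscale 3 (zsub (zact w (sc_point s)) (sc_point s))) (zscale (sc_den s) e))
  end.

Definition eliminate (c : zvec -> Z) (y z : zvec) : zvec :=
  zsub (zscale (c y) z) (zscale (c z) y).

Definition pivot (y : zvec) : zvec -> Z :=
  nth zc1 [seq c : zvec -> Z <- [:: zc1; zc2; zc3; zc4; zc5; zc6] | ~~ (c y =? 0)] 0.

(** Gaussian elimination without divisions: r reduces a vector by the rows already used. The
  test is whether the vectors ts become zero. *)
Fixpoint spanned (r : zvec -> zvec) (ys ts : seq zvec) : bool :=
  all (fun t => zeqb (r t) zzero) ts ||
  if ys is y :: ys' then
    let y' := r y in let c := pivot y' in
    if c y' =? 0 then spanned r ys' ts else spanned (fun z => eliminate c y' (r z)) ys' ts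
  else false.

Section slice.
Variable s : slice_certificate.

(** 0 for a root that gives no wall. *)
Definition multiplier (v : zvec) : Z :=
  let n := ztrace_norm v in
  foldr (fun nk k => if nk.1 =? n then nk.2 else k) 0 (sc_mult s).

Definition wall_roots : seq zvec := [seq v <- zroots | ~~ (multiplier v =? 0)].

Definition wall_ok (c : wall_certificate) : bool :=
  let na := ztrace (wc_root c) in let nn := zdot na na in
  let t := multiplier (wc_root c) in let m := size (wc_moves c) in
  let step := zquot (zscale (6 * Z.of_nat m * Z.of_nat o) na) (t * nn) in
  [&& (0 < m)%nat, in_lattice dual 3 step,
      zeqb (zscale (t * nn) step) (zscale (6 * Z.of_nat m * Z.of_nat o) na) &
      all (fun jn => let: (j, n) := jn in let u := word_of n in
        let shift := zscale (3 * t * nn) (zsub (zact u (sc_point s)) (sc_point s)) in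
        let goal := zscale (6 * sc_den s * Z.of_nat j * Z.of_nat o) na in
        let l := zquot (zsub goal shift) (sc_den s * t * nn) in
        [&& commutes w u, in_lattice dual 3 l,
          all (fun i => let ne := ztrace (zsimple i) in
            zeqb (zscale nn (zact u ne)) (zsub (zscale nn ne) (zscale (2 * zdot ne na) na)))
            simple_words &
          zeqb (zadd shift (zscale (sc_den s * t * nn) l)) goal])
      (seq.zip (iota 0 m) (wc_moves c))].

Definition wall_match (v : zvec) (c : wall_certificate) : bool :=
  zeqb (ztrace v) (ztrace (wc_root c)) ||
  zeqb (ztrace v) (zscale (-1) (ztrace (wc_root c))).

Definition wall_reflected (v : zvec) : bool :=
  [&& multiplier v =? 1, zeqb (ztrace v) (zscale (Z.of_nat o) v) &
      zdot (sc_point s) v mod sc_den s =? 0]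
  || has (wall_match v) (sc_walls s).

(** Two sufficient conditions for the stabiliser to shift the values of the walls by integers:
  either they are integral at x0, or they vanish at x0 and the walls lie in the root
  lattice. *)
Definition wall_integral : bool :=
  all (fun v => (multiplier v * zdot (sc_point s) v) mod sc_den s =? 0) wall_roots
  || all (fun v => (zdot (sc_point s) (ztrace v) =? 0) &&
       zdivides (Z.of_nat o) (zscale (multiplier v) (ztrace v))) wall_roots.

Definition centre_ok : bool :=
  let c := sc_centre s in let h := sc_centre_den s in
  [&& 0 <? h, zeqb (zact w c) c, zdot c v0 =? 0,
      all (fun v => ~~ ((multiplier v * zdot c v) mod h =? 0)) wall_roots &
      zeqb (zsum [seq zscale (multiplier v * (2 * ((multiplier v * zdot c v) mod h) - h))
                        (ztrace v) | v <- wall_roots]) zzero].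

Definition span_ok : bool :=
  spanned id (v0 :: [seq ztrace v | v <- wall_roots]) [seq ztrace (zsimple i) | i <- simple_words].

Definition slice_ok : bool :=
  [&& 0 <? sc_den s,
      in_lattice dual (sc_den s) (zsub (zact w (sc_point s)) (sc_point s)),
      zdot (sc_point s) v0 =? 0,
      all (fun v => zdot (ztrace v) v0 =? 0) wall_roots,
      wall_integral, all wall_ok (sc_walls s), all wall_reflected wall_roots,
      centre_ok & span_ok].

End slice.

Definition torus_ok (t : torus_certificate) : bool :=
  let cs := tc_coords t in let ss := tc_slices t in
  [&& all coordinate_ok cs, coordinates_complete cs, all slice_ok ss,
      size (residues (map co_ord cs)) == size (tc_cover t),
      all (cover_ok cs ss) (seq.zip (residues (map co_ord cs)) (tc_cover t)),
      all invariant_ok (tc_invariants t) &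
      pairwise (fun s s' => has (fun i => invariant_holds cs i s != invariant_holds cs i s')
                                (tc_invariants t)) ss].

End checker.

Definition class_ok (k : nat) (c : class_certificate) : bool :=
  let w := class_word k in let v0 := zaxis w (cc_order c) (cc_v0_norm c) in
  [&& order_ok w (cc_order c), torus_ok w (cc_order c) v0 false (cc_root c),
      torus_ok w (cc_order c) v0 true (cc_dual c) &
      size (tc_slices (cc_root c)) == size (tc_slices (cc_dual c))].

(** * The certificates of the 25 classes *)

Section certificates.
Local Open Scope Z_scope.


(** Each certificate is named after the class in Carter's notation; the second integer of a class
  is -1 when v0 = 0. Slices common to both lattices are written once. *)
Definition cert_id : class_certificate :=
  let s0 := Slice (ZV 0 0 0 0 0 0) 1 [:: (2, 1)] (ZV 0 1 1 3 5 8) 12 [::] in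
  ClassCertificate 1 (-1)
   (Torus
    [::]
    [:: s0] [:: 0]%nat [:: 0]%num [::])
   (Torus
    [::]
    [:: s0] [:: 0]%nat [:: 0]%num [::]).

Definition cert_A1 : class_certificate :=
  let s0 := Slice (ZV 0 0 0 0 0 0) 1 [:: (8, 1)] (ZV 3 2 6 6 6 8) 12 [::] in
  ClassCertificate 2 (-1)
   (Torus
    [:: Coordinate (ZV 0 0 3 0 0 0) (ZV 4 3 5 6 4 2) 1]
    [:: s0] [:: 0]%nat [:: 0]%num [::])
   (Torus
    [:: Coordinate (ZV 4 3 5 6 4 2) (ZV 0 0 3 0 0 0) 1]
    [:: s0] [:: 0]%nat [:: 0]%num [::]).

Definition cert_2A1 : class_certificate :=
  let s0 := Slice (ZV 0 0 0 0 0 0) 1 [:: (8, 1)] (ZV 1 1 2 2 2 4) 8 [::] in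
  ClassCertificate 2 12
   (Torus
    [:: Coordinate (ZV 0 0 3 0 0 0) (ZV 4 3 5 6 4 2) 1;
      Coordinate (ZV 0 0 0 3 0 0) (ZV 3 6 6 9 6 3) 1]
    [:: s0] [:: 0]%nat [:: 0]%num [::])
   (Torus
    [:: Coordinate (ZV 4 3 5 6 4 2) (ZV 0 0 3 0 0 0) 1;
      Coordinate (ZV 3 6 6 9 6 3) (ZV 0 0 0 3 0 0) 1]
    [:: s0] [:: 0]%nat [:: 0]%num [::]).

Definition cert_A2 : class_certificate :=
  let s0 := Slice (ZV 0 0 0 0 0 0) 1 [:: (18, 1)] (ZV 1 1 2 3 2 2) 3 [::] in
  ClassCertificate 3 (-1)
   (Torus
    [:: Coordinate (ZV 0 0 3 0 0 0) (ZV 4 3 5 6 4 2) 1;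
      Coordinate (ZV 0 0 0 3 0 0) (ZV 9 9 15 18 12 6) 1]
    [:: s0] [:: 0]%nat [:: 0]%num [::])
   (Torus
    [:: Coordinate (ZV 4 3 5 6 4 2) (ZV (-3) 0 0 0 0 0) 1;
      Coordinate (ZV 9 9 15 18 12 6) (ZV 3 0 3 6 0 0) 1]
    [:: s0] [:: 0]%nat [:: 0]%num [::]).

Definition cert_A2_A1 : class_certificate :=
  let s0 := Slice (ZV 0 0 0 0 0 0) 1 [:: (72, 1)] (ZV 0 0 0 0 0 1) 3 [::] in
  ClassCertificate 6 54
   (Torus
    [:: Coordinate (ZV 0 0 3 0 0 0) (ZV 4 3 5 6 4 2) 1;
      Coordinate (ZV 0 0 0 3 0 0) (ZV 3 6 6 9 6 3) 1;
      Coordinate (ZV 3 6 6 12 0 0) (ZV 6 3 9 9 6 3) 1]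
    [:: s0] [:: 0]%nat [:: 0]%num [::])
   (Torus
    [:: Coordinate (ZV 4 3 5 6 4 2) (ZV (-3) 0 0 0 0 0) 1;
      Coordinate (ZV 3 6 6 9 6 3) (ZV 3 0 0 3 0 0) 1;
      Coordinate (ZV 3 (-3) 3 0 0 0) (ZV 3 3 3 6 0 0) 1]
    [:: s0] [:: 0]%nat [:: 0]%num [::]).

Definition cert_3A1 : class_certificate :=
  let s0 := Slice (ZV 0 0 0 0 0 0) 1 [:: (8, 1); (4, 1)] (ZV 1 1 2 2 5 8) 12
      [:: Wall (ZV 0 0 0 1 0 0) [:: 4524]%num; Wall (ZV 0 0 1 1 1 1)
      [:: 653413245613]%num; Wall (ZV 0 1 1 2 1 1) [:: 45624534132456134524]%num] in
  ClassCertificate 2 (-1)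
   (Torus
    [:: Coordinate (ZV 0 0 3 0 0 0) (ZV 4 3 5 6 4 2) 1;
      Coordinate (ZV 0 0 0 3 0 0) (ZV 3 6 6 9 6 3) 1;
      Coordinate (ZV 0 0 0 0 0 3) (ZV 1 0 2 3 4 2) 1]
    [:: s0] [:: 0]%nat [:: 0]%num [::])
   (Torus
    [:: Coordinate (ZV 4 3 5 6 4 2) (ZV 0 0 3 0 0 0) 1;
      Coordinate (ZV 3 6 6 9 6 3) (ZV 0 0 0 3 0 0) 1;
      Coordinate (ZV 1 0 2 3 4 2) (ZV 0 0 0 0 0 3) 1]
    [:: s0] [:: 0]%nat [:: 0]%num [::]).

Definition cert_A3 : class_certificate :=
  let s0 := Slice (ZV 0 0 0 0 0 0) 1 [:: (32, 1)] (ZV 1 2 2 3 2 2) 4 [::] in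
  ClassCertificate 4 192
   (Torus
    [:: Coordinate (ZV 0 0 3 0 0 0) (ZV 4 3 5 6 4 2) 1;
      Coordinate (ZV 0 0 0 3 0 0) (ZV 9 9 15 18 12 6) 1;
      Coordinate (ZV 0 3 0 0 0 0) (ZV 15 18 27 36 24 12) 1]
    [:: s0] [:: 0]%nat [:: 0]%num [::])
   (Torus
    [:: Coordinate (ZV 4 3 5 6 4 2) (ZV (-3) 0 0 0 0 0) 1;
      Coordinate (ZV 6 9 12 18 12 6) (ZV 3 3 0 0 0 0) 1;
      Coordinate (ZV (-3) (-9) (-9) (-18) (-12) (-6)) (ZV 3 9 3 6 0 0) 1]
    [:: s0] [:: 0]%nat [:: 0]%num [::]).

Definition cert_A4 : class_certificate :=
  let s0 := Slice (ZV 0 0 0 0 0 0) 1 [:: (50, 1)] (ZV 0 0 0 0 0 1) 4 [::] in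
  ClassCertificate 5 300
   (Torus
    [:: Coordinate (ZV 0 0 3 0 0 0) (ZV 4 3 5 6 4 2) 1;
      Coordinate (ZV 0 0 0 3 0 0) (ZV 3 6 6 9 6 3) 1;
      Coordinate (ZV 3 0 6 0 0 0) (ZV (-6) (-9) (-12) (-18) (-12) (-6)) 1;
      Coordinate (ZV 3 3 6 6 6 0) (ZV 12 24 27 45 30 15) 1]
    [:: s0] [:: 0]%nat [:: 0]%num [::])
   (Torus
    [:: Coordinate (ZV 4 3 5 6 4 2) (ZV (-3) 0 0 0 0 0) 1;
      Coordinate (ZV 3 6 6 9 6 3) (ZV (-3) (-3) 0 0 0 0) 1;
      Coordinate (ZV 15 21 27 36 24 12) (ZV 3 3 3 0 0 0) 1;
      Coordinate (ZV (-21) (-27) (-36) (-45) (-30) (-15)) (ZV 0 0 0 (-3) (-3) 0) 1]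
    [:: s0] [:: 0]%nat [:: 0]%num [::]).

Definition cert_A2_2A1 : class_certificate :=
  let s0 := Slice (ZV 0 0 0 0 0 0) 1 [:: (12, 1)] (ZV (-2) (-3) (-4) (-6) (-3) 0) 4
      [:: Wall (ZV 0 0 0 1 0 0) [:: 4534132453413241]%num] in
  ClassCertificate 6 270
   (Torus
    [:: Coordinate (ZV 0 0 3 0 0 0) (ZV 4 3 5 6 4 2) 1;
      Coordinate (ZV 0 0 0 3 0 0) (ZV 3 6 6 9 6 3) 1;
      Coordinate (ZV 0 0 0 0 0 3) (ZV 1 0 2 3 4 2) 1;
      Coordinate (ZV 3 6 6 12 0 (-12)) (ZV 6 3 9 9 6 3) 1]
    [:: s0] [:: 0]%nat [:: 0]%num [::])
   (Torus
    [:: Coordinate (ZV 4 3 5 6 4 2) (ZV (-3) 0 0 0 0 0) 1;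
      Coordinate (ZV 3 6 6 9 6 3) (ZV 3 0 0 3 0 0) 1;
      Coordinate (ZV 1 0 2 3 4 2) (ZV 0 0 0 0 0 3) 1;
      Coordinate (ZV 3 (-3) 3 0 0 0) (ZV 3 3 3 6 0 (-6)) 1]
    [:: s0] [:: 0]%nat [:: 0]%num [::]).

Definition cert_A3_A1 : class_certificate :=
  let s0 := Slice (ZV 0 0 0 0 0 0) 1 [:: (32, 1)] (ZV (-1) (-1) (-2) (-2) (-1) 0) 4 [::] in
  ClassCertificate 4 192
   (Torus
    [:: Coordinate (ZV 0 0 3 0 0 0) (ZV 4 3 5 6 4 2) 1;
      Coordinate (ZV 0 0 0 3 0 0) (ZV 3 6 6 9 6 3) 1;
      Coordinate (ZV 0 0 0 0 3 0) (ZV 5 12 13 21 14 7) 1;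
      Coordinate (ZV 0 0 0 0 0 3) (ZV 5 15 16 27 20 10) 1]
    [:: s0] [:: 0]%nat [:: 0]%num [::])
   (Torus
    [:: Coordinate (ZV 3 6 6 9 6 3) (ZV 0 (-3) 0 0 0 0) 1;
      Coordinate (ZV 4 3 5 6 4 2) (ZV 0 3 3 0 0 0) 1;
      Coordinate (ZV 1 9 8 15 10 5) (ZV 0 0 0 (-3) 0 0) 1;
      Coordinate (ZV 5 15 16 27 20 10) (ZV 3 3 6 6 0 (-3)) 1]
    [:: s0] [:: 0]%nat [:: 0]%num [::]).

Definition cert_2A2 : class_certificate :=
  let s0 := Slice (ZV 0 0 0 0 0 0) 1 [:: (18, 1)] (ZV 1 1 2 3 2 1) 3 [::] in
  ClassCertificate 3 (-1)
   (Torus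
    [:: Coordinate (ZV 0 0 3 0 0 0) (ZV 4 3 5 6 4 2) 1;
      Coordinate (ZV 0 0 0 3 0 0) (ZV 9 9 15 18 12 6) 1;
      Coordinate (ZV 0 0 0 0 0 3) (ZV (-5) (-3) (-7) (-6) (-2) (-1)) 1;
      Coordinate (ZV 0 0 0 0 3 6) (ZV 12 9 18 18 9 3) 3]
    [:: s0; Slice (ZV 0 0 0 0 1 2) 3 [:: (18, 1)] (ZV 1 1 2 3 2 1) 3 [::];
      Slice (ZV 0 0 0 0 2 4) 3 [:: (18, 1)] (ZV 1 1 2 3 2 1) 3 [::]] [:: 0; 1; 2]%nat
      [:: 0; 0; 0]%num [:: Multiple 1 (ZV 0 0 0 0 0 0); Multiple 1 (ZV 4 3 5 6 4 2); Multiple 1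
      (ZV 8 6 10 12 8 4)])
   (Torus
    [:: Coordinate (ZV 4 3 5 6 4 2) (ZV (-3) 0 0 0 0 0) 1;
      Coordinate (ZV 4 6 8 12 10 5) (ZV 3 0 0 3 0 0) 1;
      Coordinate (ZV 2 3 4 6 5 4) (ZV 3 0 0 3 3 0) 1;
      Coordinate (ZV (-3) (-9) (-9) (-18) (-18) (-12)) (ZV 3 0 (-3) 0 0 0) 3]
    [:: s0; Slice (ZV 1 0 1 0 (-2) (-2)) 3 [:: (18, 1)] (ZV 1 1 2 3 2 1) 3 [::];
      Slice (ZV 2 0 2 0 (-4) (-4)) 3 [:: (18, 1)] (ZV 1 1 2 3 2 1) 3 [::]]
      [:: 0; 1; 2]%nat [:: 0; 0; 0]%num [:: Displacement (ZV 0 0 0 0 0 0);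
      Displacement (ZV 4 3 5 6 4 2); Displacement (ZV 8 6 10 12 8 4)]).

Definition cert_D4 : class_certificate :=
  let s0 := Slice (ZV 0 0 0 0 0 0) 1 [:: (36, 1)] (ZV 0 1 1 2 2 2) 3 [:: Wall
      (ZV 1 0 0 0 0 0) [:: 1324524321]%num; Wall (ZV 0 0 0 0 0 1) [:: 65432456]%num;
      Wall (ZV 1 0 1 1 1 1) [:: 13456245341324561324524131]%num] in
  ClassCertificate 6 (-1)
   (Torus
    [:: Coordinate (ZV 0 0 0 3 0 0) (ZV 3 6 6 9 6 3) 1;
      Coordinate (ZV 3 0 0 0 0 0) (ZV 2 0 4 3 2 1) 1;
      Coordinate (ZV 6 0 3 0 0 0) (ZV 4 9 8 15 10 5) 1;
      Coordinate (ZV 0 0 0 0 0 3) (ZV (-5) (-9) (-10) (-15) (-8) (-4)) 1]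
    [:: s0] [:: 0]%nat [:: 0]%num [::])
   (Torus
    [:: Coordinate (ZV 5 6 10 12 8 4) (ZV 3 0 0 0 0 0) 1;
      Coordinate (ZV 3 6 6 9 6 3) (ZV 3 (-3) 0 0 0 0) 1;
      Coordinate (ZV 9 15 18 27 18 9) (ZV 0 0 0 (-3) 0 0) 1;
      Coordinate (ZV 13 21 26 39 28 14) (ZV (-6) 0 (-3) 0 0 3) 1]
    [:: s0] [:: 0]%nat [:: 0]%num [::]).

Definition cert_D5 : class_certificate :=
  let s0 := point_slice (ZV 0 0 0 0 0 0) 1 in
  ClassCertificate 8 768
   (Torus
    [:: Coordinate (ZV 0 0 3 0 0 0) (ZV 4 3 5 6 4 2) 1;
      Coordinate (ZV 0 0 0 3 0 0) (ZV 3 6 6 9 6 3) 1;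
      Coordinate (ZV 3 0 6 0 0 0) (ZV (-6) (-9) (-12) (-18) (-12) (-6)) 1;
      Coordinate (ZV 0 0 0 0 0 3) (ZV (-5) (-9) (-10) (-15) (-8) (-4)) 1;
      Coordinate (ZV 3 3 6 6 6 6) (ZV 12 24 27 45 30 15) 1]
    [:: s0] [:: 0]%nat [:: 0]%num [::])
   (Torus
    [:: Coordinate (ZV 4 3 5 6 4 2) (ZV (-3) 0 0 0 0 0) 1;
      Coordinate (ZV 3 6 6 9 6 3) (ZV (-3) (-3) 0 0 0 0) 1;
      Coordinate (ZV 15 21 27 36 24 12) (ZV 3 3 3 0 0 0) 1;
      Coordinate (ZV (-21) (-27) (-36) (-45) (-30) (-15)) (ZV 0 0 0 (-3) 0 0) 1;
      Coordinate (ZV (-17) (-21) (-28) (-33) (-20) (-10)) (ZV 0 0 0 0 (-3) (-3)) 1]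
    [:: s0] [:: 0]%nat [:: 0]%num [::]).

Definition cert_A4_A1 : class_certificate :=
  let s0 := point_slice (ZV 0 0 0 0 0 0) 1 in
  ClassCertificate 10 30
   (Torus
    [:: Coordinate (ZV 0 0 3 0 0 0) (ZV 4 3 5 6 4 2) 1;
      Coordinate (ZV 0 0 0 3 0 0) (ZV 3 6 6 9 6 3) 1;
      Coordinate (ZV 3 0 6 0 0 0) (ZV (-6) (-9) (-12) (-18) (-12) (-6)) 1;
      Coordinate (ZV 3 0 6 0 3 0) (ZV 2 3 4 6 5 4) 1;
      Coordinate (ZV (-3) (-3) (-6) (-6) (-6) (-3)) (ZV (-6) (-15) (-15) (-27) (-15) (-3)) 1]
    [:: s0] [:: 0]%nat [:: 0]%num [::])
   (Torus
    [:: Coordinate (ZV 4 3 5 6 4 2) (ZV (-3) 0 0 0 0 0) 1;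
      Coordinate (ZV 3 6 6 9 6 3) (ZV (-3) (-3) 0 0 0 0) 1;
      Coordinate (ZV 15 21 27 36 24 12) (ZV 3 3 3 0 0 0) 1;
      Coordinate (ZV 2 3 4 6 5 4) (ZV (-6) (-9) (-12) 0 3 0) 1;
      Coordinate (ZV (-9) (-9) (-12) (-9) 0 9) (ZV 6 9 12 15 12 6) 1]
    [:: s0] [:: 0]%nat [:: 0]%num [::]).

Definition cert_2A2_A1 : class_certificate :=
  let s0 := Slice (ZV 0 0 0 0 0 0) 1 [:: (6, 1)] (ZV 2 3 4 6 4 2) 2 [:: Wall
      (ZV 0 0 0 1 0 0) [:: 45624534132456453413245341324]%num] in
  ClassCertificate 6 (-1)
   (Torus
    [:: Coordinate (ZV 0 0 3 0 0 0) (ZV 4 3 5 6 4 2) 1;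
      Coordinate (ZV 0 0 0 3 0 0) (ZV 3 6 6 9 6 3) 1;
      Coordinate (ZV 0 0 0 0 0 3) (ZV 1 0 2 3 4 2) 1;
      Coordinate (ZV 3 6 6 12 0 (-12)) (ZV 6 3 9 9 6 3) 1;
      Coordinate (ZV 0 0 0 0 3 6) (ZV 48 27 72 72 45 21) 3]
    [:: s0; Slice (ZV 8 6 10 12 8 4) 3 [:: (6, 1)] (ZV 2 3 4 6 4 2) 2
      [:: Wall (ZV 0 0 0 1 0 0) [:: 45624534132456453413245341324]%num];
      Slice (ZV 4 3 5 6 4 2) 3 [:: (6, 1)] (ZV 2 3 4 6 4 2) 2 [:: Wall
      (ZV 0 0 0 1 0 0) [:: 45624534132456453413245341324]%num]] [:: 0; 1; 2]%nat
      [:: 0; 0; 0]%num [:: Multiple 1 (ZV 0 0 0 0 0 0); Multiple 1 (ZV 4 3 5 6 4 2); Multiple 1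
      (ZV 8 6 10 12 8 4)])
   (Torus
    [:: Coordinate (ZV 4 3 5 6 4 2) (ZV (-3) 0 0 0 0 0) 1;
      Coordinate (ZV 3 6 6 9 6 3) (ZV 3 0 0 3 0 0) 1;
      Coordinate (ZV 1 0 2 3 4 2) (ZV 0 0 0 0 (-3) 0) 1;
      Coordinate (ZV 3 3 6 9 9 6) (ZV 12 6 0 12 9 3) 1;
      Coordinate (ZV (-21) (-27) (-45) (-72) (-72) (-48)) (ZV 3 0 (-3) 0 0 0) 3]
    [:: s0; Slice (ZV 1 3 1 0 (-8) (-8)) 3 [:: (6, 6)] (ZV 2 3 4 6 4 2) 12
      [:: Wall (ZV 0 0 0 1 0 0) [:: 45624534132456453413245341324;
      4562453413245645341324534132431; 4562453413245645341324534132413]%num]; Slice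
      (ZV 2 6 2 0 (-16) (-16)) 3 [:: (6, 6)] (ZV 2 3 4 6 4 2) 12 [:: Wall
      (ZV 0 0 0 1 0 0) [:: 45624534132456453413245341324; 4562453413245645341324534132413;
      4562453413245645341324534132431]%num]] [:: 0; 1; 2]%nat [:: 0; 0; 0]%num
      [:: Displacement (ZV 0 0 0 0 0 0); Displacement (ZV 4 3 5 6 4 2);
      Displacement (ZV 8 6 10 12 8 4)]).

Definition cert_A5 : class_certificate :=
  let s0 := Slice (ZV 0 0 0 0 0 0) 1 [:: (72, 1)] (ZV 1 2 2 3 2 1) 4 [::] in
  ClassCertificate 6 (-1)
   (Torus
    [:: Coordinate (ZV 0 0 3 0 0 0) (ZV 4 3 5 6 4 2) 1;
      Coordinate (ZV 0 0 0 3 0 0) (ZV 9 9 15 18 12 6) 1;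
      Coordinate (ZV 0 3 0 0 0 0) (ZV 15 18 27 36 24 12) 1;
      Coordinate (ZV 0 0 0 0 0 3) (ZV (-11) (-12) (-19) (-24) (-14) (-7)) 1;
      Coordinate (ZV 0 (-3) 0 0 3 6) (ZV 24 27 42 54 33 15) 3]
    [:: s0; Slice (ZV 1 0 2 3 4 5) 6 [:: (72, 1)] (ZV 1 2 2 3 2 1) 4 [::];
      Slice (ZV 1 0 2 3 4 5) 3 [:: (72, 1)] (ZV 1 2 2 3 2 1) 4 [::]] [:: 0; 1; 2]%nat
      [:: 0; 0; 0]%num [:: Multiple 1 (ZV 0 0 0 0 0 0); Multiple 1 (ZV 4 3 5 6 4 2); Multiple 1
      (ZV 8 6 10 12 8 4)])
   (Torus
    [:: Coordinate (ZV 4 3 5 6 4 2) (ZV (-3) 0 0 0 0 0) 1;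
      Coordinate (ZV 6 9 12 18 12 6) (ZV 3 3 0 0 0 0) 1;
      Coordinate (ZV 4 6 8 12 10 5) (ZV 3 3 0 3 0 0) 1;
      Coordinate (ZV 2 3 4 6 5 4) (ZV 3 3 0 3 3 0) 1;
      Coordinate (ZV (-15) (-27) (-33) (-54) (-42) (-24)) (ZV 3 3 (-3) 0 0 0) 3]
    [:: s0; Slice (ZV (-1) 0 (-4) (-9) (-10) (-7)) 6 [:: (72, 1)] (ZV 1 2 2 3 2 1) 4
      [::]; Slice (ZV (-1) 0 (-4) (-9) (-10) (-7)) 3 [:: (72, 1)] (ZV 1 2 2 3 2 1) 4
      [::]] [:: 0; 1; 2]%nat [:: 0; 0; 0]%num [:: Displacement (ZV 0 0 0 0 0 0);
      Displacement (ZV 4 3 5 6 4 2); Displacement (ZV 8 6 10 12 8 4)]).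

Definition cert_E6 : class_certificate :=
  let s0 := point_slice (ZV 0 0 0 0 0 0) 1 in
  ClassCertificate 12 (-1)
   (Torus
    [:: Coordinate (ZV 0 0 3 0 0 0) (ZV 4 3 5 6 4 2) 1;
      Coordinate (ZV 0 0 0 3 0 0) (ZV 3 6 6 9 6 3) 1;
      Coordinate (ZV 3 0 6 0 0 0) (ZV (-6) (-9) (-12) (-18) (-12) (-6)) 1;
      Coordinate (ZV 0 0 0 0 0 3) (ZV (-5) (-9) (-10) (-15) (-8) (-4)) 1;
      Coordinate (ZV 3 3 6 6 6 6) (ZV 12 24 27 45 30 15) 1;
      Coordinate (ZV (-6) (-9) (-12) (-18) (-15) (-12)) (ZV 12 27 30 54 39 21) 3]
    [:: s0; point_slice (ZV (-2) (-3) (-4) (-6) (-5) (-4)) 3;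
      point_slice (ZV (-4) (-6) (-8) (-12) (-10) (-8)) 3] [:: 0; 1; 2]%nat [:: 0; 0; 0]%num
      [:: Multiple 1 (ZV 0 0 0 0 0 0); Multiple 1 (ZV 4 3 5 6 4 2); Multiple 1
      (ZV 8 6 10 12 8 4)])
   (Torus
    [:: Coordinate (ZV 4 3 5 6 4 2) (ZV (-3) 0 0 0 0 0) 1;
      Coordinate (ZV 3 6 6 9 6 3) (ZV (-3) (-3) 0 0 0 0) 1;
      Coordinate (ZV 15 21 27 36 24 12) (ZV 3 3 3 0 0 0) 1;
      Coordinate (ZV (-21) (-27) (-36) (-45) (-30) (-15)) (ZV 0 0 0 (-3) 0 0) 1;
      Coordinate (ZV (-17) (-21) (-28) (-33) (-20) (-10)) (ZV 0 0 0 0 (-3) 0) 1;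
      Coordinate (ZV (-15) (-18) (-24) (-27) (-15) (-6)) (ZV 6 9 12 18 15 3) 3]
    [:: s0; point_slice (ZV (-5) (-6) (-8) (-9) (-5) (-2)) 3;
      point_slice (ZV (-10) (-12) (-16) (-18) (-10) (-4)) 3] [:: 0; 1; 2]%nat [:: 0; 0; 0]%num
      [:: Displacement (ZV 0 0 0 0 0 0); Displacement (ZV 4 3 5 6 4 2);
      Displacement (ZV 8 6 10 12 8 4)]).

Definition cert_D4a1 : class_certificate :=
  let s0 := Slice (ZV 0 0 0 0 0 0) 1 [:: (16, 1)] (ZV 0 1 1 2 2 2) 3 [:: Wall
      (ZV 1 0 0 0 0 0) [:: 134524321]%num; Wall (ZV 0 0 0 0 0 1)
      [:: 65432456242]%num; Wall (ZV 1 0 1 1 1 1)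
      [:: 134562453413245613453241321]%num] in
  ClassCertificate 4 (-1)
   (Torus
    [:: Coordinate (ZV 3 0 0 0 0 0) (ZV 3 6 6 9 6 3) 1;
      Coordinate (ZV 3 3 0 0 0 0) (ZV 2 0 4 3 2 1) 1;
      Coordinate (ZV 0 0 0 0 0 3) (ZV (-4) (-3) (-8) (-6) (-4) (-2)) 1;
      Coordinate (ZV (-3) 3 0 3 6 6) (ZV (-5) (-3) (-10) (-9) (-8) (-4)) 1]
    [:: s0] [:: 0]%nat [:: 0]%num [::])
   (Torus
    [:: Coordinate (ZV 5 6 10 12 8 4) (ZV 3 0 0 0 0 0) 1;
      Coordinate (ZV 3 6 6 9 6 3) (ZV 0 (-3) 0 0 0 0) 1;
      Coordinate (ZV 7 12 14 21 16 8) (ZV (-3) 0 0 (-3) 0 0) 1;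
      Coordinate (ZV (-8) (-15) (-16) (-24) (-20) (-10)) (ZV 3 0 3 0 0 (-3)) 1]
    [:: s0] [:: 0]%nat [:: 0]%num [::]).

Definition cert_D5a1 : class_certificate :=
  let s0 := point_slice (ZV 0 0 0 0 0 0) 1 in
  ClassCertificate 12 1728
   (Torus
    [:: Coordinate (ZV 0 0 3 0 0 0) (ZV 4 3 5 6 4 2) 1;
      Coordinate (ZV 0 3 0 0 0 0) (ZV (-3) (-6) (-6) (-9) (-6) (-3)) 1;
      Coordinate (ZV 0 0 0 3 0 0) (ZV 9 9 15 18 12 6) 1;
      Coordinate (ZV 0 0 0 0 0 3) (ZV 6 9 12 18 12 6) 1;
      Coordinate (ZV 3 6 6 9 9 6) (ZV 14 18 25 33 20 10) 1]
    [:: s0] [:: 0]%nat [:: 0]%num [::])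
   (Torus
    [:: Coordinate (ZV 4 3 5 6 4 2) (ZV (-3) 0 0 0 0 0) 1;
      Coordinate (ZV 3 6 6 9 6 3) (ZV 0 (-3) 0 0 0 0) 1;
      Coordinate (ZV 9 9 15 18 12 6) (ZV 3 3 3 0 0 0) 1;
      Coordinate (ZV 1 3 2 3 4 2) (ZV 3 6 6 3 0 0) 1;
      Coordinate (ZV (-14) (-15) (-22) (-24) (-20) (-10)) (ZV 0 0 0 (-3) (-3) (-3)) 1]
    [:: s0] [:: 0]%nat [:: 0]%num [::]).

Definition cert_E6a1 : class_certificate :=
  let s0 := point_slice (ZV 0 0 0 0 0 0) 1 in
  ClassCertificate 9 (-1)
   (Torus
    [:: Coordinate (ZV 0 0 3 0 0 0) (ZV 4 3 5 6 4 2) 1;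
      Coordinate (ZV 0 3 0 0 0 0) (ZV (-3) (-6) (-6) (-9) (-6) (-3)) 1;
      Coordinate (ZV 0 0 0 3 0 0) (ZV 9 9 15 18 12 6) 1;
      Coordinate (ZV 0 0 0 0 0 3) (ZV 6 9 12 18 12 6) 1;
      Coordinate (ZV 0 3 0 0 3 0) (ZV 4 3 5 3 1 (-1)) 1;
      Coordinate (ZV 3 0 6 9 3 6) (ZV (-6) (-12) (-15) (-27) (-18) (-12)) 3]
    [:: s0; point_slice (ZV 1 0 2 3 1 2) 3; point_slice (ZV 2 0 4 6 2 4) 3] [:: 0; 1; 2]%nat
      [:: 0; 0; 0]%num [:: Multiple 1 (ZV 0 0 0 0 0 0); Multiple 1 (ZV 4 3 5 6 4 2); Multiple 1
      (ZV 8 6 10 12 8 4)])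
   (Torus
    [:: Coordinate (ZV 4 3 5 6 4 2) (ZV (-3) 0 0 0 0 0) 1;
      Coordinate (ZV 3 6 6 9 6 3) (ZV 0 (-3) 0 0 0 0) 1;
      Coordinate (ZV 9 9 15 18 12 6) (ZV 3 3 3 0 0 0) 1;
      Coordinate (ZV 2 3 4 6 5 4) (ZV (-3) (-6) (-6) 0 3 0) 1;
      Coordinate (ZV 3 6 6 9 9 6) (ZV 3 6 6 3 0 0) 1;
      Coordinate (ZV (-12) (-12) (-18) (-18) (-15) (-6)) (ZV 6 9 12 9 6 3) 3]
    [:: s0; point_slice (ZV (-4) (-4) (-6) (-6) (-5) (-2)) 3;
      point_slice (ZV (-8) (-8) (-12) (-12) (-10) (-4)) 3] [:: 0; 1; 2]%nat [:: 0; 0; 0]%num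
      [:: Displacement (ZV 0 0 0 0 0 0); Displacement (ZV 4 3 5 6 4 2);
      Displacement (ZV 8 6 10 12 8 4)]).

Definition cert_E6a2 : class_certificate :=
  let s0 := point_slice (ZV 0 0 0 0 0 0) 1 in
  ClassCertificate 6 (-1)
   (Torus
    [:: Coordinate (ZV 3 0 0 0 0 0) (ZV (-4) (-3) (-5) (-6) (-4) (-2)) 1;
      Coordinate (ZV 0 3 0 0 0 0) (ZV 1 (-3) (-1) (-3) (-2) (-1)) 1;
      Coordinate (ZV (-3) 3 3 0 0 0) (ZV (-3) (-3) (-6) (-9) (-6) (-3)) 1;
      Coordinate (ZV 3 (-3) 0 3 0 0) (ZV (-2) (-3) (-4) (-6) (-2) (-1)) 1;
      Coordinate (ZV 0 0 3 3 0 3) (ZV (-1) 0 1 6 8 4) 1;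
      Coordinate (ZV 3 0 6 9 3 6) (ZV 3 0 0 (-9) (-15) (-9)) 3]
    [:: s0; point_slice (ZV 1 0 2 3 1 2) 3; point_slice (ZV 2 0 4 6 2 4) 3] [:: 0; 1; 2]%nat
      [:: 0; 0; 0]%num [:: Multiple 1 (ZV 0 0 0 0 0 0); Multiple 1 (ZV 4 3 5 6 4 2); Multiple 1
      (ZV 8 6 10 12 8 4)])
   (Torus
    [:: Coordinate (ZV 4 3 5 6 4 2) (ZV (-3) 0 0 0 0 0) 1;
      Coordinate (ZV 5 6 10 12 8 4) (ZV 0 3 0 0 0 0) 1;
      Coordinate (ZV 7 9 11 15 10 5) (ZV 3 0 3 0 0 0) 1;
      Coordinate (ZV (-9) (-12) (-15) (-18) (-12) (-6)) (ZV 0 0 0 (-3) 0 0) 1;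
      Coordinate (ZV (-8) (-9) (-13) (-15) (-8) (-4)) (ZV 3 3 6 9 3 0) 1;
      Coordinate (ZV 9 9 15 18 9 6) (ZV 3 0 6 9 3 (-3)) 3]
    [:: s0; point_slice (ZV 3 3 5 6 3 2) 3; point_slice (ZV 6 6 10 12 6 4) 3] [:: 0; 1; 2]%nat
      [:: 0; 0; 0]%num [:: Displacement (ZV 0 0 0 0 0 0); Displacement (ZV 4 3 5 6 4 2);
      Displacement (ZV 8 6 10 12 8 4)]).

Definition cert_4A1 : class_certificate :=
  let s0 := Slice (ZV 0 0 0 0 0 0) 1 [:: (4, 1)] (ZV 0 1 1 2 2 2) 3 [:: Wall
      (ZV 1 0 0 0 0 0) [:: 13452431]%num; Wall (ZV 0 0 0 0 0 1) [:: 65432456]%num;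
      Wall (ZV 1 0 1 1 1 1) [:: 134562453413245613452431]%num] in
  ClassCertificate 2 (-1)
   (Torus
    [:: Coordinate (ZV 3 0 0 0 0 0) (ZV 3 6 6 9 6 3) 1;
      Coordinate (ZV (-3) 0 0 0 0 3) (ZV 1 6 2 6 4 2) 1;
      Coordinate (ZV 0 0 0 3 0 0) (ZV 0 3 0 0 0 0) 2;
      Coordinate (ZV 6 0 3 0 0 (-6)) (ZV 0 6 0 3 0 0) 2]
    [:: s0; Slice (ZV 0 0 0 0 1 0) 2 [:: (4, 2)] (ZV 0 1 1 2 2 2) 6
      [:: Wall (ZV 1 0 0 0 0 0) [:: 413245432431; 13452431]%num; Wall
      (ZV 0 0 0 0 0 1) [:: 65432456; 654324564324]%num; Wall (ZV 1 0 1 1 1 1)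
      [:: 1345624534132456413245132431; 134562453413245613452431]%num]] [:: 0; 1; 1; 1]%nat
      [:: 0; 0; 42; 4]%num [:: Multiple 1 (ZV 0 0 0 0 0 0)])
   (Torus
    [:: Coordinate (ZV 3 6 6 9 6 3) (ZV 3 0 0 0 0 0) 1;
      Coordinate (ZV (-1) (-6) (-2) (-6) (-4) (-2)) (ZV 3 0 0 0 0 (-3)) 1;
      Coordinate (ZV 0 (-6) 0 (-3) 0 0) (ZV (-6) 0 (-3) 0 0 6) 2;
      Coordinate (ZV 0 (-3) 0 0 0 0) (ZV 0 0 0 (-3) 0 0) 2]
    [:: s0; Slice (ZV 0 (-1) 0 0 0 0) 2 [:: (4, 2)] (ZV 0 1 1 2 2 2) 6
      [:: Wall (ZV 1 0 0 0 0 0) [:: 413245432431; 13452431]%num; Wall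
      (ZV 0 0 0 0 0 1) [:: 654324564324; 65432456]%num; Wall (ZV 1 0 1 1 1 1)
      [:: 134562453413245613452431; 1345624534132456413245132431]%num]] [:: 0; 1; 1; 1]%nat
      [:: 0; 0; 42; 4]%num [:: Multiple 1 (ZV 0 0 0 0 0 0)]).

Definition cert_A3_2A1 : class_certificate :=
  let s0 := point_slice (ZV 0 0 0 0 0 0) 1 in
  ClassCertificate 4 192
   (Torus
    [:: Coordinate (ZV 0 0 3 0 0 0) (ZV 4 3 5 6 4 2) 1;
      Coordinate (ZV 3 0 6 0 0 0) (ZV (-1) 3 1 3 2 1) 1;
      Coordinate (ZV (-3) 0 (-6) 0 0 3) (ZV 1 0 2 3 4 2) 1;
      Coordinate (ZV 0 0 0 3 0 0) (ZV 0 3 0 0 0 0) 2;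
      Coordinate (ZV 0 3 0 6 6 6) (ZV 0 12 6 9 0 0) 2]
    [:: s0; point_slice (ZV (-2) (-1) (-4) (-2) (-1) 0) 4] [:: 0; 1; 1; 1]%nat
      [:: 0; 0; 42; 4]%num [:: Multiple 1 (ZV 0 0 0 0 0 0)])
   (Torus
    [:: Coordinate (ZV 3 6 6 9 6 3) (ZV 3 0 0 0 0 0) 1;
      Coordinate (ZV 4 3 5 6 4 2) (ZV 0 0 (-3) 0 0 0) 1;
      Coordinate (ZV 1 0 2 3 4 2) (ZV (-3) 0 3 0 0 3) 1;
      Coordinate (ZV 0 (-3) 0 0 0 0) (ZV 0 0 0 (-3) 0 0) 2;
      Coordinate (ZV (-6) (-12) (-6) (-9) 0 0) (ZV 0 (-3) (-6) (-6) (-6) (-6)) 2]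
    [:: s0; point_slice (ZV (-2) (-4) (-2) (-3) 0 0) 2] [:: 0; 1; 1; 1]%nat [:: 0; 0; 24; 2]%num
      [:: Multiple 1 (ZV 0 0 0 0 0 0)]).

Definition cert_A5_A1 : class_certificate :=
  let s0 := point_slice (ZV 0 0 0 0 0 0) 1 in
  ClassCertificate 6 (-1)
   (Torus
    [:: Coordinate (ZV 0 0 3 0 0 0) (ZV 4 3 5 6 4 2) 1;
      Coordinate (ZV 3 0 6 0 0 0) (ZV (-1) 3 1 3 2 1) 1;
      Coordinate (ZV (-3) 0 (-6) 0 0 3) (ZV 1 0 2 3 4 2) 1;
      Coordinate (ZV (-6) 0 (-12) (-3) 3 6) (ZV 0 6 0 0 (-3) (-3)) 1;
      Coordinate (ZV 0 (-3) 0 (-3) (-6) (-6)) (ZV 0 15 0 0 (-6) (-6)) 2;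
      Coordinate (ZV 12 9 24 18 12 6) (ZV 0 9 (-6) (-9) (-12) (-12)) 6]
    [:: s0; point_slice (ZV 4 3 8 6 4 2) 6; point_slice (ZV 4 3 8 6 4 2) 3;
      point_slice (ZV 4 3 8 6 4 2) 2; point_slice (ZV 8 6 16 12 8 4) 3;
      point_slice (ZV 20 15 40 30 20 10) 6] [:: 0; 1; 2; 3; 4; 5; 3; 1; 5; 3; 1; 5]%nat
      [:: 0; 0; 0; 0; 0; 0; 4; 42; 4; 42; 4; 42]%num [:: Multiple 3 (ZV 0 0 0 0 0 0); Multiple 4
      (ZV 0 0 0 0 0 0); Multiple 4 (ZV 4 3 5 6 4 2); Multiple 4 (ZV 8 6 10 12 8 4)])
   (Torus
    [:: Coordinate (ZV 3 6 6 9 6 3) (ZV 3 0 0 0 0 0) 1;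
      Coordinate (ZV 4 3 5 6 4 2) (ZV 0 0 (-3) 0 0 0) 1;
      Coordinate (ZV 1 0 2 3 4 2) (ZV 3 0 (-3) 0 (-3) 0) 1;
      Coordinate (ZV 3 6 6 9 9 6) (ZV (-6) 0 6 (-3) 3 (-3)) 1;
      Coordinate (ZV (-12) (-21) (-18) (-27) (-24) (-12)) (ZV (-12) (-3) 6 (-12) 0 (-6)) 2;
      Coordinate (ZV 18 27 24 36 30 12) (ZV (-24) (-9) 6 (-27) (-6) (-12)) 6]
    [:: s0; point_slice (ZV 6 9 8 12 10 4) 6; point_slice (ZV 6 9 8 12 10 4) 3;
      point_slice (ZV 6 9 8 12 10 4) 2; point_slice (ZV 12 18 16 24 20 8) 3;
      point_slice (ZV 30 45 40 60 50 20) 6] [:: 0; 1; 2; 3; 4; 5; 3; 1; 5; 3; 1; 5]%nat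
      [:: 0; 0; 0; 0; 0; 0; 4; 42; 4; 42; 4; 42]%num [:: Displacement (ZV 0 0 0 0 0 0);
      Displacement (ZV 4 3 5 6 4 2); Displacement (ZV 8 6 10 12 8 4); Multiple 3
      (ZV 0 0 0 0 0 0)]).

Definition cert_3A2 : class_certificate :=
  let s0 := point_slice (ZV 0 0 0 0 0 0) 1 in
  ClassCertificate 3 (-1)
   (Torus
    [:: Coordinate (ZV 0 0 0 0 0 3) (ZV 4 3 5 6 4 2) 1;
      Coordinate (ZV 0 0 0 0 3 0) (ZV 3 6 6 9 6 3) 1;
      Coordinate (ZV 0 0 0 3 0 0) (ZV 1 3 5 6 4 2) 1;
      Coordinate (ZV 0 0 3 6 0 0) (ZV 0 (-3) (-6) (-9) (-6) (-3)) 3;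
      Coordinate (ZV 0 3 0 3 6 0) (ZV (-3) (-9) (-9) (-15) (-12) (-6)) 3;
      Coordinate (ZV 3 0 3 3 3 6) (ZV (-6) (-6) (-9) (-12) (-9) (-6)) 3]
    [:: s0; point_slice (ZV 1 0 1 1 1 2) 3; point_slice (ZV 1 0 2 3 1 2) 3;
      point_slice (ZV 2 0 4 6 2 4) 3] [:: 0; 1; 1; 1; 1; 1; 1; 1; 1; 1; 2; 1; 1; 1; 1; 1; 1; 1;
      1; 1; 3; 1; 1; 1; 1; 1; 1]%nat [:: 0; 0; 2456541324532421; 132456; 2452; 245613245431;
      562454132431; 5242; 245654132431; 5645324321; 0; 245632454321; 13245634; 245324;
      245624534321; 5624524321; 5432; 2456524321; 132456453432; 5432453432; 0; 13245643; 245243;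
      24561324534131; 562454324131; 543243; 245654324131]%num [:: Multiple 1 (ZV 0 0 0 0 0 0);
      Multiple 1 (ZV 4 3 5 6 4 2); Multiple 1 (ZV 8 6 10 12 8 4)])
   (Torus
    [:: Coordinate (ZV 4 3 5 6 4 2) (ZV (-3) 0 0 0 0 0) 1;
      Coordinate (ZV 7 9 11 15 10 5) (ZV 0 (-3) 0 0 0 0) 1;
      Coordinate (ZV 16 18 26 33 22 11) (ZV 0 0 (-3) 0 0 0) 1;
      Coordinate (ZV 33 39 54 72 48 24) (ZV 0 0 3 (-3) 0 0) 3;
      Coordinate (ZV 15 18 24 33 24 12) (ZV 0 3 0 3 (-3) 0) 3;
      Coordinate (ZV 6 6 9 12 9 6) (ZV 3 0 3 3 3 (-3)) 3]
    [:: s0; point_slice (ZV 2 2 3 4 3 2) 3; point_slice (ZV 4 4 6 8 6 4) 3;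
      point_slice (ZV 5 6 8 11 8 4) 3] [:: 0; 1; 2; 3; 1; 2; 3; 1; 2; 1; 2; 3; 1; 2; 3; 1; 2; 3;
      2; 3; 1; 2; 3; 1; 2; 3; 1]%nat [:: 0; 0; 0; 0; 132456; 61345431; 5645324321; 61345431;
      132456; 654321; 1324565432; 245324; 65432413; 654132452421; 2452; 65413241; 1324565242;
      245243; 654321; 5432; 1324565432; 65413241; 5242; 1324565242; 65432413; 543243;
      654132452421]%num [:: Displacement (ZV 0 0 0 0 0 0); Displacement (ZV 4 3 5 6 4 2);
      Displacement (ZV 8 6 10 12 8 4); Multiple 1 (ZV 0 0 0 0 0 0)]).

Definition class_certificates : seq class_certificate :=
  [:: cert_id; cert_A1; cert_2A1; cert_A2; cert_A2_A1; cert_3A1; cert_A3; cert_A4; cert_A2_2A1;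
    cert_A3_A1; cert_2A2; cert_D4; cert_D5; cert_A4_A1; cert_2A2_A1; cert_A5; cert_E6;
    cert_D4a1; cert_D5a1; cert_E6a1; cert_E6a2; cert_4A1; cert_A3_2A1; cert_A5_A1; cert_3A2].

End certificates.

(** * The two lattices and the sum over the powers of w *)

Section lattices.
Context (R : realType) (Phi : rootSystem R 6) (a : 'I_6 -> 'rV[R]_6) (E : E6_base Phi a).
Local Notation vec := (vec a).
Local Notation act := (act a).
Local Notation zr := (zr R).

Definition torus_lattice (dual : bool) : weylLattice Phi :=
  if dual then dual_lattice Phi else root_lattice Phi.

Lemma vec_root_lattice v : lattice_set (root_lattice Phi) (vec v).
Proof.
rewrite /vec; do !apply: latticeD;
  rewrite zr_intr scaler_int; apply: root_lattice_root; exact: (simple_root E).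
Qed.

Lemma root_lattice_vec x : lattice_set (root_lattice Phi) x -> exists v, x = vec v.
Proof.
move=> [m [k [b [rb ->]]]].
elim/big_ind: _ => [|_ _ [u ->] [v ->]|i _].
- by exists zzero; rewrite vec0.
- by exists (zadd u v); rewrite vecD.
- have [v _ ->] := root_zroots E (rb i).
  by exists (zscale (Z_of_int (k i)) v); rewrite vecZ zr_intr Z_of_intK scaler_int.
Qed.

Lemma dual_lattice_simple x :
  (forall i, dot x (a i) \is a Num.int) <-> lattice_set (dual_lattice Phi) x.
Proof.
split=> [h y /root_lattice_vec[v ->]|h i].
  by rewrite /vec !dotDr !dotZr; do !apply: rpredD; apply: rpredM => //; exact: zr_int.
apply: h; rewrite -[a i](mulr1z); apply: root_lattice_root; exact: (simple_root E).
Qed.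

Lemma root_sub_dual x : lattice_set (root_lattice Phi) x -> lattice_set (dual_lattice Phi) x.
Proof.
by move=> /root_lattice_vec[v ->] y /root_lattice_vec[u ->]; rewrite (dot_vec E) zr_int.
Qed.

Lemma torus_lattice_sub dual x :
  lattice_set (torus_lattice dual) x -> lattice_set (dual_lattice Phi) x.
Proof. by case: dual => //; exact: root_sub_dual. Qed.

Lemma root_sub_torus dual x :
  lattice_set (root_lattice Phi) x -> lattice_set (torus_lattice dual) x.
Proof. by case: dual => //; exact: root_sub_dual. Qed.

Lemma torus_lattice_pairing dual x y : lattice_set (torus_lattice dual) x ->
  lattice_set (torus_lattice (~~ dual)) y -> dot x y \is a Num.int.
Proof. by case: dual => /= Lx Ly; [exact: Lx|rewrite dotC; exact: Ly]. Qed.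

Lemma zdividesP k v : k <> 0%Z -> reflect (exists u, v = zscale k u) (zdivides k v).
Proof.
move=> k0; apply: (iffP idP).
  case: v => x1 x2 x3 x4 x5 x6 /=.
  case/and5P => /Z.eqb_eq h1 /Z.eqb_eq h2 /Z.eqb_eq h3 /Z.eqb_eq h4
    /andP[/Z.eqb_eq h5 /Z.eqb_eq h6].
  exists (ZV (Z.div x1 k) (Z.div x2 k) (Z.div x3 k) (Z.div x4 k) (Z.div x5 k) (Z.div x6 k)).
  by rewrite /zscale /=; congr ZV; apply: Z_div_exact_full_2.
move=> [u ->]; rewrite /zdivides /zscale /= !(Z.mul_comm k) !Z_mod_mult.
by rewrite !Z.eqb_refl.
Qed.

Lemma zr_neq0 k : k <> 0%Z -> zr k != 0.
Proof. by move=> k0; rewrite zr_eq0; apply/negP => /Z.eqb_eq. Qed.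

Lemma zmodP k x : k <> 0%Z ->
  reflect (zr x / zr k \is a Num.int) (Z.eqb (Z.modulo x k) 0).
Proof.
move=> k0; have kr := zr_neq0 k0.
apply: (iffP idP) => [/Z.eqb_eq h|/zr_intP[q qE]].
  by rewrite (Z_div_exact_full_2 x k k0 h) zrM mulrAC mulfV// mul1r zr_int.
have -> : x = Z.mul q k by apply: (@zr_inj R); rewrite zrM -qE divfK.
by rewrite Z_mod_mult.
Qed.

Lemma zdivides_root_lattice k v : k <> 0%Z ->
  reflect (lattice_set (root_lattice Phi) ((zr k)^-1 *: vec v)) (zdivides k v).
Proof.
move=> k0; have kr := zr_neq0 k0.
apply: (iffP (zdividesP _ k0)) => [[u ->]|/root_lattice_vec[u uE]].
  by rewrite vecZ scalerA mulVf// scale1r; exact: vec_root_lattice.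
exists u; apply: (vec_inj E); rewrite vecZ -uE scalerA mulfV// scale1r //.
Qed.

Lemma in_lattice_torus dual k v : k <> 0%Z -> in_lattice dual k v ->
  lattice_set (torus_lattice dual) ((zr k)^-1 *: vec v).
Proof.
case: dual => k0; last by move=> h; apply/zdivides_root_lattice.
move=> h; apply/dual_lattice_simple => i; have [j _ ->] := simple_indexP i.
rewrite dotZl (dot_vec_simple E) mulrC; apply/zmodP => //.
move: h; rewrite /in_lattice; case: zdual => d1 d2 d3 d4 d5 d6.
by case/and5P => h1 h2 h3 h4 /andP[h5 h6]; case: j => [|[|[|[|[|[|j]]]]]].
Qed.

Lemma linear_on_simple (f g : 'rV[R]_6 -> 'rV[R]_6) :
  (forall x y, f (x + y) = f x + f y) -> (forall c x, f (c *: x) = c *: f x) ->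
  (forall x y, g (x + y) = g x + g y) -> (forall c x, g (c *: x) = c *: g x) ->
  (forall i, i \in simple_words -> f (vec (zsimple i)) = g (vec (zsimple i))) -> f =1 g.
Proof.
move=> fD fZ gD gZ fg x; have [c ->] := base_span E x.
have f0 : f 0 = 0 by rewrite -[X in f X](scale0r 0) fZ scale0r.
have g0 : g 0 = 0 by rewrite -[X in g X](scale0r 0) gZ scale0r.
apply: (big_ind (fun x => f x = g x)) => [|u v fu fv|i _]; first by rewrite f0 g0.
  by rewrite fD gD fu fv.
rewrite fZ gZ; have [j j6 ->] := simple_indexP i; rewrite -vec_simple fg//.
by case: j j6 => [|[|[|[|[|[|[|j]]]]]]].
Qed.

End lattices.

Section word.
Context (R : realType) (Phi : rootSystem R 6) (a : 'I_6 -> 'rV[R]_6) (E : E6_base Phi a).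
Context (w : word) (o : nat) (w_order : order_ok w o).
Local Notation vec := (vec a).
Local Notation act := (act a).
Local Notation zr := (zr R).
Local Notation f := (act w).
Local Notation V := (fixed_space f).
Local Notation Z_w := (weyl_centralizer Phi f).
Local Notation trace := (ztrace w o).

Let Wf : weyl Phi f := act_weyl E w.

Lemma order_gt0 : (0 < o)%nat. Proof. by case/andP: w_order. Qed.

(** The real counterpart of ztrace. Its image is ker (w - 1), where it is multiplication by o,
  so identities on ker (w - 1) can be checked on the sums of the six simple roots. *)
Definition Tr (x : 'rV[R]_6) : 'rV[R]_6 := \sum_(y <- traject f x o) y.

Lemma traject_act v n : traject f (vec v) n = map vec (traject (zact w) v n).
Proof. by elim: n v => //= n IH v; rewrite -IH (act_vec E). Qed.

Lemma Tr_vec v : Tr (vec v) = vec (trace v).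
Proof. by rewrite /Tr traject_act big_map /ztrace vec_sum. Qed.

Lemma TrE x : Tr x = \sum_(k < o) ssrnat.iter k f x.
Proof. have -> : Tr x = \sum_(y <- [seq ssrnat.iter k f x | k <- iota 0 o]) y.
  congr (\sum_(y <- _) y); apply: (@eq_from_nth _ x).
    by rewrite size_map size_traject size_iota.
  move=> k; rewrite size_traject => ko.
  by rewrite nth_traject// (nth_map 0%nat) ?size_iota// nth_iota.
rewrite big_map.
by rewrite -(big_mkord xpredT (fun k => ssrnat.iter k f x)) /index_iota subn0. Qed.

Lemma weyl_iter k : weyl Phi (ssrnat.iter k f).
Proof.
elim: k => [|k IH]; first exact: weyl_id.
by have := weyl_comp Wf IH.
Qed.

Lemma TrD x y : Tr (x + y) = Tr x + Tr y.
Proof.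
by rewrite !TrE -big_split; apply: eq_bigr => k _; rewrite (weylD _ _ (weyl_iter k)).
Qed.

Lemma TrZ c x : Tr (c *: x) = c *: Tr x.
Proof.
by rewrite !TrE scaler_sumr; apply: eq_bigr => k _; rewrite (weylZ _ _ (weyl_iter k)).
Qed.

Lemma Tr_fixed x : V (Tr x).
Proof.
have [_ /allP h] := andP w_order.
apply: (linear_on_simple E (f := fun x => f (Tr x)) (g := Tr)).
- by move=> y z; rewrite TrD (weylD _ _ Wf).
- by move=> c y; rewrite TrZ (weylZ _ _ Wf).
- exact: TrD.
- exact: TrZ.
- by move=> i /h/zeqbP; rewrite Tr_vec (act_vec E) => ->.
Qed.

Lemma iter_centralizer k u x : Z_w u -> u (ssrnat.iter k f x) = ssrnat.iter k f (u x).
Proof. by move=> Zu; elim: k => //= k <-; exact: (centralizer_comm _ Zu). Qed.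

Lemma Tr_act u x : Z_w u -> Tr (u x) = u (Tr x).
Proof.
move=> Zu; rewrite !TrE (weyl_sum _ _ (proj1 Zu)).
by apply: eq_bigr => k _; rewrite iter_centralizer.
Qed.

Lemma iter_fixed k v : V v -> ssrnat.iter k f v = v.
Proof. by move=> Vv; elim: k => //= k ->. Qed.

Lemma dot_Tr v x : V v -> dot v (Tr x) = o%:R * dot v x.
Proof.
move=> Vv; rewrite TrE dot_sumr (eq_bigr (fun=> dot v x)).
  by rewrite sumr_const card_ord mulr_natl.
by move=> k _; rewrite -{1}(iter_fixed k Vv) (weyl_dot _ _ (weyl_iter k)).
Qed.

Lemma Tr_id v : V v -> Tr v = o%:R *: v.
Proof.
move=> Vv; rewrite TrE (eq_bigr (fun=> v)).
  by rewrite sumr_const card_ord scaler_nat.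
by move=> k _; exact: iter_fixed.
Qed.

Lemma oR_neq0 : o%:R != 0 :> R.
Proof. by rewrite pnatr_eq0 -lt0n order_gt0. Qed.

Lemma zr_order : zr (Z.of_nat o) = o%:R.
Proof.
rewrite zr_intr; elim: o => // n IH; rewrite Nat2Z.inj_succ -Z.add_1_l (rmorphD int_of_Z).
by rewrite intrD IH -[in RHS]addn1 natrD addrC.
Qed.

Lemma centralizer_word u : Z_w u -> exists s, u = act s.
Proof. by move=> [Wu _]; exact: (weyl_word E). Qed.

Lemma zact_trace s v : Z_w (act s) -> trace (zact s v) = zact s (trace v).
Proof.
move=> Zs; apply: (vec_inj E).
by rewrite -Tr_vec -(act_vec E) -[in RHS](act_vec E) Tr_act// Tr_vec.
Qed.

Lemma zact_dot s u v : zdot (zact s u) (zact s v) = zdot u v.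
Proof.
by apply: (@zr_inj R); rewrite -!(dot_vec E) -!(act_vec E) (weyl_dot _ _ (act_weyl E s)).
Qed.

Lemma zact_trace_norm s v : Z_w (act s) -> ztrace_norm w o (zact s v) = ztrace_norm w o v.
Proof. by move=> Zs; rewrite /ztrace_norm zact_trace// zact_dot. Qed.

Lemma zact_inj s : injective (zact s).
Proof.
move=> u v /(congr1 vec); rewrite -!(act_vec E) => /(can_inj (act_Krev a s)).
exact: (vec_inj E).
Qed.

Lemma perm_zact (S : seq zvec) s : uniq S -> (forall v, v \in S -> zact s v \in S) ->
  perm_eq (map (zact s) S) S.
Proof.
move=> uS cS; have uM : uniq (map (zact s) S) by rewrite map_inj_uniq//; exact: zact_inj.
have sub : {subset map (zact s) S <= S} by move=> _ /mapP[v vS ->]; exact: cS.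
have [_ eqi] := uniq_min_size uM sub (eq_leq (esym (size_map _ _))).
by apply: uniq_perm => // x; exact: eqi.
Qed.

Lemma perm_zact_filter (S : seq zvec) (p : pred zvec) s : uniq S ->
  (forall v, v \in S -> zact s v \in S) -> (forall v, p (zact s v) = p v) ->
  perm_eq (map (zact s) (seq.filter p S)) (seq.filter p S).
Proof.
move=> uS cS ps; have /(perm_filter p) := perm_zact uS cS.
rewrite filter_map (eq_filter (a2 := p))//.
Qed.

Lemma axis_fixed n u : Z_w u -> u (vec (zaxis w o n)) = vec (zaxis w o n).
Proof.
move=> Zu; have [s us] := centralizer_word Zu; rewrite us in Zu *.
rewrite /zaxis vec_sum big_map (weyl_sum _ _ (proj1 Zu)).
have P := perm_zact_filter (S := zweights) (p := fun m => (ztrace_norm w o m =? n)%Z) (s := s).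
rewrite -[RHS](perm_big _ (P _ _ _)).
- rewrite big_map; apply: eq_bigr => m _.
  by rewrite zact_trace// (act_vec E).
- by vm_compute.
- by move=> v; exact: zact_zweights.
- by move=> v; rewrite zact_trace_norm.
Qed.

End word.

(** * Soundness of the certificates *)

(** A reflection moves a weight by an integral multiple of a root. *)
Lemma weyl_dual_trivial (R : realType) (Phi : rootSystem R 6)
    (Phi_norm : forall x : 'rV[R]_6, root_set Phi x -> dot x x = 2) u p :
  weyl Phi u -> lattice_set (dual_lattice Phi) p -> lattice_set (root_lattice Phi) (u p - p).
Proof.
move=> Wu Pp; elim: Wu => [|b g rb Wg IH] /=; first by rewrite subrr; exact: root_lattice0.
have Qb : root_lattice_set Phi b by rewrite -[b](mulr1z); exact: root_lattice_root.
have /intrP[k kE] : dot (g p) b \is a Num.int.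
  by apply: (latticeW Wg Pp).
rewrite /reflection kE (Phi_norm _ rb) [2 * _]mulrC mulfK ?pnatr_eq0// scaler_int addrAC.
by apply: root_latticeB => //; exact: root_lattice_root.
Qed.

Section torus_certificate.
Context (R : realType) (Phi : rootSystem R 6) (a : 'I_6 -> 'rV[R]_6) (E : E6_base Phi a).
Context (w : word) (o : nat) (w_order : order_ok w o).
Local Notation vec := (vec a).
Local Notation act := (act a).
Local Notation zr := (zr R).
Local Notation f := (act w).
Local Notation V := (fixed_space f).
Local Notation Z_w := (weyl_centralizer Phi f).
Local Notation trace := (ztrace w o).
Let Wf : weyl Phi f := act_weyl E w.

Context (zv0 : zvec).
Context (dual : bool) (t : torus_certificate) (t_ok : torus_ok w o zv0 dual t).
Local Notation L := (torus_lattice Phi dual).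
Local Notation cs := (tc_coords t).
Local Notation v0 := (vec zv0).

Definition qvec (k : Z) (v : zvec) : 'rV[R]_6 := (zr k)^-1 *: vec v.

Lemma dot_qvec k l u v : dot (qvec k u) (qvec l v) = zr (zdot u v) / zr (Z.mul k l).
Proof.
rewrite /qvec dotZl dotZr (dot_vec E) zrM invfM.
by rewrite mulrA mulrC.
Qed.

Lemma dot_qvecl k u v : dot (qvec k u) (vec v) = zr (zdot u v) / zr k.
Proof. by rewrite /qvec dotZl (dot_vec E) mulrC. Qed.

Lemma dot_qvecr k u v : dot (vec u) (qvec k v) = zr (zdot u v) / zr k.
Proof. by rewrite /qvec dotZr (dot_vec E) mulrC. Qed.

Lemma qvecM k l v : k <> 0%Z -> qvec (Z.mul k l) (zscale k v) = qvec l v.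
Proof.
move=> k0; rewrite /qvec zrM vecZ scalerA invfM mulrAC mulVf ?mul1r//.
exact: zr_neq0.
Qed.

Lemma qvecB k u v : qvec k (zsub u v) = qvec k u - qvec k v.
Proof. by rewrite /qvec vecB scalerBr. Qed.

Lemma act_qvec s k v : act s (qvec k v) = qvec k (zact s v).
Proof. by rewrite /qvec (weylZ _ _ (act_weyl E s)) (act_vec E). Qed.

(** The points in the slices through L; two points of F are in slices that differ by a translation
  in L exactly when their difference is here. *)
Definition slice_group : set 'rV[R]_6 :=
  [set x | exists l v, [/\ lattice_set L l, V v & x = l + v]].

Lemma slice_groupD x y : slice_group x -> slice_group y -> slice_group (x + y).
Proof.
move=> [l [v [Ll Vv ->]]] [l' [v' [Ll' Vv' ->]]]; exists (l + l'), (v + v'); split.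
- exact: latticeD.
- exact: (fixed_spaceD Wf).
- by rewrite addrACA.
Qed.

Lemma slice_groupN x : slice_group x -> slice_group (- x).
Proof.
move=> [l [v [Ll Vv ->]]]; exists (- l), (- v); split.
- exact: latticeN.
- by rewrite -scaleN1r; exact: (fixed_spaceZ Wf).
- by rewrite opprD.
Qed.

Lemma slice_group_lattice l : lattice_set L l -> slice_group l.
Proof.
by move=> Ll; exists l, 0; split; rewrite ?addr0//; exact: (weyl0 Wf).
Qed.

Lemma slice_group_fixed v : V v -> slice_group v.
Proof. by move=> Vv; exists 0, v; split; rewrite ?add0r//; exact: lattice0. Qed.

Lemma slice_group_act u x : Z_w u -> slice_group x -> slice_group (u x).
Proof.
move=> Zu [l [v [Ll Vv ->]]]; have [Wu _] := Zu.
exists (u l), (u v); split; [exact: latticeW|exact: (fixed_space_act Zu)|exact: (weylD _ _ Wu)].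
Qed.

Lemma slice_group_act_eq u x : Z_w u -> slice_group (u x) <-> slice_group x.
Proof.
move=> Zu; split; last exact: slice_group_act.
by have [v [Zv uv vu]] := centralizer_inv Zu; move=> /(slice_group_act Zv); rewrite uv.
Qed.

(** The vector theta of the coordinate. *)
Definition char c := qvec 3 (co_char w c).

Lemma displacement_char c x : coordinate_ok w dual c ->
  dot (f x - x) (qvec 3 (co_test c)) = zr (co_ord c) * dot x (char c).
Proof.
case/and5P => _ _ _ _ /allP h; have [y ->] := base_span E x.
elim/big_ind: _ => [|u v hu hv|i _].
- by rewrite (weyl0 Wf) subrr !dot0l mulr0.
- by rewrite (weylD _ _ Wf) opprD addrACA dotDl hu hv dotDl mulrDr.
- have [j j6 ->] := simple_indexP i; rewrite (weylZ _ _ Wf) -scalerBr !dotZl mulrCA; congr (_ * _).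
  have js : j \in simple_words by case: j j6 => [|[|[|[|[|[|[|j]]]]]]].
  rewrite -vec_simple (act_vec E) -vecB /char /qvec !dotZr !(dot_vec E).
  have /Z.eqb_eq-> := h _ js.
  by rewrite zrM mulrCA.
Qed.

Lemma co_ord_gt0 c : coordinate_ok w dual c -> (0 < co_ord c)%Z.
Proof. by case/and5P => /Z.ltb_lt. Qed.

Lemma co_ord_neq0 c : coordinate_ok w dual c -> co_ord c <> 0%Z.
Proof. by move=> /co_ord_gt0; lia. Qed.

Lemma char_fixed c v : coordinate_ok w dual c -> V v -> dot v (char c) = 0.
Proof.
move=> ok Vv; have := displacement_char v ok; rewrite Vv subrr dot0l => /esym/eqP.
by rewrite mulf_eq0 (negbTE (zr_neq0 R (co_ord_neq0 ok))) /= => /eqP.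
Qed.

Lemma char_lattice c l : coordinate_ok w dual c -> lattice_set L l ->
  dot l (char c) \is a Num.int.
Proof.
case/and5P => _ hc _ _ _ Ll; apply: (torus_lattice_pairing Ll).
exact: (in_lattice_torus E).
Qed.

Lemma char_fixed_lift c x : coordinate_ok w dual c -> fixed_lift L f x ->
  zr (co_ord c) * dot x (char c) \is a Num.int.
Proof.
move=> ok Fx; rewrite -displacement_char//; apply: (torus_lattice_pairing Fx).
by case/and5P: ok => _ _ _ hs _; exact: (in_lattice_torus E).
Qed.

Lemma co_vec_lattice c : coordinate_ok w dual c -> lattice_set L (qvec 3 (co_vec c)).
Proof. by case/and5P => _ _ hb _ _; exact: (in_lattice_torus E). Qed.

Lemma latticeZ l (k : int) : lattice_set L l -> lattice_set L (k%:~R *: l).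
Proof.
move=> Ll; rewrite scaler_int; have nat_mul n : lattice_set L (l *+ n).
  elim: n => [|n IH]; first exact: lattice0.
  by rewrite mulrS; exact: latticeD.
by case: k => n; [exact: nat_mul|apply: latticeN; exact: nat_mul].
Qed.

Lemma latticeZint l (r : R) : r \is a Num.int -> lattice_set L l -> lattice_set L (r *: l).
Proof. by move=> /intrP[k ->]; exact: latticeZ. Qed.

Let cs_ok : all (coordinate_ok w dual) cs. Proof. by case/and5P: t_ok. Qed.
Let cs_complete : coordinates_complete w cs. Proof. by case/and5P: t_ok. Qed.

Definition lattice_part (cs' : seq coordinate) x :=
  \sum_(c <- cs') dot x (char c) *: qvec 3 (co_vec c).

Lemma lattice_partP x : V (x - lattice_part cs x).
Proof.
rewrite /fixed_space /=.
have linD y z : y + z - lattice_part cs (y + z) = (y - lattice_part cs y) + (z - lattice_part cs z).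
  rewrite /lattice_part addrACA -opprD -big_split; congr (_ - _).
  by apply: eq_bigr => c _; rewrite dotDl scalerDl.
have linZ r y : r *: y - lattice_part cs (r *: y) = r *: (y - lattice_part cs y).
  rewrite /lattice_part scalerBr scaler_sumr; congr (_ - _).
  by apply: eq_bigr => c _; rewrite dotZl -scalerA.
apply: (linear_on_simple E (f := fun x => f (x - lattice_part cs x))
   (g := fun x => x - lattice_part cs x)) => //.
- by move=> y z; rewrite linD; exact: (weylD _ _ Wf).
- by move=> r y; rewrite linZ; exact: (weylZ _ _ Wf).
move=> i /(allP cs_complete)/zeqbP h.
have nz : zr 9 != 0 by exact: zr_neq0.
have -> : vec (zsimple i) - lattice_part cs (vec (zsimple i)) =
    qvec 9 (zsub (zscale 9 (zsimple i))
     (zsum [seq zscale (zdot (zsimple i) (co_char w c)) (co_vec c) | c <- cs])).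
  rewrite qvecB /qvec vecZ scalerA mulVf// scale1r vec_sum big_map scaler_sumr.
  congr (_ - _); apply: eq_bigr => c _.
  rewrite /char dot_qvecr vecZ /qvec !scalerA; congr (_ *: _).
  by rewrite -mulrA -invfM -zrM mulrC.
by rewrite act_qvec h.
Qed.

Lemma slice_groupP x : slice_group x <-> all (fun c => dot x (char c) \is a Num.int) cs.
Proof.
split=> [[l [v [Ll Vv ->]]]|h].
  have := cs_ok; elim: (cs) => //= c s IH /andP[ok /IH->].
  by rewrite dotDl (char_fixed ok Vv) addr0 (char_lattice ok Ll).
have Vp := lattice_partP x; exists (lattice_part cs x), (x - lattice_part cs x).
split=> //; last by rewrite addrC subrK.
rewrite /lattice_part; move: h cs_ok; elim: (cs) => [|c s IH] /=.
  by move=> _ _; rewrite big_nil; exact: lattice0.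
case/andP => hi hs /andP[ok oks]; rewrite big_cons; apply: latticeD; last exact: IH.
by apply: latticeZint => //; exact: co_vec_lattice.
Qed.

Lemma in_slice_groupP k v : k <> 0%Z ->
  in_slice_group w cs k v <-> slice_group (qvec k v).
Proof.
move=> k0; rewrite slice_groupP /in_slice_group.
suff -> : all (fun c => dot (qvec k v) (char c) \is a Num.int) cs =
    all (fun c => zdot v (co_char w c) mod (3 * k) =? 0)%Z cs by [].
apply: eq_all => c; rewrite /char dot_qvec Z.mul_comm; apply/idP/idP; move/zmodP; apply; lia.
Qed.

(** A point of F with prescribed coordinates k / d. *)
Definition residue_vector (cs' : seq coordinate) (ks : seq Z) : 'rV[R]_6 :=
  \sum_(ck <- seq.zip cs' ks) (zr ck.2 / zr (co_ord ck.1)) *: qvec 3 (co_vec ck.1).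

Lemma order_product_neq0 cs' : all (coordinate_ok w dual) cs' -> order_product cs' <> 0%Z.
Proof.
elim: cs' => //= c s IH /andP[/co_ord_neq0 c0 /IH s0] /Z.mul_eq_0; lia.
Qed.

Lemma order_product_dvd (M : Z) cs' : all (coordinate_ok w dual) cs' ->
  all (fun c => Z.eqb (M * order_product cs')
    (co_ord c * ((M * order_product cs') / co_ord c)))%Z cs'.
Proof.
elim: cs' M => //= c s IH M /andP[ok oks]; apply/andP; split.
  have c0 := co_ord_neq0 ok; apply/Z.eqb_eq.
  have -> : (M * (co_ord c * order_product s) = M * order_product s * co_ord c)%Z by lia.
  by rewrite Z.div_mul// Z.mul_comm.
by rewrite Z.mul_assoc; exact: IH.
Qed.

Lemma residue_pointP ks :
  qvec (Z.mul 3 (order_product cs)) (residue_point cs ks) = residue_vector cs ks.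
Proof.
rewrite /residue_point /residue_vector /qvec vec_sum big_map scaler_sumr.
have D0 := order_product_neq0 cs_ok; have := order_product_dvd 1 cs_ok.
rewrite Z.mul_1_l; move: (order_product cs) D0 => D D0.
elim: (cs) cs_ok ks => [|c s IH].
  by move=> _ [|k ks] _; rewrite !big_nil.
move=> /andP[ok oks] [|k ks]; first by move=> _; rewrite !big_nil.
move=> /andP[/Z.eqb_eq DE Ds]; rewrite [seq.zip _ _]/= !big_cons IH//.
congr (_ + _); rewrite [LHS]/= vecZ /qvec !scalerA; congr (_ *: _).
have c0 := zr_neq0 R (co_ord_neq0 ok).
have q0 : zr (D / co_ord c)%Z != 0.
  by apply: contraTneq (zr_neq0 R D0) => q0; rewrite DE zrM q0 mulr0 eqxx.
have -> : zr (3 * D)%Z = zr 3 * (zr (co_ord c) * zr (D / co_ord c)%Z) by rewrite {1}DE !zrM.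
rewrite zrM; have : zr 3 != 0 by exact: zr_neq0.
move: (zr 3) (zr k) (zr (co_ord c)) (zr (D / co_ord c)%Z) c0 q0 => p q r s' r0 s0 p0.
by field; rewrite p0 r0 s0.
Qed.

Lemma mem_residues (ds : seq Z) (ks : seq Z) : size ks = size ds ->
  all (fun kd => (0 <=? kd.1) && (kd.1 <? kd.2))%Z (seq.zip ks ds) -> ks \in residues ds.
Proof.
elim: ds ks => [|d ds IH] [|k ks] //= [sz] /andP[/andP[/Z.leb_le k0 /Z.ltb_lt kd] h].
apply/allpairsP; exists (Z.to_nat k, ks); split => /=.
- by rewrite mem_iota /=; lia.
- exact: IH.
- by rewrite Z2Nat.id.
Qed.

Lemma residue_exists x : fixed_lift L f x -> exists2 ks,
  ks \in residues (map co_ord cs) & slice_group (x - residue_vector cs ks).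
Proof.
move=> Fx.
have [ks [sz hks Lks]] : exists ks, [/\ size ks = size (map co_ord cs),
    all (fun kd => (0 <=? kd.1) && (kd.1 <? kd.2))%Z (seq.zip ks (map co_ord cs)) &
    lattice_set L (lattice_part cs x - residue_vector cs ks)].
  rewrite /lattice_part /residue_vector; elim: (cs) cs_ok => [|c s IH].
    by exists [::]; split=> //; rewrite !big_nil subrr; exact: lattice0.
  move=> /andP[ok oks]; have [ks [sz hks Lks]] := IH oks.
  have [n nE] := zr_intP (char_fixed_lift ok Fx).
  have c0 := co_ord_gt0 ok; have cr := zr_neq0 R (co_ord_neq0 ok).
  exists ((n mod co_ord c)%Z :: ks); split=> /=; first by rewrite sz.
    rewrite hks andbT; have := Z.mod_pos_bound n _ c0 => -[h1 h2].
    by apply/andP; split; [apply/Z.leb_le|apply/Z.ltb_lt].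
  rewrite !big_cons opprD addrACA -scalerBl; apply: latticeD => //=.
  apply: latticeZint (co_vec_lattice ok).
  have -> : dot x (char c) = zr n / zr (co_ord c) by rewrite -nE mulrAC mulfV ?mul1r.
  rewrite -mulrBl -zrB [in X in zr (X - _)%Z](Z_div_mod_eq_full n (co_ord c)).
  by rewrite Z.add_simpl_r zrM mulrAC mulfV// mul1r zr_int.
exists ks; first exact: mem_residues.
rewrite -[x](subrK (lattice_part cs x)) -addrA; apply: slice_groupD.
  exact: slice_group_fixed (lattice_partP x).
exact: slice_group_lattice.
Qed.

Definition slice_at (i : nat) : slice_certificate :=
  nth (point_slice zzero 1) (tc_slices t) i.

Definition point_at i := qvec (sc_den (slice_at i)) (sc_point (slice_at i)).

Definition centre_at i :=
  point_at i + qvec (sc_centre_den (slice_at i)) (sc_centre (slice_at i)).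

Definition wall_vector (s : slice_certificate) v : 'rV[R]_6 :=
  (zr (multiplier w o s v) / o%:R) *: vec (trace v).

Definition walls_at i := [seq wall_vector (slice_at i) v | v <- wall_roots w o (slice_at i)].

Let slices_ok : all (slice_ok w o zv0 dual) (tc_slices t).
Proof. by case/and5P: t_ok. Qed.

Lemma slice_at_ok i : (i < size (tc_slices t))%nat -> slice_ok w o zv0 dual (slice_at i).
Proof. by move=> i_s; have /all_nthP h := slices_ok; exact: h. Qed.

(** Move x by L + ker (w - 1) to one of the finitely many points with the same coordinates; the
  certificate says where the centraliser takes this point. *)
Lemma cover x : fixed_lift L f x -> exists i u l, [/\ (i < size (tc_slices t))%nat,
  Z_w u, lattice_set L l & V (u x + l - point_at i)].
Proof.
move=> Fx; have [ks kr xk] := residue_exists Fx.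
have /and5P[_ _ _ /eqP sz /andP[cov _]] := t_ok.
pose j := index ks (residues (map co_ord cs)).
have j_s : (j < size (residues (map co_ord cs)))%nat by rewrite index_mem.
have := all_nthP (ks, (0%nat, 0%num)) cov j; rewrite size_zip -sz minnn => /(_ j_s).
rewrite nth_zip// nth_index//; case: (nth _ (tc_cover t) j) => i n /=.
case/and3P => i_s com; rewrite -/(slice_at i) => inS.
have ok := slice_at_ok i_s.
have d0 : (0 < sc_den (slice_at i))%Z by case/and5P: ok => /Z.ltb_lt.
have D0 := order_product_neq0 cs_ok.
have Zu := commutes_centralizer E com.
move: inS => /in_slice_groupP; rewrite qvecB.
have -> : qvec (3 * order_product cs * sc_den (slice_at i)) (zscale (sc_den (slice_at i))
    (zact (word_of n) (residue_point cs ks))) = act (word_of n) (residue_vector cs ks).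
  by rewrite Z.mul_comm qvecM -?act_qvec ?residue_pointP//; lia.
rewrite qvecM -/(point_at i); last by lia.
move=> /(_ ltac:(lia)) h.
have : slice_group (act (word_of n) x - point_at i).
  rewrite -(subrKA (act (word_of n) (residue_vector cs ks))); apply: slice_groupD => //.
  by rewrite -(weylB _ _ (proj1 Zu)); exact: slice_group_act.
move=> [l [v [Ll Vv e]]]; exists i, (act (word_of n)), (- l); split=> //.
  exact: latticeN.
by rewrite addrAC e addrAC subrr add0r.
Qed.

Lemma point_fixed_lift i : (i < size (tc_slices t))%nat -> fixed_lift L f (point_at i).
Proof.
move=> /slice_at_ok/and5P[/Z.ltb_lt d0 h _ _ _].
rewrite /fixed_lift /= act_qvec -qvecB; apply: (in_lattice_torus E) => //; lia.
Qed.

Definition invariant_value (iv : invariant) : set 'rV[R]_6 :=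
  match iv with
  | Multiple k e => [set x | slice_group (zr k *: x - qvec 3 e)]
  | Displacement e => [set x | lattice_set (root_lattice Phi) (f x - x - qvec 3 e)]
  end.

Lemma invariant_holdsP i iv : (i < size (tc_slices t))%nat ->
  invariant_holds w cs iv (slice_at i) <-> invariant_value iv (point_at i).
Proof.
move=> /slice_at_ok/and5P[/Z.ltb_lt d0 _ _ _ _].
set s := slice_at i in d0 *; have d3 : (3 * sc_den s <> 0)%Z by lia.
have qe e : qvec (3 * sc_den s) (zscale (sc_den s) e) = qvec 3 e.
  by rewrite Z.mul_comm qvecM//; lia.
case: iv => [k e|e] /=.
  rewrite in_slice_groupP// qvecB qe -/s.
  have -> : zscale (3 * k) (sc_point s) = zscale 3 (zscale k (sc_point s)).
    by rewrite /zscale /=; congr ZV; lia.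
  by rewrite qvecM// /qvec vecZ scalerA mulrC -scalerA.
have -> : f (point_at i) - point_at i - qvec 3 e = qvec (3 * sc_den s)
    (zsub (zscale 3 (zsub (zact w (sc_point s)) (sc_point s))) (zscale (sc_den s) e)).
  by rewrite qvecB qe qvecM// qvecB -act_qvec.
have := rwP (zdivides_root_lattice E (zsub (zscale 3 (zsub (zact w (sc_point s)) (sc_point s)))
  (zscale (sc_den s) e)) d3).
by case=> h1 h2; split.
Qed.

Lemma invariant_act iv x y u l : invariant_ok iv -> Z_w u -> lattice_set L l ->
  V (u x + l - y) -> invariant_value iv x <-> invariant_value iv y.
Proof.
move=> ok Zu Ll Vy; have [Wu _] := Zu.
have yE : y = u x + l - (u x + l - y) by rewrite opprB addrC subrK.
move: (u x + l - y) Vy yE => v Vv yE.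
have Pe e : in_lattice true 3 e -> lattice_set (root_lattice Phi) (u (qvec 3 e) - qvec 3 e).
  move=> he; apply: (weyl_dual_trivial (E6_norm E) Wu).
  exact: (in_lattice_torus E (dual := true)).
case: iv ok => [k e|e] /= /Pe Qe.
  have -> : zr k *: y - qvec 3 e = u (zr k *: x - qvec 3 e) +
      ((u (qvec 3 e) - qvec 3 e) + zr k *: l - zr k *: v).
    rewrite yE (weylB _ _ Wu) (weylZ _ _ Wu) scalerBr scalerDr.
    by apply/rowP => j; rewrite !mxE; ring.
  have Sr : slice_group (u (qvec 3 e) - qvec 3 e + zr k *: l - zr k *: v).
    apply: slice_groupD; last first.
      by apply: slice_groupN; apply: slice_group_fixed; exact: (fixed_spaceZ Wf).
    apply: slice_group_lattice; apply: latticeD; first exact: (root_sub_torus E).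
    by apply: latticeZint => //; exact: zr_int.
  split=> h.
    by apply: slice_groupD => //; exact: slice_group_act.
  apply/(slice_group_act_eq _ Zu).
  rewrite -[u _](addrK (u (qvec 3 e) - qvec 3 e + zr k *: l - zr k *: v)).
  by apply: slice_groupD => //; exact: slice_groupN.
have Ql : lattice_set (root_lattice Phi) (f l - l).
  by apply: (weyl_dual_trivial (E6_norm E) Wf); exact: (torus_lattice_sub E Ll).
have -> : f y - y - qvec 3 e = u (f x - x - qvec 3 e) +
    ((u (qvec 3 e) - qvec 3 e) + (f l - l)).
  have fv : f v = v by [].
  rewrite yE (weylB _ _ Wf) (weylD _ _ Wf) fv -(centralizer_comm _ Zu) !(weylB _ _ Wu).
  by apply/rowP => j; rewrite !mxE; ring.
have Qr := latticeD Qe Ql; split=> h.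
  by apply: (latticeD (L := root_lattice Phi)) => //; exact: (root_latticeW Wu).
have : lattice_set (root_lattice Phi) (u (f x - x - qvec 3 e)).
  rewrite -[u _](addrK (u (qvec 3 e) - qvec 3 e + (f l - l))).
  exact: root_latticeB.
have [u' [[Wu' _] uu' _]] := centralizer_inv Zu.
by move=> /(latticeW Wu'); rewrite uu'.
Qed.

(** Slices in one orbit have the same invariants, and the certificate contains an invariant
  for every pair of slices. *)
Lemma slices_distinct i j u l : (i < size (tc_slices t))%nat -> (j < size (tc_slices t))%nat ->
  Z_w u -> lattice_set L l -> V (u (point_at i) + l - point_at j) -> i = j.
Proof.
move=> i_s j_s Zu Ll Vij.
have /and5P[_ _ _ _ /andP[_ /andP[iok pw]]] := t_ok.
have same : forall iv, invariant_ok iv ->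
    invariant_holds w cs iv (slice_at i) = invariant_holds w cs iv (slice_at j).
  move=> iv ok; apply/idP/idP => /invariant_holdsP h; apply/invariant_holdsP => //.
    by apply/(invariant_act ok Zu Ll Vij); exact: h.
  by apply/(invariant_act ok Zu Ll Vij); exact: h.
have diff k k' : (k < k')%nat -> (k' < size (tc_slices t))%nat ->
    ~ forall iv, invariant_ok iv ->
      invariant_holds w cs iv (slice_at k) = invariant_holds w cs iv (slice_at k').
  move=> kk' k'_s eqi; have k_s := ltn_trans kk' k'_s.
  have /(pairwiseP (point_slice zzero 1)) pw' := pw.
  have := pw' k k' k_s k'_s kk'.
  elim: (tc_invariants t) iok => //= iv s IH /andP[ok oks].
  by rewrite -/(slice_at k) -/(slice_at k') eqi// eqxx /=; exact: IH.
case: (ltngtP i j) => // ij; first by case: (diff i j ij j_s).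
by case: (diff j i ij i_s) => iv ok; rewrite same.
Qed.

Section one_slice.
Context (i : nat) (i_s : (i < size (tc_slices t))%nat).
Local Notation s := (slice_at i).
Local Notation x0 := (point_at i).
Let s_ok := slice_at_ok i_s.
Let o_neq0 : o%:R != 0 :> R := oR_neq0 R w_order.

Let den_gt0 : (0 < sc_den s)%Z. Proof. by case/and5P: s_ok => /Z.ltb_lt. Qed.
Let den_neq0 : sc_den s <> 0%Z. Proof. by move: den_gt0; lia. Qed.

Lemma point_perp : dot x0 v0 = 0.
Proof.
case/and5P: s_ok => _ _ /Z.eqb_eq h _ _.
by rewrite dot_qvecl h mul0r.
Qed.

Lemma trace_vec_fixed v : V (vec (trace v)).
Proof. by rewrite -(Tr_vec E); exact: (Tr_fixed E w_order). Qed.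

Lemma dot_trace v u : V v -> dot v (vec (trace u)) = o%:R * dot v (vec u).
Proof. by move=> Vv; rewrite -(Tr_vec E) (dot_Tr E _ _ Vv). Qed.

Lemma wall_vector_fixed v : V (wall_vector s v).
Proof. by apply: (fixed_spaceZ Wf); exact: trace_vec_fixed. Qed.

Lemma dot_wall v u : V v -> dot v (wall_vector s u) = zr (multiplier w o s u) * dot v (vec u).
Proof. by move=> Vv; rewrite dotZr dot_trace// mulrA divfK. Qed.

Lemma wall_vector_contracted v : v \in wall_roots w o s ->
  contracted_space f v0 (wall_vector s v).
Proof.
move=> vw; split; first exact: wall_vector_fixed.
case/and5P: s_ok => _ _ _ /allP/(_ v vw)/Z.eqb_eq h _.
by rewrite dotZl (dot_vec E) h mulr0.
Qed.

Lemma multiplier_act s' v : Z_w (act s') -> multiplier w o s (zact s' v) = multiplier w o s v.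
Proof. by move=> Zs; rewrite /multiplier (zact_trace_norm E). Qed.

Lemma wall_roots_act s' v : Z_w (act s') -> v \in wall_roots w o s ->
  zact s' v \in wall_roots w o s.
Proof.
move=> Zs; rewrite !mem_filter => /andP[mv vr]; rewrite multiplier_act// mv /=.
exact: zact_zroots.
Qed.

Lemma walls_perm u : Z_w u -> perm_eq (map u (walls_at i)) (walls_at i).
Proof.
move=> Zu; have [s' us] := centralizer_word E Zu; rewrite us in Zu *.
have P : perm_eq (map (zact s') (wall_roots w o s)) (wall_roots w o s).
  apply: (perm_zact_filter E); first by vm_compute.
    by move=> v; exact: zact_zroots.
  by move=> v; rewrite multiplier_act.
have := perm_map (wall_vector s) P; rewrite /walls_at -!map_comp.
rewrite (@eq_map _ _ (wall_vector s \o zact s') (act s' \o wall_vector s)) => [//|v /=].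
by rewrite /wall_vector multiplier_act// (zact_trace E)// (weylZ _ _ (proj1 Zu)) (act_vec E).
Qed.

Lemma wallsP b : b \in walls_at i -> exists2 v, v \in wall_roots w o s & b = wall_vector s v.
Proof. by rewrite /walls_at => /mapP. Qed.

Lemma walls_integral u l b : Z_w u -> lattice_set L l -> V (u x0 + l - x0) ->
  b \in walls_at i -> dot (u x0 + l - x0) b \is a Num.int.
Proof.
move=> Zu Ll Vl /wallsP[v vw ->].
have [u' [Zu' uu' u'u]] := centralizer_inv Zu.
have [s' us'] := centralizer_word E Zu'.
have Zs' : Z_w (act s') by rewrite -us'.
have v'w := wall_roots_act Zs' vw.
have adj y : dot (u x0) y = dot x0 (u' y).
  by rewrite -[in RHS](uu' x0) (weyl_dot _ _ (proj1 Zu')).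
have Pl := torus_lattice_sub E Ll.
have : wall_integral w o s by case/and5P: s_ok => _ _ _ _ /andP[].
rewrite /wall_integral => /orP[] /allP h.
  have hx y : y \in wall_roots w o s -> zr (multiplier w o s y) * dot x0 (vec y) \is a Num.int.
    by move=> yw; rewrite dot_qvecl mulrA -zrM; apply/zmodP => //; exact: h.
  rewrite dot_wall// dotBl dotDl adj us' (act_vec E) mulrBr mulrDr.
  apply: rpredB; last exact: hx.
  apply: rpredD; first by rewrite -(multiplier_act v Zs'); exact: hx.
  by apply: rpredM; [exact: zr_int|apply: Pl; exact: vec_root_lattice].
have hx y : y \in wall_roots w o s -> dot x0 (vec (trace y)) = 0.
  by move=> /h/andP[/Z.eqb_eq e _]; rewrite dot_qvecl e mul0r.
have lw : dot l (wall_vector s v) \is a Num.int.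
  apply: Pl; rewrite /wall_vector.
  have on : Z.of_nat o <> 0%Z by have := order_gt0 w_order; lia.
  have /andP[_ /(zdivides_root_lattice E _ on)] := h v vw.
  by rewrite vecZ scalerA zr_order mulrC.
rewrite dotBl dotDl adj us' /wall_vector (weylZ _ _ (proj1 Zs')) !dotZr (act_vec E).
rewrite -(zact_trace E)// !hx// !mulr0 add0r subr0.
by move: lw; rewrite dotZr.
Qed.

Lemma centre_part_fixed : V (qvec (sc_centre_den s) (sc_centre s)).
Proof.
case/and5P: s_ok => _ _ _ _ /and5P[_ _ _ /and5P[_ /zeqbP h _ _ _] _].
by rewrite /fixed_space /= act_qvec h.
Qed.

Let h_gt0 : (0 < sc_centre_den s)%Z.
Proof. by case/and5P: s_ok => _ _ _ _ /and5P[_ _ _ /and5P[/Z.ltb_lt]]. Qed.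
Let h_neq0 : sc_centre_den s <> 0%Z. Proof. by move: h_gt0; lia. Qed.

Lemma centre_wall v : dot (qvec (sc_centre_den s) (sc_centre s)) (wall_vector s v) =
  zr (multiplier w o s v * zdot (sc_centre s) v)%Z / zr (sc_centre_den s).
Proof. by rewrite dot_wall; [rewrite dot_qvecl zrM mulrA|exact: centre_part_fixed]. Qed.

Lemma centre_off b : b \in walls_at i ->
  dot (qvec (sc_centre_den s) (sc_centre s)) b \isn't a Num.int.
Proof.
move=> /wallsP[v vw ->]; rewrite centre_wall.
case/and5P: s_ok => _ _ _ _ /and5P[_ _ _ /and5P[_ _ _ /allP h _] _].
by apply/negP => /(zmodP _ _ h_neq0) e; have := h v vw; rewrite e.
Qed.

Lemma frac_zr (x h : Z) : (0 < h)%Z -> frac (zr x / zr h) = zr (x mod h)%Z / zr h.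
Proof.
move=> h0; have hr := zr_neq0 R (k := h) ltac:(lia).
have zr_lt (y z : Z) : (y < z)%Z -> zr y < zr z by move=> yz; rewrite zr_intr ltr_int; lia.
have [q0 q1] := Z.mod_pos_bound x h h0.
have xE : zr x / zr h = zr (x / h)%Z + zr (x mod h)%Z / zr h.
  by rewrite {1}(Z_div_mod_eq_full x h) zrD zrM mulrDl mulrAC mulfV// mul1r.
rewrite /frac; have -> : Num.floor (zr x / zr h) = int_of_Z (x / h)%Z.
  have hp : 0 < zr h := zr_lt 0%Z h h0.
  apply: floor_def; rewrite xE intrD; apply/andP; split.
    rewrite lerDl divr_ge0 ?(ltW hp)// zr_intr ler0z; lia.
  by rewrite ltrD2l ltr_pdivrMr// mul1r; exact: zr_lt.
by rewrite xE addrC addKr.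
Qed.

Lemma centre_sum :
  \sum_(b <- walls_at i) (frac (dot (qvec (sc_centre_den s) (sc_centre s)) b) - 2^-1) *: b = 0.
Proof.
case/and5P: s_ok => _ _ _ _ /and5P[_ _ _ /and5P[_ _ _ _ /zeqbP h] _].
set hh := sc_centre_den s in h *.
have hr := zr_neq0 R h_neq0.
rewrite big_map; transitivity ((2 * zr hh * o%:R)^-1 *: vec zzero); last by rewrite vec0 scaler0.
rewrite -h vec_sum big_map scaler_sumr; apply: eq_bigr => v _.
rewrite centre_wall frac_zr// -/hh vecZ /wall_vector !scalerA; congr (_ *: _).
rewrite !zrM zrB zrM; have -> : zr 2 = 2 by [].
by field; rewrite o_neq0 hr.
Qed.

(** Orthogonality to v is not changed by a reduction step, since the pivot is not zero. *)
Lemma spanned_orthogonal v ys ts : spanned id ys ts ->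
  (forall y, y \in ys -> dot v (vec y) = 0) -> forall t, t \in ts -> dot v (vec t) = 0.
Proof.
suff gen r : (forall z, dot v (vec (r z)) = 0 <-> dot v (vec z) = 0) -> spanned r ys ts ->
    (forall y, y \in ys -> dot v (vec y) = 0) -> forall t, t \in ts -> dot v (vec t) = 0.
  exact: (gen id).
have done_ r' : (forall z, dot v (vec (r' z)) = 0 <-> dot v (vec z) = 0) ->
    all (fun t => zeqb (r' t) zzero) ts -> forall t, t \in ts -> dot v (vec t) = 0.
  move=> r'P /allP h u uts; have /zeqbP e := h u uts.
  by apply: (proj1 (r'P u)); rewrite e vec0 dot0r.
elim: ys r => [|y ys IH] r rP /=; first by rewrite orbF => h _; exact: done_ h.
case/orP => [h _|rest yv]; first exact: done_ h.
have yv' : dot v (vec (r y)) = 0 by apply: (proj2 (rP y)); apply: yv; exact: mem_head.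
have ysv z : z \in ys -> dot v (vec z) = 0 by move=> zys; apply: yv; rewrite inE zys orbT.
move: rest; case: ifPn => [_ h|c0 h]; first exact: (IH r).
apply: (IH _ _ h) => // z; rewrite /eliminate vecB !vecZ dotBr !dotZr yv' mulr0 subr0.
split=> [/eqP|/(proj2 (rP z))->]; last by rewrite mulr0.
by rewrite mulf_eq0 zr_eq0 (negbTE c0) => /eqP/(proj1 (rP z)).
Qed.

Lemma walls_span v : contracted_space f v0 v ->
  (forall b, b \in walls_at i -> dot v b = 0) -> v = 0.
Proof.
move=> [Vv vv0] hb.
have : span_ok w o zv0 s by case/and5P: s_ok => _ _ _ _ /and5P[].
rewrite /span_ok => span.
have axes y : y \in zv0 :: map trace (wall_roots w o s) -> dot v (vec y) = 0.
  rewrite inE => /orP[/eqP->//|/mapP[u uw ->]].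
  have := hb _ (map_f (wall_vector s) uw).
  rewrite /wall_vector dotZr => /eqP; rewrite !mulf_eq0 invr_eq0 (negbTE o_neq0) orbF.
  by move: uw; rewrite mem_filter zr_eq0 => /andP[/negbTE-> _] /= /eqP.
have simple0 k : k \in simple_words -> dot v (vec (zsimple k)) = 0.
  move=> k6; have := spanned_orthogonal span axes (map_f (fun k => trace (zsimple k)) k6).
  by rewrite dot_trace// => /eqP; rewrite mulf_eq0 (negbTE o_neq0) => /eqP.
apply/eqP; rewrite -dot_eq0; apply/eqP; have [c cE] := base_span E v.
rewrite [X in dot _ X]cE dot_sumr big1// => j _; rewrite dotZr.
have [k k6 ->] := simple_indexP j; rewrite -vec_simple simple0 ?mulr0//.
by case: k k6 => [|[|[|[|[|[|[|k]]]]]]].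
Qed.

Lemma wall_vector_neq0 v : v \in wall_roots w o s -> wall_vector s v != 0.
Proof.
move=> vw; apply/eqP => e; have := centre_off (map_f _ vw).
by rewrite e dotC dot0l rpred0.
Qed.

(** A root fixed by w gives a reflection commuting with w, and its multiples are in both lattices. *)
Lemma root_wall_reflection v (k : int) : v \in zroots -> V (vec v) ->
  dot x0 (vec v) \is a Num.int -> exists u l, [/\ Z_w u, lattice_set L l,
    forall y, u y = reflection (vec v) y &
    u x0 + l - x0 = (2 * k%:~R / dot (vec v) (vec v)) *: vec v].
Proof.
move=> /(zroots_root E) rv Vv /intrP[n nE]; have vv := E6_norm E rv.
exists (reflection (vec v)), ((n + k)%:~R *: vec v); split=> //.
- split; first exact: (weyl_reflection rv (weyl_id _)).
  apply/funext => y /=; rewrite /reflection (weylB _ _ Wf) (weylZ _ _ Wf) Vv.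
  by congr (_ - (2 * _ / _) *: _); rewrite -{1}Vv (weyl_dot _ _ Wf).
- by apply: latticeZ; apply: (root_sub_torus E); exact: vec_root_lattice.
- rewrite /reflection vv nE intrD.
  rewrite [2 * k%:~R]mulrC mulfK ?pnatr_eq0// [2 * n%:~R]mulrC mulfK ?pnatr_eq0//.
  by apply/rowP => j; rewrite !mxE; ring.
Qed.

(** Divide k by the number m of moves: the remainder chooses the move, the quotient the power of
  the translation by 2 m beta / <beta, beta>. *)
Lemma wall_certificate_reflection c (k : int) : wall_ok w o dual s c ->
  multiplier w o s (wc_root c) != 0%Z -> vec (trace (wc_root c)) != 0 ->
  exists u l, [/\ Z_w u, lattice_set L l,
    forall y, V y -> u y = reflection (vec (trace (wc_root c))) y &
    u x0 + l - x0 = (2 * k%:~R * o%:R / (zr (multiplier w o s (wc_root c)) *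
      zr (ztrace_norm w o (wc_root c)))) *: vec (trace (wc_root c))].
Proof.
rewrite /wall_ok /ztrace_norm; set na := trace _; set nn := zdot na na.
set tt := multiplier _ _ _ _.
move: (zquot _ (tt * nn)) => step.
case/and4P => m0 stepL /zeqbP stepE moves t0 na0.
have nn0 : zr nn != 0 by rewrite /nn -(dot_vec E) dot_eq0.
have tr0 : zr tt != 0 by rewrite zr_eq0; apply: contra_neqN t0 => /Z.eqb_eq.
set m := size _ in m0 stepE moves; pose kz := Z_of_int k.
have kE : k%:~R = zr kz by rewrite zr_intr Z_of_intK.
have mz : (0 < Z.of_nat m)%Z by have /ssrnat.ltP/Nat2Z.inj_lt := m0.
have [j0 jm] := Z.mod_pos_bound kz _ mz.
pose j := Z.to_nat (kz mod Z.of_nat m)%Z.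
have jE : Z.of_nat j = (kz mod Z.of_nat m)%Z by rewrite Z2Nat.id.
have j_m : (j < m)%nat by apply/ssrnat.ltP/Nat2Z.inj_lt; rewrite jE.
have := all_nthP (0%nat, 0%num) moves j; rewrite size_zip size_iota -/m minnn => /(_ j_m).
rewrite nth_zip ?size_iota// nth_iota// add0n; move: (nth 0%num (wc_moves c) j) => n.
move: (zquot _ (sc_den s * tt * nn)) => l.
case/and4P => com lL /allP refl /zeqbP moveE.
have Zu := commutes_centralizer E com; have [Wu _] := Zu.
exists (act (word_of n)), (qvec 3 l + zr (kz / Z.of_nat m)%Z *: qvec 3 step); split=> //.
- apply: latticeD; first exact: (in_lattice_torus E).
  by apply: latticeZint; [exact: zr_int|exact: (in_lattice_torus E)].
- move=> y Vy; apply: (scalerI o_neq0); rewrite -(weylZ _ _ Wu).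
  have reflZ r z : reflection (vec na) (r *: z) = r *: reflection (vec na) z.
    by rewrite /reflection dotZl scalerBr scalerA; congr (_ - _ *: _); ring.
  have reflD z z' : reflection (vec na) (z + z') = reflection (vec na) z + reflection (vec na) z'.
    by rewrite /reflection dotDl; apply/rowP => p; rewrite !mxE; ring.
  rewrite -reflZ -(Tr_id o Vy).
  apply: (linear_on_simple E (f := fun x => act (word_of n) (Tr a w o x))
    (g := fun x => reflection (vec na) (Tr a w o x))).
  + by move=> z z'; rewrite (TrD E) (weylD _ _ Wu).
  + by move=> r z; rewrite (TrZ E) (weylZ _ _ Wu).
  + by move=> z z'; rewrite (TrD E) reflD.
  + by move=> r z; rewrite (TrZ E) reflZ.
  move=> p /refl /zeqbP/(congr1 vec); rewrite !(Tr_vec E) (act_vec E) vecB !vecZ -/nn => e.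
  apply: (scalerI nn0); rewrite e /reflection !(dot_vec E) -/nn scalerBr scalerA zrM.
  by congr (_ - _ *: _); rewrite [RHS]mulrC divfK.
have d0 : zr (sc_den s) != 0 by exact: zr_neq0.
have z3 : zr 3 != 0 by exact: zr_neq0.
clearbody nn; have -> : act (word_of n) x0 + (qvec 3 l + zr (kz / Z.of_nat m) *: qvec 3 step) - x0 =
   (zr (3 * sc_den s * tt * nn))^-1 *: vec (zadd (zscale (3 * tt * nn)
     (zsub (zact (word_of n) (sc_point s)) (sc_point s))) (zscale (sc_den s * tt * nn) l)) +
   (zr (kz / Z.of_nat m) / (zr 3 * (zr tt * zr nn))) *: vec (zscale (tt * nn) step).
  rewrite vecD !vecZ vecB -(act_vec E) /point_at /qvec (weylZ _ _ Wu) !zrM.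
  move: (zr 3) z3 (zr (sc_den s)) d0 => p p0 q q0.
  by apply/rowP => h; rewrite !mxE; field; rewrite p0 q0 tr0 nn0.
rewrite moveE stepE !vecZ kE [in RHS](Z_div_mod_eq_full kz (Z.of_nat m)) jE !scalerA -scalerDl.
congr (_ *: _); rewrite !zrD !zrM !zr_order.
have -> : zr 6 = 2 * zr 3 by rewrite -[2]/(zr 2) -zrM.
move: (zr 3) z3 (zr (sc_den s)) d0 => p p0 q q0.
by field; rewrite p0 q0 tr0 nn0.
Qed.

Lemma walls_reflect b (k : int) : b \in walls_at i -> exists u l, [/\ Z_w u, lattice_set L l,
    forall v, V v -> u v = reflection b v &
    u x0 + l - x0 = (2 * k%:~R / dot b b) *: b].
Proof.
move=> /wallsP[v vw ->].
have := s_ok; case/and5P => _ _ _ _ /and5P[_ walls_ok /allP/(_ v vw) refl _ _].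
have wv0 := wall_vector_neq0 vw.
have vroot : v \in zroots by move: vw; rewrite mem_filter => /andP[].
case/orP: refl => [/and3P[/Z.eqb_eq m1 /zeqbP trv xv]|].
  have wE : wall_vector s v = vec v.
    by rewrite /wall_vector m1 trv vecZ zr_order scalerA mulrAC mulfK ?scale1r// mul1r.
  rewrite wE; have Vv : V (vec v) by rewrite -wE; exact: wall_vector_fixed.
  have xint : dot x0 (vec v) \is a Num.int by rewrite dot_qvecl; apply/zmodP.
  by have [u [l [? ? h ?]]] := root_wall_reflection k vroot Vv xint; exists u, l; split=> // y _.
elim: (sc_walls s) walls_ok => //= c cs' IH /andP[ok oks] /orP[match_c|]; last exact: IH.
have [e [eE e2]] : exists e : Z, vec (trace v) = zr e *: vec (trace (wc_root c)) /\ zr e * zr e = 1.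
  (* The wall of a root and that of its opposite have the same reflections. *)
  case/orP: match_c => /zeqbP->; last by exists (-1)%Z; rewrite vecZ -zrM.
  by exists 1%Z; rewrite scale1r -zrM.
have nE : ztrace_norm w o v = ztrace_norm w o (wc_root c).
  apply: (@zr_inj R); rewrite /ztrace_norm -!(dot_vec E) eE dotZl dotZr mulrA e2.
  by rewrite mul1r.
have mE : multiplier w o s v = multiplier w o s (wc_root c) by rewrite /multiplier nE.
have m0 : multiplier w o s (wc_root c) != 0%Z.
  by move: vw; rewrite mem_filter mE => /andP[/negP h _]; apply/eqP => h'; apply: h; rewrite h'.
have mr0 : zr (multiplier w o s (wc_root c)) != 0.
  by rewrite zr_eq0; apply: contra_neqN m0 => /Z.eqb_eq.
have na0 : vec (trace (wc_root c)) != 0.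
  by apply: contra_neq wv0 => h; rewrite /wall_vector eE h !scaler0.
have kk : zr e * k%:~R \is a Num.int by rewrite rpredM ?zr_int ?intr_int.
case/intrP: kk => k' k'E.
have [u [l [Zu Ll uV uE]]] := wall_certificate_reflection k' ok m0 na0.
exists u, l; split=> //.
  move=> y Vy; rewrite uV// /wall_vector mE eE scalerA; set r := _ * _.
  have r0 : r != 0.
    by apply: contra_neq wv0 => h; rewrite /wall_vector mE eE scalerA -/r h scale0r.
  rewrite /reflection dotZl !dotZr scalerA; congr (_ - _ *: _).
  have : dot (vec (trace (wc_root c))) (vec (trace (wc_root c))) != 0 by rewrite dot_eq0.
  by move: (dot _ _) (dot y _) => p q p0; field; rewrite p0 r0.
rewrite uE /wall_vector mE eE dotZl !dotZr dotZl -k'E /ztrace_norm -(dot_vec E) !scalerA.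
congr (_ *: _).
have p0 : dot (vec (trace (wc_root c))) (vec (trace (wc_root c))) != 0 by rewrite dot_eq0.
have e0 : zr e != 0 by apply: contra_eq_neq e2 => ->; rewrite mul0r eq_sym oner_eq0.
have ei : (zr e)^-1 = zr e by rewrite -[LHS]mulr1 -e2 mulKf.
rewrite -[in LHS]ei.
move: (dot _ _) p0 (zr e) e0 {ei e2 eE k'E} => p p0 q q0.
by field; rewrite p0 q0 mr0 o_neq0.
Qed.

End one_slice.

Lemma torus_slice_system : slice_system f v0 L
  (fun i : 'I_(size (tc_slices t)) => point_at i) (fun i => centre_at i) (fun i => walls_at i).
Proof.
split.
- by move=> x /cover[i [u [l [i_s Zu Ll h]]]]; exists (Ordinal i_s), u, l; split.
- by move=> i j u l Zu Ll /(slices_distinct (ltn_ord i) (ltn_ord j) Zu Ll)/val_inj.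
- by move=> i; exact: point_fixed_lift.
- by move=> i; exact: point_perp.
- by move=> i b /wallsP[v vw ->]; exact: (wall_vector_contracted (ltn_ord i)).
- by move=> i u; exact: walls_perm.
- by move=> i u l b; exact: walls_integral.
- by move=> i b k; exact: walls_reflect.
- by move=> i v; exact: walls_span.
- move=> i; rewrite /centre_at addrC addKr; split; first exact: centre_part_fixed.
  have := slice_at_ok (ltn_ord i).
  case/and5P => _ _ _ _ /and5P[_ _ _ /and5P[_ _ /Z.eqb_eq h _ _] _].
  by rewrite dot_qvecl h mul0r.
- by move=> i b; rewrite /centre_at addrC addKr; exact: centre_off.
- by move=> i; rewrite /centre_at addrC addKr; exact: centre_sum.
Qed.

End torus_certificate.

(** * Homotopy equivalence of the orbit spaces *)

Lemma class_certificates_ok :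
  all (fun k => class_ok k (nth cert_id class_certificates k)) (iota 0 25).
Proof. by vm_compute. Qed.

Section base.
Context (R : realType) (Phi : rootSystem R 6) (a : 'I_6 -> 'rV[R]_6) (E : E6_base Phi a).

(** The product of a weight of length less than 1 / 2 and a simple root is an integer of absolute
  value less than 1, so it vanishes. *)
Lemma torus_lattice_discrete dual : discrete_lattice (torus_lattice Phi dual).
Proof.
exists 2^-1; first by rewrite invr_gt0.
move=> l /(torus_lattice_sub E)/(dual_lattice_simple E) lP l_lt.
have l0 i : dot l (a i) = 0.
  have aa : dot (a i) (a i) = 2 := E6_norm E (simple_root E i).
  apply/eqP; rewrite -[_ == _]negbK; apply/negP => nz.
  have := norm_intr_ge1 (lP i) nz.
  apply/negP; rewrite -ltNge.
  apply: (le_lt_trans (cauchy_schwarz _ _)).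
  have a2 : enorm (a i) <= 2.
    by rewrite -(@ler_pXn2r _ 2)// ?nnegrE ?enorm_ge0// sqr_enorm aa expr2; lra.
  apply: (le_lt_trans (ler_wpM2l _ a2)); first exact: sqrtr_ge0.
  by rewrite -ltr_pdivlMr// mul1r.
have [c cE] := base_span E l.
apply/eqP; rewrite -dot_eq0 [X in dot _ X]cE dot_sumr big1// => i _.
by rewrite dotZr l0 mulr0.
Qed.

Lemma class_homotopy_equivalent k : (k < 25)%nat -> homotopy_equivalent R
  (fixed_orbit_space (root_lattice Phi) (act a (class_word k)))
  (fixed_orbit_space (dual_lattice Phi) (act a (class_word k))).
Proof.
move=> k25; have /allP/(_ k) := class_certificates_ok; rewrite mem_iota /= => /(_ k25).
set c := nth _ _ _; rewrite /class_ok; set v0 := zaxis _ _ _.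
case/and4P => ord rootok dualok /eqP sz.
have v0_fixed u : weyl_centralizer Phi (act a (class_word k)) u -> u (vec a v0) = vec a v0.
  exact: (axis_fixed E).
have HS := torus_slice_system E ord rootok.
have := torus_slice_system E ord dualok.
move: HS; rewrite -sz => HS HS'.
have Pv : lattice_set (root_lattice Phi) (vec a v0) := vec_root_lattice E v0.
apply: (slices_equivalent_lattices (act_weyl E _) v0_fixed HS HS').
- exact: (torus_lattice_discrete false).
- exact: (torus_lattice_discrete true).
- exact: Pv.
- exact: (root_sub_dual E Pv).
- by move=> l /(root_sub_dual E); apply.
- by move=> l; apply.
Qed.
End base.

Theorem theorem6 (R : realType) (Phi : rootSystem R 6)
    (Phi_E6 : type_E6 Phi)
    (Phi_norm : forall a : 'rV[R]_6, root_set Phi a -> dot a a = 2)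
    (w : 'rV[R]_6 -> 'rV[R]_6) (w_weyl : weyl Phi w) :
  homotopy_equivalent R
    (fixed_orbit_space (root_lattice Phi) w)
    (fixed_orbit_space (dual_lattice Phi) w).
Proof.
case: Phi_E6 => a base cartan.
have E : E6_base Phi a by split.
have [k [u [k25 Wu uw]]] := weyl_class E w_weyl.
have [v [Wv uv vu _]] := weyl_inv Wu.
suff -> : w = act (v \o a) (class_word k).
  exact: (class_homotopy_equivalent (E6_base_weyl Wv E)).
apply/funext => x; have := act_base_weyl a (class_word k) (u x) Wv.
by rewrite uv -uw uv => <-.
Qed.
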